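(* Let $G/P$ be cominuscule, with associated poset $\Lambda_{G/P}$. (I) Any two standard fillings of a straight shape $\lambda\in\mathbb{Y}_{G/P}$ are dual equivalent. (II) $X,Y\in\mathrm{SYT}_{G/P}(\nu/\lambda)$ are dual equivalent if and only if they are connected by a chain of elementary Haiman moves. (III) There is a unique straight shape of size $m$ (where $m=m(G/P)$ is the integer specified in the context) having two standard fillings $T\equiv_D U$. All other pairs of dual equivalent tableaux of this size are obtained by applying a sequence of jeu de taquin slides to this pair.
   Context: Setting. $G$ is a complex connected reductive Lie group with root system $\Phi$, positive roots $\Phi^+$, simple roots $\Delta$; $P$ is a maximal parabolic subgroup associated to a simple root $\beta(P)$ that is cominuscule, i.e. if $\beta(P)$ occurs in the simple root expansion of $\gamma\in\Phi^+$ it does so with coefficient one. Then $G/P$ is called cominuscule. Order $\Phi^+$ by the transitive closure of the covering relations $\alpha\prec\gamma$ if $\gamma-\alpha\in\Delta$. Let $\Lambda_{G/P}\subseteq\Phi^+$ be the subposet of positive roots containing $\beta(P)$ in their simple root expansion; its elements are called boxes. Straight shapes are the lower order ideals of $\Lambda_{G/P}$; their set is $\mathbb{Y}_{G/P}$. For $\lambda\subseteq\nu$ in $\mathbb{Y}_{G/P}$, the set difference $\nu/\lambda$ is a skew shape; a straight shape $\nu$ is regarded as $\nu/\emptyset$. A standard filling (standard tableau) of shape $\nu/\lambda$ is a bijection $\mathrm{label}:\nu/\lambda\to\{1,\dots,|\nu/\lambda|\}$ with $\mathrm{label}(x)<\mathrm{label}(y)$ whenever $x\prec y$, where $|\nu/\lambda|$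 is the number of boxes; the set of these is $\mathrm{SYT}_{G/P}(\nu/\lambda)$. The size of a shape or tableau is its number of boxes. Slides. Let $T\in\mathrm{SYT}_{G/P}(\nu/\lambda)$ and let $x\in\lambda$ be maximal in $\prec$ subject to being below some box of $\nu/\lambda$. The jeu de taquin slide $\mathrm{jdt}_x(T)$ is obtained as follows: let $y$ be the box of $\nu/\lambda$ with smallest label among those covering $x$; move $\mathrm{label}(y)$ to $x$, leaving $y$ vacant; then move into $y$ the smallest label among the boxes of $\nu/\lambda$ covering $y$; repeat until no further move is possible. If $x\in\Lambda_{G/P}\setminus\nu$ is minimal in $\prec$ subject to being above some box of $\nu/\lambda$, the reverse jeu de taquin slide $\mathrm{revjdt}_x(T)$ is defined similarly, each time moving into the vacant box the largest label among the boxes of $\nu/\lambda$ covered by it. A sequence of slides is denoted by the sequence of boxes $(x_1,\dots,x_k)$ used. Dual equivalence. Tableaux $T,U$ are dual equivalent, $T\equiv_D U$, if any sequence of slides and reverse slides $(x_1,\dots,x_k)$ for $T$ and $U$ results in tableaux of the same shape (in particular $T$ and $U$ have the same shape). Haiman moves. For $\lambda\subseteq\mu\subseteq\nu$, and tableaux $A$ of shape $\mu/\lambda$ and $B$ of shape $\nu/\mu$, $A\coprod B$ is the tableau of shape $\nu/\lambda$ equal to $A$ on $\mu/\lambda$ and to $B$ with all labels increased by $|\mu/\lambda|$ on $\nu/\mu$. If $\lambda\subseteq\mu\subseteq\nu\subseteq\rho$, $A$ has shape $\mu/\lambda$, $T,U$ have shape $\nu/\mu$ with $T\equiv_D U$,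 and $B$ has shape $\rho/\nu$, then replacing $A\coprod T\coprod B$ by $A\coprod U\coprod B$ is a Haiman move. It is elementary if the number of boxes of $T$ and $U$ is $m=m(G/P)$ as below. The posets and the number $m$. Up to isomorphism the posets are sets of boxes $(i,j)$ ($i$ = column numbered from the left, $j$ = row numbered from the bottom), with covering relations going from a box to the box immediately to its right or immediately above it: - Grassmannian $Gr(k,\mathbb{C}^n)$ (type $A_{n-1}$): $1\le i\le n-k$, $1\le j\le k$; $m=3$. - Odd quadric $\mathbb{Q}^{2n-1}$ (type $B_n$): a chain of $2n-1$ boxes; no value of $m$ is assigned (every shape has exactly one filling, and every dual equivalence class has exactly one member), so (III) makes no claim in this case. - Lagrangian Grassmannian $LG(n,2n)$ (type $C_n$) and orthogonal Grassmannian $OG(n+1,2n+2)$: the height $n$ staircase $1\le j\le i\le n$; $m=4$. - Even quadric $\mathbb{Q}^{2n-2}$ (type $D_n$): row 1 has columns $1,\dots,n-1$, row 2 has columns $n-2,\dots,2n-4$; $m=n$. - Cayley plane $\mathbb{OP}^2$ (type $E_6$): rows 1–4 occupy columns $1$–$5$, $3$–$5$, $4$–$6$, $4$–$8$ respectively; $m=5$. - Freudenthal variety $G_\omega(\mathbb{O}^3,\mathbb{O}^6)$ (type $E_7$): rows 1–9 occupy columns $1$–$6$, $4$–$6$, $5$–$7$, $5$–$9$, $5$–$9$, $8$–$9$, $9$, $9$, $9$ respectively; $m=6$.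
   Formalization: Part (III) is stated only when the poset has two incomparable boxes: when it is a chain, e.g. Gr(1,C^n) or LG(2,4) and not only for odd quadrics, every shape has at most one standard filling, so (III) as written is false. *)

(* Defs.v *)
From mathcomp Require Import all_boot all_order all_algebra.
From mathcomp Require Import finmap.
From Stdlib Require Import Relations.

Set Implicit Arguments.
Unset Strict Implicit.
Unset Printing Implicit Defensive.

Import Order.TTheory GRing.Theory Num.Theory.
Local Open Scope ring_scope.

(* A root system lives in the Euclidean space 'rV[R]_n with its
   standard scalar product; it is not required to span, since the group is
   only reductive. *)

Definition dotv (R : realFieldType) (n : nat) (u v : 'rV[R]_n) : R :=
  (u *m v^T) 0 0.

Definition cartan_int (R : realFieldType) (n : nat) (g a : 'rV[R]_n) : R :=
  2 * dotv g a / dotv a a.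

Definition root_system (R : realFieldType) (n : nat)
    (Phi : {fset 'rV[R]_n}) : Prop :=
  [/\ 0 \notin Phi,
      forall (a : 'rV[R]_n) (c : R),
        a \in Phi -> c *: a \in Phi -> c = 1 \/ c = -1,
      forall a g : 'rV[R]_n,
        a \in Phi -> g \in Phi -> g - cartan_int g a *: a \in Phi
    & forall a g : 'rV[R]_n,
        a \in Phi -> g \in Phi -> exists z : int, cartan_int g a = z%:~R].

Definition simple_system (R : realFieldType) (n r : nat)
    (Phi : {fset 'rV[R]_n}) (Delta : r.-tuple 'rV[R]_n) : Prop :=
  [/\ free Delta,
      {subset Delta <= Phi}
    & forall g : 'rV[R]_n, g \in Phi ->
        exists c : 'I_r -> nat,
          let s := \sum_(i < r) tnth Delta i *+ c i in g = s \/ g = - s].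

(* For g in Phi, coord Delta i g is the coefficient of the i-th simple root in
   the simple root expansion of g. *)
Definition posroots (R : realFieldType) (n r : nat)
    (Phi : {fset 'rV[R]_n}) (Delta : r.-tuple 'rV[R]_n) : {fset 'rV[R]_n} :=
  [fset g in Phi | [forall i : 'I_r, 0 <= coord Delta i g]]%fset.

Definition cominuscule (R : realFieldType) (n r : nat)
    (Phi : {fset 'rV[R]_n}) (Delta : r.-tuple 'rV[R]_n) (b : 'I_r) : Prop :=
  forall g : 'rV[R]_n,
    g \in posroots Phi Delta -> coord Delta b g != 0 -> coord Delta b g = 1.

Definition root_le (R : realFieldType) (n r : nat)
    (Phi : {fset 'rV[R]_n}) (Delta : r.-tuple 'rV[R]_n) :
    rel (posroots Phi Delta) :=
  connect (fun a g => val g - val a \in Delta).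

(* The poset Lambda_{G/P}, where P is the maximal parabolic subgroup attached
   to the simple root tnth Delta b: its carrier and its order. *)
Definition box (R : realFieldType) (n r : nat)
    (Phi : {fset 'rV[R]_n}) (Delta : r.-tuple 'rV[R]_n) (b : 'I_r) : finType :=
  {g : posroots Phi Delta | coord Delta b (val g) != 0}.

Definition box_le (R : realFieldType) (n r : nat)
    (Phi : {fset 'rV[R]_n}) (Delta : r.-tuple 'rV[R]_n) (b : 'I_r) :
    rel (box Phi Delta b) :=
  fun x y => root_le (val x) (val y).

Local Close Scope ring_scope.

(* From here on, (B, le) is a finite poset. *)

Definition slt (B : finType) (le : rel B) : rel B :=
  fun x y => (x != y) && le x y.

Definition covered (B : finType) (le : rel B) : rel B :=
  fun x y => slt le x y && [forall z, ~~ (slt le x z && slt le z y)].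

Definition straight (B : finType) (le : rel B) (l : {set B}) : Prop :=
  forall x y, le x y -> y \in l -> x \in l.

(* A filling of a set of boxes is encoded by the labelling of all of B that is
   0 off that set, so that equality of fillings is equality of functions. *)
Definition filling (B : finType) := {ffun B -> nat}.

Definition shape (B : finType) (T : filling B) : {set B} :=
  [set x | T x != 0].

Definition SYT (B : finType) (le : rel B) (D : {set B}) (T : filling B) : Prop :=
  [/\ shape T = D,
      perm_eq [seq T x | x in D] (iota 1 #|D|)
    & {in D &, forall x y, slt le x y -> T x < T y}].

(* A skew shape D = nu / lambda is a set difference and does not
   remember lambda and nu.  This is harmless: the boxes of lambda that are
   below some box of D are exactly the boxes outside D below some box of D,
   and dually for the boxes outside nu. *)

Definition below (B : finType) (le : rel B) (D : {set B}) : {set B} :=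
  [set x | (x \notin D) && [exists y in D, slt le x y]].

Definition above (B : finType) (le : rel B) (D : {set B}) : {set B} :=
  [set x | (x \notin D) && [exists y in D, slt le y x]].

Definition inner_corner (B : finType) (le : rel B) (D : {set B}) : pred B :=
  fun x => (x \in below le D) && [forall y in below le D, ~~ slt le x y].

Definition outer_corner (B : finType) (le : rel B) (D : {set B}) : pred B :=
  fun x => (x \in above le D) && [forall y in above le D, ~~ slt le y x].

Definition jdt_next (B : finType) (le : rel B) (T : filling B) (y : B) :
    option B :=
  [pick z in shape T | covered le y z &
    [forall w in shape T, covered le y w ==> (T z <= T w)]].

Definition revjdt_next (B : finType) (le : rel B) (T : filling B) (y : B) :
    option B :=
  [pick z in shape T | covered le z y &
    [forall w in shape T, covered le w y ==> (T w <= T z)]].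

Definition move_label (B : finType) (T : filling B) (z y : B) : filling B :=
  [ffun w => if w == y then T z else if w == z then 0 else T w].

(* The second component of the state is the vacant box.  It moves strictly
   monotonically through B, so #|B| steps always reach a state from which no
   further move is possible. *)
Definition slide_step (B : finType) (next : filling B -> B -> option B)
    (s : filling B * B) : filling B * B :=
  if next s.1 s.2 is Some z then (move_label s.1 z s.2, z) else s.

Definition jdt (B : finType) (le : rel B) (x : B) (T : filling B) : filling B :=
  (iter #|B| (slide_step (jdt_next le)) (T, x)).1.

Definition revjdt (B : finType) (le : rel B) (x : B) (T : filling B) :
    filling B :=
  (iter #|B| (slide_step (revjdt_next le)) (T, x)).1.

(* slide and slides return None when a box is not a legal place to slide
   into.  For a skew shape no box is both an inner and an outer corner. *)
Definition slide (B : finType) (le : rel B) (x : B) (T : filling B) :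
    option (filling B) :=
  if inner_corner le (shape T) x then Some (jdt le x T)
  else if outer_corner le (shape T) x then Some (revjdt le x T)
  else None.

Fixpoint slides (B : finType) (le : rel B) (s : seq B) (T : filling B) :
    option (filling B) :=
  if s is x :: s' then obind (slides le s') (slide le x T) else Some T.

Definition dual_equiv (B : finType) (le : rel B) (T U : filling B) : Prop :=
  forall (s : seq B) (T' U' : filling B),
    slides le s T = Some T' -> slides le s U = Some U' -> shape T' = shape U'.

Definition coprod (B : finType) (S T : filling B) : filling B :=
  [ffun x => if x \in shape S then S x
             else if x \in shape T then T x + #|shape S| else 0].

Definition haiman_move (B : finType) (le : rel B) (k : nat)
    (X Y : filling B) : Prop :=
  exists (l m n p : {set B}) (S T U V : filling B),
    [/\ [/\ straight le l, straight le m, straight le n & straight le p],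
        [/\ l \subset m, m \subset n & n \subset p],
        [/\ SYT le (m :\: l) S, SYT le (n :\: m) T, SYT le (n :\: m) U
          & SYT le (p :\: n) V],
        #|n :\: m| = k /\ dual_equiv le T U
      & X = coprod (coprod S T) V /\ Y = coprod (coprod S U) V].

(* om is m(G/P), or None when no value is assigned; then there are no elementary moves. *)
Definition elementary_move (B : finType) (le : rel B) (om : option nat)
    (X Y : filling B) : Prop :=
  exists2 k, om = Some k & haiman_move le k X Y.

Definition elementary_chain (B : finType) (le : rel B) (om : option nat) :
    filling B -> filling B -> Prop :=
  clos_refl_trans (filling B) (elementary_move le om).

Inductive variety : Type :=
  | Gr of nat & nat      (* Gr k n : Gr(k, C^n) *)
  | OddQuadric of nat    (* OddQuadric n : Q^(2n-1) *)
  | LG of nat            (* LG n : LG(n, 2n) *)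
  | OG of nat            (* OG n : OG(n+1, 2n+2) *)
  | EvenQuadric of nat   (* EvenQuadric n : Q^(2n-2) *)
  | CayleyPlane
  | Freudenthal.

Definition variety_ok (t : variety) : bool :=
  match t with
  | Gr k n => 1 <= k < n
  | OddQuadric n | LG n | OG n => 1 <= n
  | EvenQuadric n => 3 <= n
  | CayleyPlane | Freudenthal => true
  end.

Definition mnum (t : variety) : option nat :=
  match t with
  | Gr _ _ => Some 3
  | OddQuadric _ => None
  | LG _ | OG _ => Some 4
  | EvenQuadric n => Some n
  | CayleyPlane => Some 5
  | Freudenthal => Some 6
  end.

(* The rows are listed from the bottom, each by its first and last columns. *)
Definition in_rows (rows : seq (nat * nat)) (p : nat * nat) : bool :=
  (1 <= p.2 <= size rows) &&
  (let: (c, d) := nth (1, 0) rows p.2.-1 in c <= p.1 <= d).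

(* p.1 is the column and p.2 the row. *)
Definition boxes (t : variety) (p : nat * nat) : bool :=
  match t with
  | Gr k n => (1 <= p.1 <= n - k) && (1 <= p.2 <= k)
  | OddQuadric n => in_rows [:: (1, 2 * n - 1)] p
  | LG n | OG n => (1 <= p.2 <= p.1) && (p.1 <= n)
  | EvenQuadric n => in_rows [:: (1, n - 1); (n - 2, 2 * n - 4)] p
  | CayleyPlane => in_rows [:: (1, 5); (3, 5); (4, 6); (4, 8)] p
  | Freudenthal => in_rows [:: (1, 6); (4, 6); (5, 7); (5, 9); (5, 9); (8, 9);
                               (9, 9); (9, 9); (9, 9)] p
  end.

Definition right_or_up (p q : nat * nat) : bool :=
  (q == (p.1.+1, p.2)) || (q == (p.1, p.2.+1)).

(* A finite poset is determined by its covering relations, so an isomorphism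
   is a bijection that matches them. *)
Definition has_type (B : finType) (le : rel B) (t : variety) : Prop :=
  variety_ok t /\
  exists f : B -> nat * nat,
    [/\ injective f,
        forall p, boxes t p <-> exists x, f x = p
      & forall x y, covered le x y = right_or_up (f x) (f y)].

(* Main.v *)
From Stdlib Require Import Relations.
From mathcomp Require Import all_boot all_order all_algebra.
From mathcomp Require Import finmap zify.
Require Import Defs.

Set Implicit Arguments.
Unset Strict Implicit.
Unset Printing Implicit Defensive.

(** A standard filling is a linear extension of its shape, so it can be written
as the word of its boxes in increasing order of labels.  In this form a jeu de
taquin slide is a single scan of the word (lemma [jdt_filling_of]): the vacancy
passes over each letter that does not cover it and changes places with each
letter that does.  Therefore a slide of a concatenation slides the factors one
after the other, scanning back for the opposite order undoes a slide
([pushK]), and reverse slides are the slides of the reversed words in the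
opposite order.

Call a relation between words on the same boxes stable if slides and reverse
slides preserve it and vacate the same box on both sides.  Stable relations
imply dual equivalence ([stable_dual]), dual equivalence is itself stable
([dual_words_stable]), and so is the replacement of a factor by a related one
([in_context_stable]).  Consequently Haiman moves preserve dual equivalence,
and a slide turns a Haiman move into a Haiman move.  Every word can be slid to
a straight shape ([rectify]), and all slides can be undone; so the three claims
follow from two properties of straight shapes
([dual_equivalence_of_windows]):
- [window_prop]: for two maximal boxes [c] and [c'] of a straight shape there
  are two dual equivalent words with [m] letters, on the same boxes, that can
  come last in a filling of this shape, one ending with [c] and one with [c'];
  induction on the size then joins any two fillings of a straight shape by
  elementary moves ([connected]);
- [seed_prop]: unless the poset is a chain, exactly one pair of distinct fillings
  of a common straight shape of size [m] exists, and its members are dual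
  equivalent.

These are proved family by family.  In a rectangle or a staircase, give a box
its diagonal as a colour.  Two letters that are next to each other in a word
form a covering pair exactly when their colours differ by one ([color_adj]), so
that the slide of a word can be read off its colours.  The relations [knuth3]
and [knuth4] on words of three and four colours, which are the dual Knuth
relations and their shifted analogues, are closed under slides: only the
relative order of the colours and the adjacencies matter, so all gaps can be
squeezed to at most two, and finitely many words remain to be checked.  In an
even quadric, words with [m] letters on the same boxes always vacate the same
box, because a shape of that size with two maximal boxes leaves no room below
it.  For the two exceptional varieties the pairs obtained from the smallest one
by slides form finite tables, of 58 and 379 pairs, and the required properties
of these tables are checked by computation. *)

(** * Slides of words *)

Definition flip (T : Type) (r : rel T) : rel T := fun x y => r y x.

Section Push.
Variables (T : eqType) (c : rel T).

(** The first component is the word after the scan and the second one is the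
box that ends up vacant. *)
Fixpoint push (a : T) (s : seq T) : seq T * T :=
  if s is t :: s' then
    if c a t then let r := push t s' in (a :: r.1, r.2)
    else let r := push a s' in (t :: r.1, r.2)
  else ([::], a).

Lemma push_cat a s1 s2 :
  push a (s1 ++ s2) =
  ((push a s1).1 ++ (push (push a s1).2 s2).1, (push (push a s1).2 s2).2).
Proof.
elim: s1 a => [|t s1 IH] a /=; first by case: (push a s2).
by case: ifP => _; rewrite IH.
Qed.

Lemma size_push a s : size (push a s).1 = size s.
Proof. by elim: s a => //= t s IH a; case: ifP => _ /=; rewrite IH. Qed.

Lemma push_perm a s : perm_eq (rcons (push a s).1 (push a s).2) (a :: s).
Proof.
elim: s a => //= t s IH a; case: ifP => _ /=; first by rewrite perm_cons IH.
apply: (@perm_trans _ (t :: a :: s)); first by rewrite perm_cons IH.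
by apply/permP => p /=; lia.
Qed.

Lemma mem_push a s x :
  (x \in a :: s) = (x == (push a s).2) || (x \in (push a s).1).
Proof. by rewrite -(perm_mem (push_perm a s)) mem_rcons inE. Qed.

Lemma push_id a s : ~~ has (c a) s -> push a s = (s, a).
Proof. by elim: s => //= t s IH; rewrite negb_or => /andP [/negbTE -> /IH ->]. Qed.

End Push.

Lemma map_push (T U : eqType) (g : T -> U) (c : rel T) (d : rel U) a s :
  (forall x y, c x y = d (g x) (g y)) ->
  push d (g a) (map g s) = (map g (push c a s).1, g (push c a s).2).
Proof.
move=> cd; elim: s a => //= t s IH a.
by rewrite cd; case: ifP => _; rewrite IH.
Qed.

(** Read backwards, each step of the scan is a step of the scan for the opposite
relation: a letter that took the vacancy gives it back, and a letter that was
passed over is passed over again, since later letters are never covered by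
earlier ones. *)
Lemma pushK (T : eqType) (c : rel T) a s :
  pairwise (fun x y => ~~ c y x) (a :: s) ->
  push (flip c) (push c a s).2 (rev (push c a s).1) = (rev s, a).
Proof.
elim: s a => //= t s IH a /andP [/andP [cta ca] /andP [ct cs]].
case: ifP => cat /=.
  rewrite rev_cons -cats1 push_cat IH /=; last by rewrite ct cs.
  by rewrite /flip cat /= rev_cons cats1.
rewrite rev_cons -cats1 push_cat IH /=; last by rewrite ca cs.
by rewrite /flip (negbTE cta) /= rev_cons cats1.
Qed.

Definition partial_order (T : Type) (r : rel T) := [/\ reflexive r,
  antisymmetric r & transitive r].

Lemma partial_order_flip (T : Type) (r : rel T) : partial_order r -> partial_order (flip r).
Proof.
case=> rr ra rt; split=> [x|x y|y x z xy yz]; rewrite /flip //.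
  by rewrite andbC; apply: ra.
exact: rt yz xy.
Qed.

Section Poset.
Variables (B : finType) (le : rel B).
Hypothesis le_order : partial_order le.

Let le_refl : reflexive le. Proof. by case: le_order. Qed.
Let le_anti : antisymmetric le. Proof. by case: le_order. Qed.
Let le_trans : transitive le. Proof. by case: le_order. Qed.

Notation cov := (covered le).

Lemma covered_le x y : cov x y -> le x y.
Proof. by case/andP => /andP []. Qed.

Definition lin_ext (w : seq B) := pairwise (fun x y => ~~ le y x) w.

Definition convex (w : seq B) :=
  forall x y z, x \in w -> z \in w -> le x y -> le y z -> y \in w.

(** The words of the standard fillings of skew shapes: the convex subsets of a
poset are the differences of two order ideals. *)
Definition valid w := lin_ext w /\ convex w.

Lemma lin_ext_uniq w : lin_ext w -> uniq w.
Proof.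
by apply: pairwise_uniq => x; rewrite le_refl.
Qed.

Lemma lin_ext_cat s1 s2 :
  lin_ext (s1 ++ s2) = [&& lin_ext s1, lin_ext s2 & all (fun x => all (fun y =>
    ~~ le y x) s2) s1].
Proof. by rewrite /lin_ext pairwise_cat /allrel andbC -andbA. Qed.

Lemma valid_mid s1 s2 s3 : valid (s1 ++ s2 ++ s3) -> valid s2.
Proof.
rewrite /valid !lin_ext_cat => -[/and3P [l1 /and3P [l2 l3 a23] a123] cx].
split=> // x y z xs zs xy yz.
have := cx x y z; rewrite !mem_cat xs zs !orbT => /(_ isT isT xy yz).
case/or3P=> // ys.
  move/allP: a123 => /(_ y ys); rewrite all_cat => /andP [/allP /(_ x xs)].
  by rewrite xy.
by move/allP: a23 => /(_ z zs) /allP /(_ y ys); rewrite yz.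
Qed.

Lemma valid_prefix s1 s2 : valid (s1 ++ s2) -> valid s1.
Proof. exact: (@valid_mid [::]). Qed.

Lemma valid_suffix s1 s2 : valid (s1 ++ s2) -> valid s2.
Proof. by rewrite -{1}[s2]cats0; apply: valid_mid. Qed.

Lemma valid_eq w w' : lin_ext w' -> w =i w' -> valid w -> valid w'.
Proof.
move=> lw' ww' [lw cw]; split=> // x y z; rewrite -!ww'; exact: cw.
Qed.

(** A box strictly between two consecutive letters would have to be a letter, by
convexity, and there is no place for it. *)
Lemma valid_adj p a t s : valid (p ++ a :: t :: s) -> le a t -> cov a t.
Proof.
move=> vw at_; have vv : valid [:: a; t].
  by apply: (@valid_mid p _ s); rewrite /=.
case: vv => lv cv.
have nta : ~~ le t a by case/andP: lv => /andP [].
have neq : a != t by apply: contraNneq nta => ->.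
rewrite /covered /slt at_ neq /=; apply/forallP => z.
apply/negP => /andP [/andP [az laz] /andP [zt lzt]].
have := cv a z t; rewrite !inE !eqxx !orbT => /(_ isT isT laz lzt).
by rewrite eq_sym (negbTE az) (negbTE zt).
Qed.

Lemma valid_swap p a t s : valid (p ++ a :: t :: s) -> ~~ cov a t ->
  valid (p ++ t :: a :: s).
Proof.
move=> vw cat.
have nle : ~~ le a t by apply: contra cat => /(valid_adj vw).
apply: (valid_eq _ _ vw); last first.
  by move=> x; rewrite !mem_cat !inE; case: (x \in p); case: (x == a); case: (x == t).
case: (vw) => + _; rewrite !lin_ext_cat /lin_ext /=.
case/and3P => -> /andP [/andP [ta as_] /andP [ts ls]] /allP al.
rewrite nle as_ ts ls /=.
by apply/allP => x /al /= /and3P [-> -> ->].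
Qed.

(** The word of the shape with the new box [a] is changed by the scan only through
exchanges of consecutive letters that are not comparable, so it remains the
word of a filling of the same boxes. *)
Lemma valid_push_cat p a s q : valid (p ++ a :: s ++ q) ->
  valid (p ++ (push cov a s).1 ++ (push cov a s).2 :: q).
Proof.
elim: s p a => [|t s IH] p a //= vw.
case: ifP => cat /=; rewrite -cat_rcons; apply: IH; rewrite cat_rcons //.
by apply: valid_swap; rewrite ?cat.
Qed.

Lemma valid_push a s : valid (a :: s) ->
  valid (rcons (push cov a s).1 (push cov a s).2).
Proof. by move=> v; rewrite -cats1; apply: (@valid_push_cat [::]); rewrite cats0. Qed.

Lemma push_le a s : le a (push cov a s).2.
Proof.
elim: s a => //= t s IH a; case: ifP => //= cat.
exact: le_trans (covered_le cat) (IH t).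
Qed.

Definition filling_of (w : seq B) : filling B :=
  [ffun x => if x \in w then (index x w).+1 else 0].

Lemma shape_filling_of w : shape (filling_of w) = [set x in w].
Proof. by apply/setP => x; rewrite !inE ffunE; case: ifP. Qed.

Lemma shape_filling_eq w w' : shape (filling_of w) = shape (filling_of w') <-> w =i w'.
Proof.
rewrite !shape_filling_of; split=> [/setP e x|e]; first by have:= e x; rewrite !inE.
by apply/setP => x; rewrite !inE e.
Qed.

Lemma filling_of_inj w w' : uniq w -> uniq w' -> filling_of w = filling_of w' -> w = w'.
Proof.
move=> uw uw' e.
have ww' : w =i w' by apply/shape_filling_eq; rewrite e.
have sz : size w = size w' by apply/perm_size; rewrite uniq_perm.
case Ew: {1}w => [|x0 w0]; first by move: sz; rewrite Ew; case: (w').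
rewrite -Ew; apply: (@eq_from_nth _ x0) => // i iw.
have xw : nth x0 w i \in w by rewrite mem_nth.
move/ffunP: e => /(_ (nth x0 w i)); rewrite !ffunE -ww' xw => -[].
by rewrite index_uniq // => ei; rewrite [in RHS]ei nth_index -?ww'.
Qed.

Lemma SYT_filling_of w : lin_ext w -> SYT le [set x in w] (filling_of w).
Proof.
move=> lw; have uw := lin_ext_uniq lw; split; first exact: shape_filling_of.
  have -> : #|[set x in w]| = size w by rewrite cardsE; apply/card_uniqP.
  have -> : iota 1 (size w) = [seq filling_of w x | x <- w].
    case: w uw {lw} => // x0 w uw; apply: (@eq_from_nth _ 0) => [|i].
      by rewrite size_iota size_map.
    rewrite size_iota => iw; rewrite nth_iota // (nth_map x0) // ffunE.
    by rewrite mem_nth // index_uniq.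
  apply: perm_map; apply: uniq_perm => //; first exact: enum_uniq.
  by move=> x; rewrite mem_enum inE.
move=> x y; rewrite !inE => xw yw /andP [xy lxy]; rewrite !ffunE xw yw ltnS.
rewrite ltnNge; apply/negP => ixy.
have iyx : index y w < index x w.
  rewrite ltn_neqAle ixy andbT; apply: contraNneq xy => e.
  by rewrite -(nth_index x xw) -e nth_index.
have := pairwiseP x lw (index y w) (index x w); rewrite !inE !index_mem yw xw.
by move=> /(_ isT isT iyx); rewrite !nth_index // lxy.
Qed.

(** The word lists the boxes by increasing label. *)
Lemma SYT_word D T : SYT le D T -> exists w, [/\ lin_ext w, [set x in w] = D & T = filling_of w].
Proof.
case=> sh pe inc.
pose w := sort (relpre T leq) (enum D).
have wD : w =i D by move=> x; rewrite mem_sort mem_enum.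
have uw : uniq w by rewrite sort_uniq enum_uniq.
have Tw : map T w = iota 1 #|D|.
  apply: (@sorted_eq _ leq); [exact: leq_trans|exact: anti_leq| | |].
  - by rewrite sorted_map; apply: sort_sorted => x y; apply: leq_total.
  - exact: iota_sorted.
  - apply: (perm_trans _ pe); apply: perm_map; exact/permEl/perm_sort.
have Tx x : x \in w -> T x = (index x w).+1.
  move=> xw; have iw : index x w < size w by rewrite index_mem.
  have <- : nth 0 (map T w) (index x w) = T x by rewrite (nth_map x) // nth_index.
  rewrite Tw nth_iota ?add1n //.
  by rewrite -(size_iota 1 #|D|) -Tw size_map.
exists w; split; last first.
- apply/ffunP => x; rewrite ffunE; case: ifP => [/Tx //|].
  by rewrite wD -sh inE => /negbFE /eqP.
- by apply/setP => x; rewrite inE wD.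
have : sorted ltn (map T w) by rewrite Tw; apply: iota_ltn_sorted.
rewrite (sorted_pairwise ltn_trans) pairwise_map.
apply: (@sub_in_pairwise _ (mem w)); last exact/allP.
move=> x y /=; rewrite !wD => xD yD Txy; apply/negP => yx.
have : T y < T x.
  by apply: inc; rewrite // /slt yx andbT; apply: contraTneq Txy => ->; rewrite ltnn.
by rewrite ltnNge ltnW.
Qed.

End Poset.

(** * Slides of fillings are slides of words *)

Section Slides.
Variables (B : finType) (le : rel B).
Hypothesis le_order : partial_order le.

Let le_refl : reflexive le. Proof. by case: le_order. Qed.
Let le_anti : antisymmetric le. Proof. by case: le_order. Qed.
Let le_trans : transitive le. Proof. by case: le_order. Qed.

Notation cov := (covered le).

Lemma filling_of_cat (p s : seq B) x : x \in p ++ s ->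
  filling_of (p ++ s) x = if x \in p then (index x p).+1 else (size p + index x s).+1.
Proof. by move=> xps; rewrite ffunE xps index_cat; case: ifP. Qed.

(** None of the letters in [p], which have been scanned already, lies above [a];
therefore the next letter to cover [a] carries the smallest label among all that
do. *)
Lemma jdt_next_some p a t s : lin_ext le (p ++ a :: t :: s) -> cov a t ->
  jdt_next le (filling_of (p ++ t :: s)) a = Some t.
Proof.
move=> lw cat; have uw := lin_ext_uniq le_order lw.
have nop z : cov a z -> z \notin p.
  move=> /covered_le az; apply/negP => zp; move: lw; rewrite lin_ext_cat.
  by case/and3P => _ _ /allP /(_ z zp) /= /andP []; rewrite az.
have tin : t \in p ++ t :: s by rewrite mem_cat inE eqxx orbT.
have ft : filling_of (p ++ t :: s) t = (size p).+1.
  by rewrite filling_of_cat // (negbTE (nop _ cat)) /= eqxx addn0.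
rewrite /jdt_next; case: pickP => [z|/(_ t)].
  rewrite shape_filling_of inE => /and3P [zw az /forall_inP min].
  have := min t; rewrite inE => /(_ tin); rewrite cat ft => /= zt.
  congr Some; move: zt; rewrite filling_of_cat // (negbTE (nop _ az)) /=.
  by case: (t =P z) => [//|_]; rewrite ltnS addnS ltnNge leq_addr.
rewrite shape_filling_of inE tin cat /= => /forall_inP []; move=> z; rewrite inE => zw.
by apply/implyP => az; rewrite ft filling_of_cat // (negbTE (nop _ az)) ltnS leq_addr.
Qed.

Lemma jdt_next_none (w : seq B) a : ~~ has (cov a) w -> jdt_next le (filling_of w) a = None.
Proof.
move=> /hasPn nw; rewrite /jdt_next; case: pickP => // z.
by rewrite shape_filling_of inE => /and3P [/nw /negbTE ->].
Qed.

Lemma revjdt_next_some p a t s : lin_ext le (s ++ t :: a :: p) -> cov t a ->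
  revjdt_next le (filling_of (s ++ t :: p)) a = Some t.
Proof.
move=> lw cat; have uw := lin_ext_uniq le_order lw.
have nop z : cov z a -> z \notin p.
  move=> /covered_le az; apply/negP => zp; move: lw; rewrite lin_ext_cat /lin_ext /=.
  by case/and3P => _ /and3P [_ /allP /(_ z zp)]; rewrite az.
have ts : t \notin s.
  by move: uw; rewrite cat_uniq => /and3P [_ /hasPn /(_ t)]; rewrite inE eqxx => /(_ isT).
have tin : t \in s ++ t :: p by rewrite mem_cat inE eqxx orbT.
have ft : filling_of (s ++ t :: p) t = (size s).+1.
  by rewrite filling_of_cat // (negbTE ts) /= eqxx addn0.
have lt z : z \in s -> filling_of (s ++ t :: p) z < (size s).+1.
  by move=> zs; rewrite filling_of_cat ?mem_cat ?zs // ltnS index_mem.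
rewrite /revjdt_next; case: pickP => [z|/(_ t)].
  rewrite shape_filling_of inE => /and3P [zw az /forall_inP min].
  have := min t; rewrite inE => /(_ tin); rewrite cat ft => /= zt.
  move: zw; rewrite mem_cat inE (negbTE (nop _ az)) orbF => /orP [/lt|/eqP -> //].
  by rewrite ltnNge zt.
rewrite shape_filling_of inE tin cat /= => /forall_inP []; move=> z; rewrite inE => zw.
apply/implyP => az; rewrite ft.
by move: zw; rewrite mem_cat inE (negbTE (nop _ az)) orbF => /orP [/lt/ltnW|/eqP ->]; rewrite ?ft.
Qed.

Lemma revjdt_next_none (w : seq B) a : ~~ has (cov^~ a) w ->
  revjdt_next le (filling_of w) a = None.
Proof.
move=> /hasPn nw; rewrite /revjdt_next; case: pickP => // z.
by rewrite shape_filling_of inE => /and3P [/nw /= /negbTE ->].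
Qed.

Lemma move_label_filling (p s : seq B) a t : uniq (p ++ a :: t :: s) ->
  move_label (filling_of (p ++ t :: s)) t a = filling_of (p ++ a :: s).
Proof.
rewrite cat_uniq /= !inE !negb_or -!andbA.
case/and5P=> up ap tp hs /and4P [at_ as_ ts us].
apply/ffunP => x; rewrite !ffunE !mem_cat !inE !index_cat (negbTE tp) eqxx orbT /=.
case: (x =P a) => [->|xa]; first by rewrite (negbTE ap) orbT /= !eqxx.
case: (x =P t) => [->|xt].
  by rewrite (negbTE tp) (negbTE ts) /= .
by rewrite [t == x]eq_sym [a == x]eq_sym (introF eqP xa) (introF eqP xt).
Qed.

Lemma move_label_filling' (p s : seq B) a t : uniq (s ++ t :: a :: p) ->
  move_label (filling_of (s ++ t :: p)) t a = filling_of (s ++ a :: p).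
Proof.
move=> u; apply: move_label_filling; move: u; rewrite !cat_uniq /= !inE !negb_or.
by rewrite (eq_sym t a) => /andP [-> /andP [/and3P [-> -> ->] /and3P [/andP [-> ->] -> ->]]].
Qed.

(** The prefix [p] is the part of the word already scanned.  The bound on [n] is
the fuel: only the letters still to be scanned can move. *)
Lemma iter_jdt n p a s : valid le (p ++ a :: s) -> size s <= n ->
  iter n (slide_step (jdt_next le)) (filling_of (p ++ s), a) =
  (filling_of (p ++ (push cov a s).1), (push cov a s).2).
Proof.
elim: s n p a => [|t s IH] n p a vw; have lw := vw.1.
  move=> _; apply: iter_fix; rewrite /slide_step /= cats0 jdt_next_none //.
  apply/hasPn => x xp; apply/negP => /covered_le ax.
  by move: lw; rewrite lin_ext_cat => /and3P [_ _ /allP /(_ x xp) /=]; rewrite ax.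
move=> /= sn; case: ifP => cat /=.
  case: n sn => // n sn; rewrite iterSr /slide_step /= (jdt_next_some lw cat).
  rewrite move_label_filling ?(lin_ext_uniq le_order lw) // -!cat_rcons IH //.
  by rewrite cat_rcons.
rewrite -!cat_rcons IH ?(ltnW sn) // cat_rcons; apply: (valid_swap le_order vw).
by rewrite cat.
Qed.

(** The word is scanned from its end, so the induction runs on the reversal of
the part that remains. *)
Lemma iter_revjdt n p a s : valid le (rev s ++ a :: p) -> size s <= n ->
  iter n (slide_step (revjdt_next le)) (filling_of (rev s ++ p), a) =
  (filling_of (rev (push (flip cov) a s).1 ++ p), (push (flip cov) a s).2).
Proof.
elim: s n p a => [|t s IH] n p a vw; have lw := vw.1.
  move=> _; apply: iter_fix; rewrite /slide_step /= revjdt_next_none //.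
  apply/hasPn => x xp; apply/negP => /covered_le ax.
  by move: lw; rewrite /lin_ext /= => /andP [/allP /(_ x xp)]; rewrite ax.
move: vw lw; rewrite rev_cons cat_rcons => vw lw /= sn.
rewrite {1}/flip; case: ifP => cat /=; rewrite ?rev_cons ?cat_rcons.
  case: n sn => // n sn; rewrite iterSr /slide_step /= (revjdt_next_some lw cat).
  by rewrite move_label_filling' ?(lin_ext_uniq le_order lw) // IH.
rewrite IH ?(ltnW sn) //.
by apply: (valid_swap le_order vw); rewrite cat.
Qed.

Lemma jdt_filling_of a s : valid le (a :: s) ->
  jdt le a (filling_of s) = filling_of (push cov a s).1.
Proof.
move=> v; rewrite /jdt (@iter_jdt _ [::]) //.
by have /andP [_ /card_uniqP <-] := lin_ext_uniq le_order v.1; apply: max_card.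
Qed.

Lemma revjdt_filling_of a s : valid le (rcons s a) ->
  revjdt le a (filling_of s) = filling_of (rev (push (flip cov) a (rev s)).1).
Proof.
move=> v; have u := lin_ext_uniq le_order v.1.
rewrite /revjdt -[in filling_of s](cats0 s) -[in filling_of (s ++ _)](revK s) iter_revjdt ?cats0 //.
  by rewrite revK cats1.
move: u; rewrite rcons_uniq size_rev => /andP [_ /card_uniqP <-].
exact: max_card.
Qed.

Definition enters (s : seq B) (a : B) := inner_corner le [set x in s] a.

(** A corner is exactly a box that can be put in front of the word and that lies
below some letter: its maximality among the boxes below the shape is convexity
of the enlarged set. *)
Lemma entersP s a : valid le s ->
  enters s a <-> valid le (a :: s) /\ has (le a) s.
Proof.
move=> vs; rewrite /enters /inner_corner !inE -andbA; split.
  case/and3P => ans /exists_inP [t ts /andP [_ at_]] /forallP mx.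
  rewrite inE in ts.
  split; last by apply/hasP; exists t.
  split.
    rewrite /lin_ext /=; apply/andP; split; last exact: vs.1.
    apply/allP => y ys; apply: contra ans => ya.
    exact: (vs.2 y a t).
  have key y z : z \in s -> le a y -> le y z -> y \in a :: s.
    move=> zs ay yz; rewrite inE; case: eqP => //= /eqP ya; apply: contraTT (mx y) => ys.
    rewrite !inE ys negb_imply negbK; apply/andP; split; last by rewrite /slt eq_sym ya.
    apply/exists_inP; exists z; rewrite ?inE // /slt yz andbT.
    by apply: contraNneq ys => ->.
  move=> x y z; rewrite ![_ \in a :: s]inE.
  case/predU1P => [->|xs] /predU1P [->|zs] xy yz.
  - by rewrite (@le_anti y a) ?eqxx // xy yz.
  - by have := key _ _ zs xy yz; rewrite inE.
  - by rewrite (vs.2 x y t xs ts xy (le_trans yz at_)) orbT.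
  - by rewrite (vs.2 x y z xs zs) ?orbT.
case=> -[la ca] /hasP [t ts at_].
have ans : a \notin s by have := lin_ext_uniq le_order la => /andP [].
apply/and3P; split=> //.
  apply/exists_inP; exists t; rewrite ?inE // /slt at_ andbT.
  by apply: contraNneq ans => ->.
apply/forall_inP => y; rewrite !inE => /andP [ys /exists_inP [z]].
rewrite inE => zs /andP [_ yz]; apply/negP => /andP [ay lay].
have := ca a y z; rewrite !inE eqxx zs orbT => /(_ isT isT lay yz).
by rewrite (negbTE ys) eq_sym (negbTE ay).
Qed.
End Slides.

(** * Relations preserved by slides *)

Lemma slt_flip (B : finType) (le : rel B) x y : slt (flip le) x y = slt le y x.
Proof. by rewrite /slt eq_sym. Qed.

Lemma covered_flip (B : finType) (le : rel B) x y :
  covered (flip le) x y = covered le y x.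
Proof.
rewrite /covered (slt_flip le x y); congr (_ && _); apply: eq_forallb => z.
by rewrite (slt_flip le x z) (slt_flip le z y) andbC.
Qed.

Lemma outer_corner_flip (B : finType) (le : rel B) D x :
  outer_corner le D x = inner_corner (flip le) D x.
Proof.
have e : above le D = below (flip le) D.
  apply/setP => y; rewrite !inE; congr (_ && _); apply: eq_existsb => z.
  by rewrite (slt_flip le y z).
rewrite /outer_corner /inner_corner e; congr (_ && _); apply: eq_forallb => y.
by rewrite (slt_flip le x y).
Qed.

Lemma eq_push (T : eqType) (c d : rel T) : c =2 d -> push c =2 push d.
Proof. by move=> cd a s; elim: s a => //= t s IH a; rewrite cd !IH. Qed.

Lemma lin_ext_rev (B : finType) (le : rel B) s : lin_ext (flip le) (rev s) = lin_ext le s.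
Proof.
elim: s => //= a s IH; rewrite rev_cons /lin_ext pairwise_rcons -/(lin_ext _ _) IH all_rev.
by congr (_ && _).
Qed.

Lemma valid_rev (B : finType) (le : rel B) s : valid (flip le) (rev s) <-> valid le s.
Proof.
rewrite /valid lin_ext_rev; split=> -[-> cs]; split=> // x y z.
  by move=> xs zs xy yz; have := cs z y x; rewrite !mem_rev; apply.
by rewrite !mem_rev => xs zs xy yz; apply: (cs z y x).
Qed.

Lemma valid_revW (B : finType) (le : rel B) s : valid le s -> valid (flip le) (rev s).
Proof. by move/valid_rev. Qed.

Lemma valid_revE (B : finType) (le : rel B) s : valid (flip le) s -> valid le (rev s).
Proof. exact: (@valid_revW _ (flip le)). Qed.

Lemma valid_revK (B : finType) (le : rel B) s : valid le (rev s) -> valid (flip le) s.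
Proof. by move/valid_revW; rewrite revK. Qed.

Section Stable.
Variable (B : finType).
Implicit Types (le : rel B) (X Y : seq B) (Q : seq B -> seq B -> Prop).

Definition word_slide le (a : B) (s : seq B) : option (seq B) :=
  if enters le s a then Some (push (covered le) a s).1
  else if enters (flip le) (rev s) a then
    Some (rev (push (covered (flip le)) a (rev s)).1)
  else None.

Lemma enters_eq le X Y a : X =i Y -> enters le X a = enters le Y a.
Proof. by move=> e; rewrite /enters (_ : [set x in X] = [set x in Y]) //; apply/setP => x;
  rewrite !inE. Qed.

Lemma enters_excl le s a : partial_order le -> valid le s -> enters le s a ->
  ~~ enters (flip le) (rev s) a.
Proof.
move=> le_order vs /(entersP le_order a vs) [[la ca] /hasP [t ts at_]]; apply/negP.
case/(entersP (partial_order_flip le_order) a (valid_revW vs)) => _ /hasP [u].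
rewrite mem_rev /flip => us ua.
have [/negP ans _] := andP (lin_ext_uniq le_order la); apply: ans.
exact: (vs.2 u a t).
Qed.

Lemma word_slide_inner le s a : enters le s a ->
  word_slide le a s = Some (push (covered le) a s).1.
Proof. by rewrite /word_slide => ->. Qed.

Lemma word_slide_outer le s a : partial_order le -> valid (flip le) s -> enters (flip le) s a ->
  word_slide le a (rev s) = Some (rev (push (covered (flip le)) a s).1).
Proof.
move=> le_order vs i; rewrite /word_slide revK i.
by rewrite (negbTE (enters_excl (partial_order_flip le_order) vs i)).
Qed.

Lemma word_slide_flip le s a : partial_order le -> valid le s ->
  word_slide (flip le) a (rev s) = omap rev (word_slide le a s).
Proof.
move=> le_order vs; rewrite /word_slide revK.
have -> : enters (flip (flip le)) s a = enters le s a by [].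
case: (boolP (enters le s a)) => i; first by rewrite (negbTE (enters_excl le_order vs i)).
by case: ifP => //= _; rewrite revK.
Qed.

Lemma valid_pushed le a s : partial_order le -> valid le (a :: s) ->
  valid le (push (covered le) a s).1.
Proof. by move=> le_order /(valid_push le_order); rewrite -cats1; apply: valid_prefix. Qed.

Lemma word_slide_valid le a s s' : partial_order le -> valid le s ->
  word_slide le a s = Some s' -> valid le s'.
Proof.
move=> le_order vs; rewrite /word_slide; case: ifP => [/(entersP le_order a vs) [v _] [<-]|_].
  exact: valid_pushed.
have vr := valid_revW vs; have flip_order := partial_order_flip le_order.
case: ifP => // /(entersP flip_order a vr) [v _] [<-].
by apply: valid_revE; apply: valid_pushed.
Qed.

Lemma slide_filling_of le a s : partial_order le -> valid le s ->
  slide le a (filling_of s) = omap (@filling_of B) (word_slide le a s).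
Proof.
move=> le_order vs; rewrite /slide /word_slide shape_filling_of outer_corner_flip.
rewrite -/(enters le s a); case: ifP => [/(entersP le_order a vs) [v _]|_ /=].
  by rewrite jdt_filling_of.
have vr := valid_revW vs; have flip_order := partial_order_flip le_order.
rewrite -/(enters (flip le) s a) (@enters_eq _ s (rev s)); last by move=> x; rewrite mem_rev.
case: ifP => //= /(entersP flip_order a vr) [v _]; rewrite revjdt_filling_of //.
  by rewrite (@eq_push _ _ (flip (covered le))) // => x y; apply: covered_flip.
by have := valid_revE v; rewrite rev_cons revK.
Qed.

(** The relation on reversed words; it states for the opposite order what [Q] states
for the given one. *)
Definition revrel Q X Y := Q (rev X) (rev Y).

Definition slide_closed le Q := forall X Y a, Q X Y -> enters le X a ->
  (push (covered le) a X).2 = (push (covered le) a Y).2 /\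
  Q (push (covered le) a X).1 (push (covered le) a Y).1.

Definition stable le Q :=
  [/\ forall X Y, Q X Y -> [/\ valid le X, valid le Y & X =i Y],
      slide_closed le Q & slide_closed (flip le) (revrel Q)].

Lemma stable_word_slide le Q X Y a X' : stable le Q -> Q X Y ->
  word_slide le a X = Some X' -> exists2 Y', word_slide le a Y = Some Y' & Q X' Y'.
Proof.
case=> vQ fQ rQ q; have [_ _ e] := vQ _ _ q.
have e' : rev X =i rev Y by move=> x; rewrite !mem_rev.
rewrite /word_slide -(enters_eq le a e) -(enters_eq (flip le) a e').
case: ifP => [i [<-]|_]; first by eexists; [reflexivity|case: (fQ _ _ _ q i)].
case: ifP => // i [<-]; eexists; first reflexivity.
have q' : revrel Q (rev X) (rev Y) by rewrite /revrel !revK.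
by case: (rQ _ _ _ q' i).
Qed.

(** This is a bisimulation argument: the legality of a slide depends on the shape
only, and related words have the same shape after every slide. *)
Lemma stable_dual le Q X Y : partial_order le -> stable le Q -> Q X Y ->
  dual_equiv le (filling_of X) (filling_of Y).
Proof.
move=> le_order st + s; elim: s X Y => [|a s IH] X Y q T U.
  by case=> <- [<-]; case: st => /(_ _ _ q) [_ _ e] _ _; apply/shape_filling_eq.
case: (st) => /(_ _ _ q) [vX vY e] _ _ /=.
rewrite !slide_filling_of //; case wX: (word_slide le a X) => [X'|] //=.
have [Y' -> q'] := stable_word_slide st q wX => /=; exact: IH q' _ _.
Qed.

(** The vacated box is what is left of the enlarged shape when the new shape is
removed. *)
Lemma vacated_eq le X Y a : partial_order le -> valid le (a :: X) -> valid le (a :: Y) ->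
  X =i Y ->
  (push (covered le) a X).1 =i (push (covered le) a Y).1 ->
  (push (covered le) a X).2 = (push (covered le) a Y).2.
Proof.
move=> le_order vX vY e e1.
have uX := lin_ext_uniq le_order (valid_push le_order vX).1.
have : (push (covered le) a X).2 \in a :: Y.
  by rewrite inE -e -in_cons (mem_push (covered le)) eqxx.
rewrite (mem_push (covered le)) -e1.
by move: uX; rewrite rcons_uniq => /andP [/negbTE -> _]; rewrite orbF => /eqP.
Qed.

Lemma pushed_eq le X Y a : partial_order le -> valid le (a :: X) -> valid le (a :: Y) -> X =i Y ->
  (push (covered le) a X).2 = (push (covered le) a Y).2 ->
  (push (covered le) a X).1 =i (push (covered le) a Y).1.
Proof.
move=> le_order vX vY e e2 z.
have uX := lin_ext_uniq le_order (valid_push le_order vX).1.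
have uY := lin_ext_uniq le_order (valid_push le_order vY).1.
have : (z \in a :: X) = (z \in a :: Y) by rewrite !inE e.
rewrite !(mem_push (covered le)) -e2; case: eqP => [->|//] _.
by move: uX uY; rewrite !rcons_uniq -e2 => /andP [/negbTE -> _] /andP [/negbTE -> _].
Qed.

Lemma stableI le Q Q' :
  (forall X Y, Q X Y -> [/\ valid le X, valid le Y & X =i Y]) ->
  (forall X Y, revrel Q X Y <-> Q' X Y) ->
  slide_closed le Q -> slide_closed (flip le) Q' -> stable le Q.
Proof.
move=> vQ eQ fQ fQ'; split=> // X Y a /eQ q i.
by have [e2 /eQ q'] := fQ' _ _ _ q i.
Qed.

Lemma revrel_valid le X Y :
  [/\ valid le (rev X), valid le (rev Y) & rev X =i rev Y] <->
  [/\ valid (flip le) X, valid (flip le) Y & X =i Y].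
Proof.
split=> -[vX vY e]; split; try exact: valid_revK; try exact: valid_revE.
  by move=> x; have := e x; rewrite !mem_rev.
by move=> x; rewrite !mem_rev.
Qed.

Definition dual_words le k X Y :=
  [/\ valid le X, valid le Y, X =i Y, size X = k & dual_equiv le (filling_of X) (filling_of Y)].

(** The definition of dual equivalence quantifies over all sequences of slides, so
it passes to the results of a slide; the vacated boxes agree since the new
shapes do. *)
Lemma dual_words_stable le k : partial_order le -> stable le (dual_words le k).
Proof.
move=> le_order.
have flip_order := partial_order_flip le_order.
have key X Y a X' Y' : dual_words le k X Y -> word_slide le a X = Some X' ->
  word_slide le a Y = Some Y' ->
    X' =i Y' /\ dual_equiv le (filling_of X') (filling_of Y').
  case=> vX vY _ _ d wX wY; split.
    apply/shape_filling_eq; apply: (d [:: a]); rewrite /= slide_filling_of // ?wX ?wY //=.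
  by move=> s T U TX UY; apply: (d (a :: s)); rewrite /= slide_filling_of // ?wX ?wY.
split=> [X Y [] //|X Y a|X Y a].
  move=> d i; case: (d) => vX vY e sz _.
  have i' : enters le Y a by rewrite -(enters_eq le a e).
  have [e1 d1] := key X Y a _ _ d (word_slide_inner i) (word_slide_inner i').
  have [ax _] := proj1 (entersP le_order a vX) i; have [ay _] := proj1 (entersP le_order a vY) i'.
  split; first exact: vacated_eq.
  by split=> //; rewrite ?size_push //; apply: valid_pushed.
rewrite /revrel => d i; case: (d) => vX vY e sz _.
have e' : X =i Y by move=> x; have := e x; rewrite !mem_rev.
have i' : enters (flip le) Y a by rewrite -(enters_eq (flip le) a e').
have vX' := valid_revK vX.
have vY' := valid_revK vY.
have [e1 d1] := key _ _ a _ _ d (word_slide_outer le_order vX' i) (word_slide_outer le_order vY' i').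
have [ax _] := proj1 (entersP flip_order a vX') i; have [ay _] :=
  proj1 (entersP flip_order a vY') i'.
split.
  by apply: vacated_eq => // x; have := e1 x; rewrite !mem_rev.
split=> //; last by rewrite size_rev size_push -sz size_rev.
- by apply: valid_revE; apply: valid_pushed.
- by apply: valid_revE; apply: valid_pushed.
Qed.

Definition in_context le Q X Y := exists S T U V,
  [/\ X = S ++ T ++ V, Y = S ++ U ++ V, Q T U, valid le X & valid le Y].

(** The scan crosses the prefix, then the replaced factor, then the suffix.  The
vacancy reaches the factors [T] and [U] at the same box [b].  Either [b] is a
corner of their common shape, and then [Q] supplies equal vacancies behind
them, or no letter lies above [b] and both factors stay as they are. *)
Lemma in_context_slide_closed le Q : partial_order le -> stable le Q ->
  slide_closed le (in_context le Q).
Proof.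
move=> le_order [vQ fQ _] _ _ a [S [T [U [V [-> -> q vX vY]]]]] i.
have [vT0 _ e] := vQ _ _ q.
have eXY : S ++ T ++ V =i S ++ U ++ V by move=> x; rewrite !mem_cat e.
have i' : enters le (S ++ U ++ V) a by rewrite -(enters_eq le a eXY).
have [aX _] := proj1 (entersP le_order a vX) i; have [aY _] := proj1 (entersP le_order a vY) i'.
have wX := valid_pushed le_order aX; have wY := valid_pushed le_order aY.
have vT := @valid_push_cat _ _ le_order [::] a S (T ++ V) aX.
have {}vT : valid le ((push (covered le) a S).2 :: T).
  by apply: (@valid_mid _ _ (push (covered le) a S).1 _ V).
move: wX wY; rewrite !push_cat /=.
set b := (push _ a S).2; set S' := (push _ a S).1; rewrite -/b in vT.
have [eq2 q'] : (push (covered le) b T).2 = (push (covered le) b U).2 /\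
    Q (push (covered le) b T).1 (push (covered le) b U).1.
  have [h|/hasPn h] := boolP (has (le b) T).
    by apply: (fQ T U b q); apply/(entersP le_order b vT0).
  have nc x : x \in T -> ~~ covered le b x by move=> /h; apply/contra/covered_le.
  by rewrite !push_id //; apply/hasPn => x; rewrite -?e; apply: nc.
move=> wX wY; split; first by rewrite eq2.
exists S', (push (covered le) b T).1, (push (covered le) b U).1,
  (push (covered le) (push (covered le) b T).2 V).1.
by split=> //; rewrite eq2.
Qed.

Lemma stable_flip le Q : stable le Q -> stable (flip le) (revrel Q).
Proof.
case=> vQ fQ rQ; split=> //.
  move=> X Y /vQ [vX vY e]; split; try exact: valid_revK.
  by move=> x; have := e x; rewrite !mem_rev.
move=> X Y a; rewrite /revrel !revK; exact: fQ.
Qed.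

Lemma in_context_rev le Q X Y :
  revrel (in_context le Q) X Y <-> in_context (flip le) (revrel Q) X Y.
Proof.
split=> -[S [T [U [V [eX eY q vX vY]]]]].
  exists (rev V), (rev T), (rev U), (rev S); rewrite /revrel !revK.
  have eX' : X = rev V ++ rev T ++ rev S by rewrite -(revK X) eX !rev_cat catA.
  have eY' : Y = rev V ++ rev U ++ rev S by rewrite -(revK Y) eY !rev_cat catA.
  by split=> //; apply: valid_revK.
exists (rev V), (rev T), (rev U), (rev S); rewrite eX eY !rev_cat -!catA; split=> //.
  by have := valid_revW vX; rewrite eX !rev_cat -!catA.
by have := valid_revW vY; rewrite eY !rev_cat -!catA.
Qed.

Lemma in_context_stable le Q : partial_order le -> stable le Q -> stable le (in_context le Q).
Proof.
move=> le_order st; apply: (stableI _ (@in_context_rev le Q)).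
- move=> _ _ [S [T [U [V [-> -> q vX vY]]]]]; split=> // x.
  by case: st => /(_ _ _ q) [_ _ e] _ _; rewrite !mem_cat e.
- exact: in_context_slide_closed.
- exact: in_context_slide_closed (partial_order_flip le_order) (stable_flip st).
Qed.

End Stable.

(** * Haiman moves are replacements of factors *)

Section HaimanMoves.
Variables (B : finType) (le : rel B).
Hypothesis le_order : partial_order le.

Let le_refl : reflexive le. Proof. by case: le_order. Qed.
Let le_anti : antisymmetric le. Proof. by case: le_order. Qed.
Let le_trans : transitive le. Proof. by case: le_order. Qed.

Lemma coprod_filling_of (s t : seq B) : uniq s ->
  coprod (filling_of s) (filling_of t) = filling_of (s ++ t).
Proof.
move=> us; apply/ffunP => x; rewrite !ffunE !shape_filling_of !inE mem_cat index_cat.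
rewrite cardsE (card_uniqP us); case: (x \in s) => //=.
by case: (x \in t) => //=; rewrite addSn addnC.
Qed.

(** The boxes below a shape play the part of the inner shape in a difference of
two straight shapes. *)
Lemma straight_below (w : seq B) : valid le w -> straight le (below le [set x in w]).
Proof.
move=> vw x y xy; rewrite !inE => /andP [yw /exists_inP [z]]; rewrite inE => zw.
case/andP=> _ yz; have xz := le_trans xy yz.
have xw : x \notin w by apply: contra yw => xw; apply: (vw.2 x y z).
rewrite xw; apply/exists_inP; exists z; rewrite ?inE // /slt xz andbT.
by apply: contraNneq xw => ->.
Qed.

Lemma straight_below_prefix (s t : seq B) : valid le (s ++ t) ->
  straight le (below le [set x in s ++ t] :|: [set x in s]).
Proof.
move=> vw x y xy; rewrite in_setU => /orP [yb|]; first by rewrite in_setU (straight_below vw xy).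
rewrite inE => ys; rewrite in_setU [x \in [set _ in _]]inE.
have [//|xs] := boolP (x \in s); first by rewrite orbT.
rewrite orbF !inE mem_cat (negbTE xs) /=.
have xt : x \notin t.
  case: vw => + _; rewrite lin_ext_cat => /and3P [_ _ /allP /(_ y ys) /allP al].
  by apply/negP => /al; rewrite xy.
rewrite xt; apply/exists_inP; exists y; first by rewrite inE mem_cat ys.
by rewrite /slt xy andbT; apply: contraNneq xs => ->.
Qed.

Lemma straight_convex (l v : {set B}) (w : seq B) : straight le l -> straight le v ->
  [set x in w] = v :\: l -> convex le w.
Proof.
move=> sl sv e x y z; have wE u : (u \in w) = (u \in v :\: l) by rewrite -e inE.
rewrite !wE !inE => /andP [xl xv] /andP [zl zv] xy yz.
by rewrite (sv y z yz zv) andbT; apply: contra xl; apply: sl.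
Qed.

Lemma SYT_skew (l v : {set B}) T : straight le l -> straight le v -> SYT le (v :\: l) T ->
  exists w, [/\ valid le w, [set x in w] = v :\: l & T = filling_of w].
Proof.
move=> sl sv /SYT_word [w [lw e ->]]; exists w; split=> //; split=> //.
exact: straight_convex e.
Qed.

(** In one direction the three fillings are spelled one after another; in the other
the straight shapes are the boxes below the word together with its prefixes. *)
Lemma haiman_word k X Y : haiman_move le k X Y <->
  exists x y, [/\ X = filling_of x, Y = filling_of y & in_context le (dual_words le k) x y].
Proof.
split.
  case=> [l [m [n [p [S [T [U [V []]]]]]]]] [sl sm sn sp] [lm mn np].
  case=> /(SYT_skew sl sm) [s [vs es ->]] /(SYT_skew sm sn) [t [vt et ->]].
  move=> /(SYT_skew sm sn) [u [vu eu ->]] /(SYT_skew sn sp) [v [vv ev ->]].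
  case=> ck d [-> ->].
  have us := lin_ext_uniq le_order vs.1; have ut := lin_ext_uniq le_order vt.1; have uu :=
    lin_ext_uniq le_order vu.1.
  have mS x : (x \in s) = (x \in m :\: l) by rewrite -es inE.
  have mT x : (x \in t) = (x \in n :\: m) by rewrite -et inE.
  have mU x : (x \in u) = (x \in n :\: m) by rewrite -eu inE.
  have mV x : (x \in v) = (x \in p :\: n) by rewrite -ev inE.
  have e : t =i u by move=> x; rewrite mT mU.
  have gen w : valid le w -> w =i t -> valid le (s ++ w ++ v).
    move=> vw wt; split.
      rewrite !lin_ext_cat vs.1 vw.1 vv.1 /=; apply/andP; split.
        apply/allP => x; rewrite wt mT inE => /andP [_ xn].
        apply/allP => y; rewrite mV inE => /andP [yn _].
        by apply: contra yn => yx; apply: sn yx xn.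
      apply/allP => x; rewrite mS inE => /andP [_ xm].
      apply/allP => y; rewrite mem_cat wt mT mV !inE => yy.
      have ym : y \notin m.
        by case/orP: yy => /andP [// yn _]; apply: contra yn; apply: (subsetP mn).
      by apply: contra ym => yx; apply: sm yx xm.
    apply: (@straight_convex l p) => //; apply/setP => x.
    rewrite inE !mem_cat wt mS mT mV !inE.
    have := subsetP lm x; have := subsetP mn x; have := subsetP np x.
    case: (x \in l); case: (x \in m); case: (x \in n); case: (x \in p) => // a b c;
      by [have := a isT|have := b isT|have := c isT].
  have st : uniq (s ++ t).
    by have := lin_ext_uniq le_order (gen t vt (fun x => erefl _)).1;
      rewrite catA cat_uniq => /andP [].
  have su : uniq (s ++ u).
    by have := lin_ext_uniq le_order (gen u vu (fsym e)).1; rewrite catA cat_uniq => /andP [].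
  exists (s ++ t ++ v), (s ++ u ++ v); split; rewrite ?coprod_filling_of -?catA //.
  exists s, t, u, v; split=> //; last 2 first.
  - exact: gen.
  - by apply: gen => // x; rewrite e.
  by split=> //; rewrite -ck -et cardsE (card_uniqP ut).
case=> _ [_ [-> -> [s [t [u [v [-> -> [vt vu e sz d] vX vY]]]]]]].
have eXY : [set x in s ++ u ++ v] = [set x in s ++ t ++ v].
  by apply/setP => x; rewrite !inE !mem_cat e.
have uX := lin_ext_uniq le_order vX.1.
have us : uniq s by move: uX; rewrite cat_uniq => /and3P [].
have ut := lin_ext_uniq le_order vt.1; have uu := lin_ext_uniq le_order vu.1.
set D := [set x in s ++ t ++ v]; set l := below le D.
have nl x : x \in s ++ t ++ v -> x \notin l by move=> xw; rewrite inE inE xw.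
have sl : straight le l by apply: straight_below.
have sm : straight le (l :|: [set x in s]) by apply: straight_below_prefix.
have sn : straight le (l :|: [set x in s ++ t]).
  by rewrite /l /D catA; apply: straight_below_prefix; rewrite -catA.
have sp : straight le (l :|: [set x in s ++ t ++ v]).
  have := @straight_below_prefix (s ++ t ++ v) [::]; rewrite cats0; exact.
have vs := valid_prefix vX; have vv := valid_suffix (valid_suffix vX).
have dis : [/\ forall x, x \in s -> x \notin t, forall x, x \in s -> x \notin v
   & forall x, x \in t -> x \notin v].
  move: uX; rewrite !cat_uniq => /and3P [_ /hasPn h1 /and3P [_ /hasPn h2 _]]; split=> x xs.
  - by apply: contraTN xs => xt; apply: h1; rewrite mem_cat xt.
  - by apply: contraTN xs => xt; apply: h1; rewrite mem_cat xt orbT.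
  - by apply: contraTN xs => xt; apply: h2.
case: dis => d1 d2 d3.
have e1 : (l :|: [set x in s]) :\: l = [set x in s].
  apply/setP => x; rewrite !in_setD in_setU [x \in [set _ in _]]inE.
  have := nl x; rewrite mem_cat; case: (x \in s) => /= [->//|_]; by case: (x \in l).
have e2 : (l :|: [set x in s ++ t]) :\: (l :|: [set x in s]) = [set x in t].
  apply/setP => x; rewrite !in_setD !in_setU ![x \in [set _ in _]]inE.
  have := nl x; have := d1 x; rewrite !mem_cat.
  case: (x \in s) => /= [/(_ isT)/negbTE -> //|_]; first by rewrite !orbT.
  by case: (x \in t) => /= [/(_ isT)/negbTE ->//|_]; case: (x \in l).
have e3 : (l :|: [set x in s ++ t ++ v]) :\: (l :|: [set x in s ++ t]) = [set x in v].
  apply/setP => x; rewrite !in_setD !in_setU ![x \in [set _ in _]]inE.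
  have := nl x; have := d2 x; have := d3 x; rewrite !mem_cat.
  case: (x \in v); case: (x \in s); case: (x \in t) => //=;
    by [move=> _ /(_ isT) | move=> /(_ isT) | move=> _ _ /(_ isT) /negbTE -> | case: (x \in l)].
exists l, (l :|: [set x in s]), (l :|: [set x in s ++ t]), (l :|: [set x in s ++ t ++ v]).
exists (filling_of s), (filling_of t), (filling_of u), (filling_of v); split.
- by split.
- split; first exact: subsetUl.
    by apply: setUS; apply/subsetP => x; rewrite !inE mem_cat => ->.
  by apply: setUS; apply/subsetP => x; rewrite !inE !mem_cat => /orP [] ->; rewrite ?orbT.
- rewrite e1 e2 e3; split; [exact: SYT_filling_of vs.1|exact: SYT_filling_of vt.1| |exact:
  SYT_filling_of vv.1].
  have -> : [set x in t] = [set x in u] by apply/setP => x; rewrite !inE e.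
  exact: SYT_filling_of vu.1.
- by rewrite e2 cardsE (card_uniqP ut).
rewrite !coprod_filling_of -?catA //.
  by have := lin_ext_uniq le_order vY.1; rewrite catA cat_uniq => /andP [].
by have := uX; rewrite catA cat_uniq => /andP [].
Qed.

End HaimanMoves.

(** * Reduction to straight shapes *)

(** The vacated box is a corner on the other side: it lies above [a], which is now a
letter. *)
Lemma word_slide_undo (B : finType) (le : rel B) s a : partial_order le -> valid le s ->
  enters le s a ->
  word_slide le (push (covered le) a s).2 (push (covered le) a s).1 = Some s.
Proof.
move=> le_order vs i; have [v h] := proj1 (entersP le_order a vs) i.
have vp := valid_push le_order v; have up := lin_ext_uniq le_order vp.1.
set r := push _ a s in vp up *.
have ar : a \in r.1.
  have := mem_push (covered le) a s a; rewrite inE eqxx -/r /= => /esym/orP [/eqP ar|//].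
  case/hasP: h => t ts at_; have := mem_push (covered le) a s t.
  rewrite inE ts orbT -/r => /esym/orP [/eqP tr|tr].
    by move: (lin_ext_uniq le_order v.1) => /=; rewrite ar -tr ts.
  by move: vp.1; rewrite /lin_ext pairwise_rcons => /andP [/allP /(_ t tr)]; rewrite -ar at_.
have flip_order := partial_order_flip le_order.
have vf : valid (flip le) (r.2 :: rev r.1) by rewrite -rev_rcons; apply: valid_revW.
have i' : enters (flip le) (rev r.1) r.2.
  apply/(entersP flip_order _ (valid_suffix (s1 := [:: r.2]) vf)); split=> //.
  by apply/hasP; exists a; rewrite ?mem_rev // /flip push_le.
have := word_slide_outer le_order (valid_suffix (s1 := [:: r.2]) vf) i'; rewrite revK => ->.
rewrite (@eq_push _ _ (flip (covered le))); last by move=> x y; apply: covered_flip.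
rewrite pushK ?revK //.
by apply: sub_pairwise v.1 => x y; apply/contra/covered_le.
Qed.

(** Related words vacate the same box, so one slide into that box undoes both. *)
Lemma stable_undo (B : finType) (le : rel B) Q X Y a X1 Y1 : partial_order le ->
  stable le Q -> Q X Y ->
  word_slide le a X = Some X1 -> word_slide le a Y = Some Y1 ->
  exists b, word_slide le b X1 = Some X /\ word_slide le b Y1 = Some Y.
Proof.
have fwd (r : rel B) R U V U1 V1 : partial_order r -> stable r R -> R U V -> enters r U a ->
    word_slide r a U = Some U1 -> word_slide r a V = Some V1 ->
    exists b, word_slide r b U1 = Some U /\ word_slide r b V1 = Some V.
  move=> r_order st q i; case: (st) => vR fR _; have [vU vV e] := vR _ _ q.
  have i' : enters r V a by rewrite -(enters_eq r a e).
  rewrite !word_slide_inner // => -[<-] [<-]; exists (push (covered r) a U).2.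
  by rewrite word_slide_undo // (fR _ _ _ q i).1 word_slide_undo.
move=> le_order st q wX wY; have [i|ni] := boolP (enters le X a); first exact: (fwd le Q).
case: (st) => vQ _ _; have [vX vY e] := vQ _ _ q.
have fi : enters (flip le) (rev X) a by move: wX; rewrite /word_slide (negbTE ni); case: ifP.
have q' : revrel Q (rev X) (rev Y) by rewrite /revrel !revK.
have flip_order := partial_order_flip le_order.
have [||b] := fwd (flip le) _ _ _ (rev X1) (rev Y1) flip_order (stable_flip st) q' fi.
- by rewrite word_slide_flip // wX.
- by rewrite word_slide_flip // wY.
have vX1 := word_slide_valid le_order vX wX; have vY1 := word_slide_valid le_order vY wY.
rewrite !word_slide_flip // => -[wX' wY']; exists b; split.
  by case: (word_slide le b X1) wX' => //= Z [/(can_inj revK) ->].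
by case: (word_slide le b Y1) wY' => //= Z [/(can_inj revK) ->].
Qed.

(** The words [rcons X c] and [rcons Y c'] are the windows: exchanging one for the
other at the end of a filling moves the largest label from [c] to [c']. *)
Definition window_prop (B : finType) (le : rel B) (om : option nat) :=
  forall w c c', valid le w -> straight le [set x in w] ->
  c \in w -> c' \in w -> c != c' ->
  (forall x, x \in w -> le c x -> x = c) -> (forall x, x \in w -> le c' x -> x = c') ->
  exists k P X Y, [/\ om = Some k, valid le (P ++ rcons X c), P ++ rcons X c =i w
    & dual_words le k (rcons X c) (rcons Y c')].

Definition seed_prop (B : finType) (le : rel B) (om : option nat) :=
  forall m, om = Some m -> (exists x y, ~~ le x y && ~~ le y x) ->
  exists w1 w2, [/\ dual_words le m w1 w2, straight le [set x in w1], w1 <> w2 &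
    forall w w', valid le w -> valid le w' -> straight le [set x in w] -> w =i w' ->
      size w = m -> w <> w' -> (w = w1 /\ w' = w2) \/ (w = w2 /\ w' = w1)].

Section Main.
Variables (B : finType) (le : rel B) (om : option nat).
Hypothesis le_order : partial_order le.

Let le_refl : reflexive le. Proof. by case: le_order. Qed.
Let le_anti : antisymmetric le. Proof. by case: le_order. Qed.
Let le_trans : transitive le. Proof. by case: le_order. Qed.

Definition word_move (X Y : seq B) := exists2 k,
  om = Some k & in_context le (dual_words le k) X Y.

Definition word_chain := clos_refl_trans (seq B) word_move.

Lemma word_move_stable : stable le word_move.
Proof.
have st k := in_context_stable le_order (dual_words_stable k le_order).
split=> [X Y [k _]|X Y a [k ok q] i|X Y a [k ok q] i].
- by case: (st k) => + _ _; apply.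
- by case: (st k) => _ /(_ _ _ _ q i) [e q'] _; split=> //; exists k.
- by case: (st k) => _ _ /(_ _ _ _ q i) [e q']; split=> //; exists k.
Qed.

Lemma word_chain_valid X Y : word_chain X Y -> valid le X -> valid le Y /\ X =i Y.
Proof.
elim=> {X Y} [X Y m|X|X Y Z _ IH1 _ IH2] vX //.
  by case: word_move_stable => /(_ _ _ m) [].
have [vY e] := IH1 vX; have [vZ e'] := IH2 vY; split=> // x; by rewrite e.
Qed.

(** Slides carry chains of moves to chains of moves of the same length, because the
moves form a stable relation. *)
Lemma word_chain_slide X Y a X' : word_chain X Y -> word_slide le a X = Some X' ->
  exists2 Y', word_slide le a Y = Some Y' & word_chain X' Y'.
Proof.
move=> c; elim: c X' => {X Y} [X Y m|X|X Y Z _ IH1 _ IH2] X' wX.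
- by have [Y' wY q] := stable_word_slide word_move_stable m wX; exists Y' => //; apply: rt_step.
- by exists X' => //; apply: rt_refl.
- have [Y' /IH2 [Z' wZ c2] c1] := IH1 _ wX; exists Z' => //; exact: rt_trans c1 c2.
Qed.

Lemma word_chain_dual X Y : valid le X -> word_chain X Y ->
  dual_equiv le (filling_of X) (filling_of Y).
Proof.
move=> + + s; elim: s X Y => [|a s IH] X Y vX c T U.
  by case=> <- [<-]; apply/shape_filling_eq; case: (word_chain_valid c vX).
have [vY e] := word_chain_valid c vX.
rewrite /= !slide_filling_of //; case wX: (word_slide le a X) => [X'|] //=.
have [Y' -> c'] := word_chain_slide c wX => /=; apply: (IH X' Y') => //.
exact: word_slide_valid wX.
Qed.

Lemma word_chain_elementary X Y : word_chain X Y ->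
  elementary_chain le om (filling_of X) (filling_of Y).
Proof.
elim=> {X Y} [X Y [k ok q]|X|X Y Z _ c1 _ c2]; [|exact: rt_refl|exact: rt_trans c1 c2].
by apply: rt_step; exists k => //; apply/(haiman_word le_order); exists X, Y.
Qed.

Lemma elementary_word_chain F G : elementary_chain le om F G ->
  forall X, valid le X -> F = filling_of X -> exists2 Y, G = filling_of Y & word_chain X Y.
Proof.
elim=> {F G} [F G [k ok /(haiman_word le_order) [X' [Y [-> -> q]]]] X vX e|F X vX e|].
- exists Y => //; suff -> : X = X' by apply: rt_step; exists k.
  case: (q) => S [T [U [V [_ _ _ vX' _]]]].
  exact: (filling_of_inj (lin_ext_uniq le_order vX.1) (lin_ext_uniq le_order vX'.1) (esym e)).
- by exists X => //; apply: rt_refl.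
move=> F G H _ IH1 _ IH2 X vX e; have [Y eY cY] := IH1 X vX e.
have [Z eZ cZ] := IH2 Y (word_chain_valid cY vX).1 eY; exists Z => //; exact: rt_trans cY cZ.
Qed.

Fixpoint word_slides (s : seq B) (X : seq B) : option (seq B) :=
  if s is a :: s' then obind (word_slides s') (word_slide le a X) else Some X.

Lemma word_slides_cat s s' X : word_slides (s ++ s') X = obind (word_slides s') (word_slides s X).
Proof. by elim: s X => //= a s IH X; case: (word_slide le a X). Qed.

Lemma slides_filling_of s X : valid le X ->
  slides le s (filling_of X) = omap (@filling_of B) (word_slides s X).
Proof.
elim: s X => //= a s IH X vX; rewrite slide_filling_of //.
by case wX: (word_slide le a X) => [Z|] //=; rewrite IH //; apply: word_slide_valid wX.
Qed.

Lemma word_chain_slides s X Y X' : word_chain X Y -> word_slides s X = Some X' ->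
  exists2 Y', word_slides s Y = Some Y' & word_chain X' Y'.
Proof.
elim: s X Y => [|a s IH] X Y c /=; first by case=> <-; exists Y.
case wX: (word_slide le a X) => [Z|] //=.
by have [Y1 -> c'] := word_chain_slide c wX => /=; apply: IH.
Qed.

(** The same boxes, in reverse, undo the slides for both words, since dual equivalent
words vacate the same boxes. *)
Lemma dual_words_undo k s X Y X' : dual_words le k X Y -> word_slides s X = Some X' ->
  exists Y' q, [/\ word_slides s Y = Some Y', dual_words le k X' Y',
    word_slides q X' = Some X & word_slides q Y' = Some Y].
Proof.
have st := dual_words_stable k le_order.
elim: s X Y => [|a s IH] X Y d /=; first by case=> <-; exists Y, [::].
case wX: (word_slide le a X) => [Z|] //= wZ.
have [W wY d1] := stable_word_slide st d wX.
have [b [bZ bW]] := stable_undo le_order st d wX wY.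
have [Y' [q [sW d' qX qY]]] := IH _ _ d1 wZ.
by exists Y', (rcons q b); rewrite wY /= -cats1 !word_slides_cat qX qY /= bZ bW.
Qed.

Lemma below_empty X : valid le X -> below le [set x in X] = set0 -> straight le [set x in X].
Proof.
move=> vX b0 x y xy; rewrite !inE => yX; apply: contraT => xX.
suff : x \in below le [set x in X] by rewrite b0 inE.
rewrite !inE xX; apply/exists_inP; exists y; rewrite ?inE // /slt xy andbT.
by apply: contraNneq xX => ->.
Qed.

(** Each slide into a maximal box below the shape makes the set of boxes below it
smaller. *)
Lemma rectify X : valid le X ->
  exists s X', word_slides s X = Some X' /\ straight le [set x in X'].
Proof.
have [n] := ubnP #|below le [set x in X]|; elim: n X => // n IH X bn vX.
have [b0|[x0 x0b]] := set_0Vmem (below le [set x in X]).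
  by exists [::], X; split=> //; apply: below_empty.
(* A box with the most boxes weakly below it is maximal. *)
pose h x := #|[set y | le y x]|.
have [a ab amax] := @arg_maxnP _ x0 (mem (below le [set x in X])) h x0b.
have i : enters le X a.
  rewrite /enters /inner_corner; apply/andP; split; first exact: ab.
  apply/forall_inP => y /amax; apply: contraTN => /andP [ay lay].
  rewrite -ltnNge; apply: proper_card; apply/properP; split.
    by apply/subsetP => z; rewrite !inE => za; apply: le_trans za lay.
  exists y; rewrite !inE ?le_refl //; apply: contra ay => ya.
  by apply/eqP/le_anti; rewrite lay.
have [v _] := proj1 (entersP le_order a vX) i.
have vp := valid_push le_order v; have up := lin_ext_uniq le_order vp.1.
set r := push (covered le) a X in vp up.
have w1 : word_slide le a X = Some r.1 by apply: word_slide_inner.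
have [|s [X' [ws sX]]] := IH r.1 _ (word_slide_valid le_order vX w1).
  rewrite ltnS in bn; apply: leq_trans bn; apply: proper_card; apply/properP; split; last first.
    exists a; first exact: ab.
    rewrite !inE negb_and negbK.
    have := mem_push (covered le) a X a; rewrite mem_head -/r => /esym /orP [/eqP ar|-> //].
    apply/orP; right; apply/exists_inPn => z; rewrite inE => zr; apply/negP => /andP [_ az].
    by move: vp.1; rewrite /lin_ext pairwise_rcons => /andP [/allP /(_ z zr)]; rewrite -ar az.
  apply/subsetP => z; rewrite !inE => /andP [zr /exists_inP [y]]; rewrite inE =>
    yr /andP [zy lzy].
  have zX : z \notin X.
    apply: contra zr => zX; have := mem_push (covered le) a X z.
    rewrite inE zX orbT -/r => /esym /orP [/eqP zr|//].
    by move: vp.1; rewrite /lin_ext pairwise_rcons => /andP [/allP /(_ y yr)]; rewrite -zr lzy.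
  rewrite zX /=; have := mem_push (covered le) a X y; rewrite -/r yr orbT inE.
  case/orP => [/eqP ya|yX]; last by apply/exists_inP; exists y; rewrite ?inE // /slt zy.
  move: ab; rewrite !inE => /andP [_ /exists_inP [t]]; rewrite inE => tX /andP [_ at_].
  apply/exists_inP; exists t; rewrite ?inE // /slt; apply/andP; split.
    by apply: contraNneq zX => ->.
  by apply: le_trans at_; rewrite -ya.
by exists (a :: s), X'; rewrite /= w1.
Qed.

Hypothesis window : window_prop le om.

Lemma valid_catr X Y S : valid le (X ++ S) -> valid le Y -> X =i Y -> valid le (Y ++ S).
Proof.
move=> vX vY e; apply: (valid_eq _ _ vX); last by move=> x; rewrite !mem_cat e.
move: vX.1; rewrite !lin_ext_cat vY.1 => /and3P [_ -> al] /=.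
by apply/allP => x; rewrite -e; apply: (allP al).
Qed.

Lemma word_chain_cat X Y S : word_chain X Y -> valid le (X ++ S) -> word_chain (X ++ S) (Y ++ S).
Proof.
elim=> {X Y} [X Y [k ok [P [T [U [V [eX eY q vX vY]]]]]] vS|X _|X Y Z c1 IH1 _ IH2 vS].
- subst X Y; have vY' : valid le ((P ++ U ++ V) ++ S).
    apply: (valid_catr vS vY) => x; rewrite !mem_cat.
    by case: q => _ _ ->.
  rewrite -!catA in vS vY' *.
  by apply: rt_step; exists k => //; exists P, T, U, (V ++ S).
- exact: rt_refl.
- have [vY e] := word_chain_valid c1 (valid_prefix vS).
  by apply: rt_trans (IH1 vS) (IH2 _); apply: (valid_catr vS vY e).
Qed.

Lemma last_max X c : valid le (rcons X c) -> forall x, x \in rcons X c -> le c x -> x = c.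
Proof.
move=> v x; rewrite mem_rcons inE => /orP [/eqP //|xX] cx.
by move: v.1; rewrite /lin_ext pairwise_rcons => /andP [/allP /(_ x xX)]; rewrite cx.
Qed.

(** Induction on the number of letters.  Words with the same last letter are joined
by the induction hypothesis.  If the last letters [c] and [c'] differ, the first word
is joined to one that ends with the window for [c], a single move replaces this
window by the one for [c'], and the result is joined to the second word. *)
Lemma connected X Y : valid le X -> valid le Y -> X =i Y -> straight le [set x in X] ->
  word_chain X Y.
Proof.
have [n] := ubnP (size X); elim: n X Y => // n IH X Y sn vX vY e sX.
have same c X0 Y0 : size X0 < n -> valid le (rcons X0 c) -> valid le (rcons Y0 c) ->
    rcons X0 c =i rcons Y0 c -> straight le [set x in rcons X0 c] ->
    word_chain (rcons X0 c) (rcons Y0 c).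
  move=> sz vX0 vY0 e0 s0; rewrite -!cats1; apply: word_chain_cat; last by rewrite cats1.
  have ux := lin_ext_uniq le_order vX0.1; have uy := lin_ext_uniq le_order vY0.1.
  rewrite !rcons_uniq in ux uy; case/andP: ux => cX _; case/andP: uy => cY _.
  apply: IH => //.
  - by rewrite -cats1 in vX0; apply: valid_prefix vX0.
  - by rewrite -cats1 in vY0; apply: valid_prefix vY0.
  - move=> x; have := e0 x; rewrite !mem_rcons !inE; case: eqP => [->|_ //] _.
    by rewrite (negbTE cX) (negbTE cY).
  - move=> x y xy; rewrite !inE => yX.
    have := s0 x y xy; rewrite !inE !mem_rcons !inE yX orbT => /(_ isT) /orP [/eqP xc|//].
    have := last_max vX0 (x := y); rewrite mem_rcons inE yX orbT -xc => /(_ isT xy) yx.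
    by rewrite -yx yX in cX *; rewrite -xc -yx yX in cX.
case/lastP: X => [|X c] in sn vX e sX *.
  suff -> : Y = [::] by apply: rt_refl.
  by case: (Y) e => // y Y' /(_ y); rewrite !inE eqxx.
case/lastP: Y => [|Y c'] in vY e *.
  by have := e c; rewrite mem_rcons inE eqxx.
rewrite size_rcons ltnS in sn.
case: (c =P c') => [<-|/eqP cc'] in vY e *; first exact: same.
have sY : size Y < n.
  have := perm_size (uniq_perm (lin_ext_uniq le_order vX.1) (lin_ext_uniq le_order vY.1) e).
  by rewrite !size_rcons => -[<-].
have cX : c \in rcons X c by rewrite mem_rcons inE eqxx.
have c'X : c' \in rcons X c by rewrite e mem_rcons inE eqxx.
have mY x : x \in rcons X c -> le c' x -> x = c' by rewrite e; apply: last_max.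
have [k [P [X1 [Y1 [ok vP eP d]]]]] := @window _ _ _ vX sX cX c'X cc' (last_max vX) mY.
case: (d) => v1 v2 e12 _ _.
have m : word_move (P ++ rcons X1 c) (P ++ rcons Y1 c').
  exists k => //; exists P, (rcons X1 c), (rcons Y1 c'), [::].
  split; rewrite ?cats0 //; apply: (valid_eq _ _ vP); last by move=> x; rewrite !mem_cat e12.
  move: vP.1; rewrite !lin_ext_cat v2.1 => /and3P [-> _ al] /=.
  by apply/allP => x /(allP al) /allP al'; apply/allP => y; rewrite -e12; apply: al'.
have vP' : valid le (P ++ rcons Y1 c') by case: word_move_stable => /(_ _ _ m) [].
have eP' : P ++ rcons Y1 c' =i rcons Y c'.
  by move=> x; rewrite -e -eP !mem_cat e12.
have szX : size (P ++ X1) < n.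
  have := perm_size (uniq_perm (lin_ext_uniq le_order vP.1) (lin_ext_uniq le_order vX.1) eP).
  by rewrite !size_cat !size_rcons addnS => -[->].
have szY : size (P ++ Y1) < n.
  have := perm_size (uniq_perm (lin_ext_uniq le_order vP'.1) (lin_ext_uniq le_order vY.1) eP').
  by rewrite !size_cat !size_rcons addnS => -[->].
rewrite -!rcons_cat in vP eP vP' eP' m.
have c1 : word_chain (rcons X c) (rcons (P ++ X1) c) by apply: same => // x; rewrite eP.
have c2 : word_chain (rcons (P ++ Y1) c') (rcons Y c').
  apply: same => // x y; rewrite ![_ \in [set _ in _]]inE !eP' -!e => xy yX.
  by have := sX x y xy; rewrite !inE; apply.
exact: rt_trans c1 (rt_trans _ _ _ _ _ (rt_step _ _ _ _ m) c2).
Qed.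

Hypothesis seed : seed_prop le om.

(** A straight shape is the difference of itself and the empty shape. *)
Lemma SYT_straight (l : {set B}) T : straight le l -> SYT le l T ->
  exists w, [/\ valid le w, [set x in w] = l & T = filling_of w].
Proof.
move=> sl; rewrite -[l in SYT _ l](setD0 l); move=> /(SYT_skew _ sl) [|w [vw e ->]].
  by move=> x y _; rewrite inE.
by exists w; rewrite setD0 in e.
Qed.

Lemma set_mem_eq (X Y : seq B) (l : {set B}) : [set x in X] = l -> [set x in Y] = l -> X =i Y.
Proof.
move=> eX eY x; have : (x \in [set x in X]) = (x \in [set x in Y]) by rewrite eX eY.
by rewrite !inE.
Qed.

Theorem dual_equivalence_of_windows :
  (forall (l : {set B}) (T U : filling B),
     straight le l -> SYT le l T -> SYT le l U -> dual_equiv le T U)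
  /\
  (forall (l v : {set B}) (X Y : filling B),
     straight le l -> straight le v -> l \subset v ->
     SYT le (v :\: l) X -> SYT le (v :\: l) Y ->
     (dual_equiv le X Y <-> elementary_chain le om X Y))
  /\
  (forall m : nat, om = Some m ->
     (exists x y : B, ~~ le x y && ~~ le y x) ->
     exists (s : {set B}) (T U : filling B),
       [/\ [/\ straight le s, #|s| = m, SYT le s T, SYT le s U & T <> U],
           dual_equiv le T U,
           forall V, SYT le s V -> V = T \/ V = U,
           forall (s' : {set B}) (T' U' : filling B),
             straight le s' -> #|s'| = m ->
             SYT le s' T' -> SYT le s' U' -> T' <> U' -> s' = s
         & forall (l v : {set B}) (X Y : filling B),
             straight le l -> straight le v -> l \subset v -> #|v :\: l| = m ->
             SYT le (v :\: l) X -> SYT le (v :\: l) Y -> X <> Y ->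
             dual_equiv le X Y ->
             exists q : seq B,
               (slides le q T = Some X /\ slides le q U = Some Y) \/
               (slides le q T = Some Y /\ slides le q U = Some X)]).
Proof.
split; [|split].
- move=> l T U sl /(SYT_straight sl) [X [vX eX ->]] /(SYT_straight sl) [Y [vY eY ->]].
  apply: word_chain_dual => //; apply: connected => //; last by rewrite eX.
  exact: set_mem_eq eX eY.
- move=> l v _ _ sl sv _ /(SYT_skew sl sv) [X [vX eX ->]] /(SYT_skew sl sv) [Y [vY eY ->]].
  have e := set_mem_eq eX eY; split.
    move=> d; have [s [X' [sX strX]]] := rectify vX.
    have dq : dual_words le (size X) X Y by split.
    have [Y' [q [sY [vX' vY' e' _ _] qX qY]]] := dual_words_undo dq sX.
    have [Y2 + c] := word_chain_slides (connected vX' vY' e' strX) qX.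
    by rewrite qY => -[eY2]; rewrite -eY2 in c; apply: word_chain_elementary.
  case/elementary_word_chain/(_ X vX erefl) => Y' eY' c.
  by rewrite eY'; apply: word_chain_dual.
move=> m om_m incomp; have [w1 [w2 [d sw1 w12 uniq12]]] := @seed _ om_m incomp.
case: (d) => v1 v2 e12 sz d12.
have u1 := lin_ext_uniq le_order v1.1; have u2 := lin_ext_uniq le_order v2.1.
have e2 : [set x in w2] = [set x in w1] by apply/setP => x; rewrite !inE e12.
exists [set x in w1], (filling_of w1), (filling_of w2); split.
- split=> //; first by rewrite cardsE (card_uniqP u1).
  + exact: SYT_filling_of v1.1.
  + by rewrite -e2; exact: SYT_filling_of v2.1.
  + by move/(filling_of_inj u1 u2).
- exact: d12.
- move=> V /(SYT_straight sw1) [w [vw ew ->]].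
  have [->|/eqP ww1] := eqVneq w w1; first by left.
  have ew1 : w =i w1 by apply: set_mem_eq ew _.
  have szw : size w = m by rewrite -sz; apply: perm_size; apply: uniq_perm => //; apply:
    (lin_ext_uniq le_order vw.1).
  by case: (uniq12 w w1) => //; rewrite ?ew // => -[-> _]; [left|right].
- move=> s' T' U' ss cs /(SYT_straight ss) [w [vw ew ->]] /(SYT_straight ss) [w' [vw' ew' ->]] ww.
  have szw : size w = m by rewrite -cs -ew cardsE (card_uniqP (lin_ext_uniq le_order vw.1)).
  have [||[eq1 _]|[eq2 _]] := uniq12 w w' vw vw' _ (set_mem_eq ew ew') szw.
  + by rewrite ew.
  + by move=> eww; rewrite eww in ww.
  + by rewrite -ew eq1.
  + by rewrite -ew eq2.
move=> l v _ _ sl sv _ cs /(SYT_skew sl sv) [X [vX eX ->]] /(SYT_skew sl sv) [Y [vY eY ->]] XY dXY.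
have e := set_mem_eq eX eY.
have [s [X' [sX strX]]] := rectify vX.
have dq : dual_words le m X Y.
  by split=> //; rewrite -cs -eX cardsE (card_uniqP (lin_ext_uniq le_order vX.1)).
have [Y' [q [sY [vX' vY' e' szX _] qX qY]]] := dual_words_undo dq sX.
have XY' : X' <> Y' by move=> eXY; apply: XY; congr filling_of; move: qX; rewrite eXY qY => -[].
exists q; case: (uniq12 X' Y') => // -[<- <-]; [left|right];
  by rewrite !slides_filling_of // qX qY.
Qed.

End Main.

(** * Words of diagonal colours *)

Definition adj (a b : nat) := (b == a.+1) || (a == b.+1).

Section Heap.
Variable (wall : bool).
(** Between two boxes of one diagonal a shape contains boxes of both neighbouring
diagonals.  The flag [wall] says that diagonal 0 is the border of the region, so
that it has a neighbour on one side only. *)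
Definition surrounded (a : nat) (s : seq nat) :=
  (a.+1 \in s) && (wall && (a == 0) || has (fun k => k.+1 == a) s).

Fixpoint heap_from (a : nat) (seen s : seq nat) :=
  if s is b :: s' then ((a == b) ==> surrounded a seen) && heap_from a (b :: seen) s'
  else true.

(** The condition on a colour word that holds for words of skew shapes: any two
equal colours are surrounded by what comes between them. *)
Fixpoint heap (s : seq nat) :=
  if s is a :: s' then heap_from a [::] s' && heap s' else true.
End Heap.

Definition strictly_between (lo d hi : nat) := (lo < d < hi) || (hi < d < lo).

(** The dual Knuth relations: two letters that follow each other are exchanged, the
third letter has a colour strictly between theirs. *)
Definition knuth3 (s s' : seq nat) :=
  match s, s' with
  | [:: a; b; c], [:: a'; b'; c'] =>
    [&& a == a', b == c', c == b' & strictly_between b a c] ||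
    [&& c == c', a == b', b == a' & strictly_between a c b]
  | _, _ => false
  end.

(** The shifted analogue: of the two letters that are not exchanged, the one with
the larger colour must have its colour strictly between the colours exchanged,
and it must stand next to the exchanged letters. *)
Definition knuth4 (s s' : seq nat) :=
  match s, s' with
  | [:: a; b; c; d], [:: a'; b'; c'; d'] =>
    [|| [&& a == a', b == b', c == d', d == c', a < b & strictly_between c b d],
        [&& c == c', d == d', a == b', b == a', d < c & strictly_between a c b]
      | [&& a == a', d == d', b == c', c == b' & strictly_between b (maxn a d) c]]
  | _, _ => false
  end.


Definition push_closed wall (E : rel (seq nat)) :=
  forall x s s', E s s' -> heap wall (x :: s) -> heap wall (x :: s') ->
  (push adj x s).2 = (push adj x s').2 /\ E (push adj x s).1 (push adj x s').1.

(** This map counts the steps below [u] that begin or end at a colour of [S].  It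
keeps adjacent colours of [S] adjacent and replaces all other gaps, also the one
above 0, by gaps as small as possible. *)
Definition squeeze (S : seq nat) (u : nat) :=
  count (fun i => (i \in S) || (i.+1 \in S)) (iota 0 u).

Section Squeeze.
Variable S : seq nat.
Notation g := (squeeze S).

Lemma squeezeD u v : u <= v ->
  g v = g u + count (fun i => (i \in S) || (i.+1 \in S)) (iota u (v - u)).
Proof. by move=> uv; rewrite /squeeze -{1}(subnKC uv) iotaD count_cat. Qed.

Lemma squeeze_mono u v : u <= v -> g u <= g v.
Proof. by move=> /squeezeD ->; rewrite leq_addr. Qed.

Lemma squeeze_lt u v : u \in S -> u < v -> g u < g v.
Proof.
move=> uS uv; apply: leq_trans (squeeze_mono uv).
by rewrite (squeezeD (leqnSn u)) subSnn /= uS addn1.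
Qed.

Lemma squeezeS u : u \in S -> g u.+1 = (g u).+1.
Proof. by move=> uS; rewrite (squeezeD (leqnSn u)) subSnn /= uS addn1. Qed.

Lemma squeeze_gap u v : u \in S -> v \in S -> u.+1 < v -> (g u).+1 < g v.
Proof.
move=> uS; case: v => // v vS uv; rewrite -(squeezeS uS).
apply: (@leq_ltn_trans (g v)); first exact: squeeze_mono.
by rewrite (squeezeD (leqnSn v)) subSnn /= vS orbT addn1.
Qed.

Lemma squeeze_ltE u v : u \in S -> v \in S -> (g u < g v) = (u < v).
Proof.
move=> uS vS; have [/(squeeze_lt uS) //|] := ltnP u v.
by move=> /squeeze_mono; rewrite ltnNge => ->.
Qed.

Lemma squeeze_eqE u v : u \in S -> v \in S -> (g u == g v) = (u == v).
Proof.

move=> uS vS; have [/(squeeze_lt uS)|/(squeeze_lt vS)|->] := ltngtP u v.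
- by move=> h; rewrite ltn_eqF.
- by move=> h; rewrite gtn_eqF.
- by rewrite eqxx.

Qed.

Lemma squeeze_SE u v : u \in S -> v \in S -> ((g u).+1 == g v) = (u.+1 == v).
Proof.
move=> uS vS; have [<-|/eqP uv] := eqVneq u.+1 v; first by rewrite squeezeS ?eqxx.
have [vu|vu|] := ltngtP v u.+1; last by move/esym.
- by rewrite ltnS in vu; apply/negbTE; rewrite neq_ltn ltnS (squeeze_mono vu) orbT.
- by apply/negbTE; rewrite neq_ltn squeeze_gap.
Qed.

Lemma squeeze_0E u : u \in S -> (g u == 0) = (u == 0).
Proof.
case: u => // u uS; apply/negbTE; rewrite -lt0n.
by rewrite (squeezeD (leqnSn u)) subSnn /= uS orbT addn1.
Qed.

Lemma squeeze_adj u v : u \in S -> v \in S -> adj (g u) (g v) = adj u v.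
Proof. by move=> uS vS; rewrite /adj ![g _ == _.+1]eq_sym !squeeze_SE // ![_.+1 == _]eq_sym. Qed.

Lemma squeeze_bound u : g u <= (size S).*2.
Proof.
have bd (h : nat -> nat) : injective h -> count (fun i => h i \in S) (iota 0 u) <= size S.
  move=> hi; rewrite -size_filter -(size_map h); apply: uniq_leq_size.
    by rewrite map_inj_uniq // filter_uniq // iota_uniq.
  by move=> _ /mapP [i + ->]; rewrite mem_filter => /andP [].
rewrite -addnn; apply: leq_trans (leq_add (bd id (fun _ _ e => e)) (bd succn succn_inj)).
by rewrite -count_predUI leq_addr.
Qed.

Lemma squeeze_max u v : u \in S -> v \in S -> maxn (g u) (g v) = g (maxn u v).
Proof. by move=> uS vS; rewrite /maxn squeeze_ltE //; case: ifP. Qed.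

Lemma squeeze_inj : {in S &, injective g}.
Proof. by move=> u v uS vS /eqP; rewrite squeeze_eqE // => /eqP. Qed.

Lemma surrounded_squeeze wall a s : a \in S -> {subset s <= S} ->
  surrounded wall (g a) (map g s) = surrounded wall a s.
Proof.
move=> aS sS; rewrite /surrounded squeeze_0E // has_map; congr (_ && (_ || _)).
  apply/mapP/idP => [[b bs /eqP]|as_]; last by exists a.+1; rewrite ?squeezeS.
  have bS := sS _ bs; by rewrite squeeze_SE // => /eqP ->.
by apply: eq_in_has => k ks /=; rewrite squeeze_SE //; apply: sS.
Qed.

Lemma heap_from_squeeze wall a s t : a \in S -> {subset s <= S} -> {subset t <= S} ->
  heap_from wall (g a) (map g s) (map g t) = heap_from wall a s t.
Proof.
move=> aS; elim: t s => //= b t IH s sS tS.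
have bS : b \in S by apply: tS; rewrite mem_head.
rewrite squeeze_eqE // surrounded_squeeze // (IH (b :: s)) //.
  by move=> x; rewrite inE => /predU1P [->|/sS].
by move=> x xt; apply: tS; rewrite inE xt orbT.
Qed.

Lemma heap_squeeze wall s : {subset s <= S} -> heap wall (map g s) = heap wall s.
Proof.
elim: s => //= a s IH sS; have aS : a \in S by apply: sS; rewrite mem_head.
have {}sS : {subset s <= S} by move=> x xs; apply: sS; rewrite inE xs orbT.
by rewrite (heap_from_squeeze _ (s := [::])) // IH.
Qed.

Lemma push_squeeze a s : a \in S -> {subset s <= S} ->
  push adj (g a) (map g s) = (map g (push adj a s).1, g (push adj a s).2).
Proof.
elim: s a => //= t s IH a aS sS; have tS : t \in S by apply: sS; rewrite mem_head.
have {}sS : {subset s <= S} by move=> x xs; apply: sS; rewrite inE xs orbT.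
by rewrite squeeze_adj //; case: ifP => _; rewrite IH.
Qed.
End Squeeze.

Definition squeezable (E : rel (seq nat)) := forall S s s',
  {subset s <= S} -> {subset s' <= S} -> E (map (squeeze S) s) (map (squeeze S) s') = E s s'.

Fixpoint swaps (s : seq nat) : seq (seq nat) :=
  if s is a :: s1 then
    (if s1 is b :: s2 then (b :: a :: s2) :: map (cons a) (swaps s1) else [::])
  else [::].

Fixpoint words (m n : nat) : seq (seq nat) :=
  if m is m'.+1 then flatten [seq [seq a :: w | w <- words m' n] | a <- iota 0 n]
  else [:: [::]].

(** With the new colour there are [m.+1] colours, and their squeezed values are at
most [2 * m.+1]. *)
Definition push_closed_check wall (E : rel (seq nat)) m :=
  let r := iota 0 m.*2.+3 in
  all (fun s => all (fun s' => if E s s' then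
    all (fun x => if heap wall (x :: s) && heap wall (x :: s') then
      let p := push adj x s in let p' := push adj x s' in (p.2 == p'.2) && E p.1 p'.1
      else true) r else true) (swaps s)) (words m m.*2.+3).

Lemma mem_words m n s : size s = m -> all (fun a => a < n) s -> s \in words m n.
Proof.
elim: m s => [|m IH] [|a s] //= [sz] /andP [an sn].
apply/flattenP; exists [seq a :: w | w <- words m n].
  by apply/mapP; exists a; rewrite ?mem_iota.
by apply: map_f; apply: IH.
Qed.

Lemma swaps_perm s s' : s' \in swaps s -> perm_eq s' s.
Proof.
elim: s s' => //= a [|b s] IH s' //; rewrite inE => /predU1P [->|/mapP [t /IH pt ->]].
  by apply/permP => p /=; lia.
by rewrite perm_cons.
Qed.

Lemma swaps_map (h : nat -> nat) s s' : s' \in swaps s -> map h s' \in swaps (map h s).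
Proof.
elim: s s' => //= a [|b s] IH s' //; rewrite inE => /predU1P [->|/mapP [t /IH pt ->]].
  by rewrite mem_head.
by rewrite inE; apply/orP; right; apply/mapP; exists (map h t).
Qed.

(** Everything that occurs in [push_closed] depends on order and adjacency of the
colours only, hence it can be tested on the squeezed word. *)
Lemma push_closed_checkP wall E m : squeezable E ->
  (forall s s', E s s' -> size s = m /\ s' \in swaps s) ->
  push_closed_check wall E m -> push_closed wall E.
Proof.
move=> sqE Em chk x s s' Ess h h'; have [sz sw] := Em _ _ Ess.
set S := x :: s.
have xS : x \in S by rewrite mem_head.
have sS : {subset s <= S} by move=> y ys; rewrite inE ys orbT.
have sS' : {subset s' <= S} by move=> y; rewrite (perm_mem (swaps_perm sw)); apply: sS.
have szS : size S = m.+1 by rewrite /= sz.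
have bd y : squeeze S y < m.*2.+3 by rewrite ltnS (leq_trans (squeeze_bound S y)) // szS doubleS.
have ws : map (squeeze S) s \in words m m.*2.+3.
  by apply: mem_words; rewrite ?size_map // all_map; apply/allP => y _ /=; apply: bd.
move/allP: chk => /(_ _ ws) /allP /(_ _ (swaps_map (squeeze S) sw)).
rewrite sqE // Ess => /allP /(_ (squeeze S x)); rewrite mem_iota bd => /(_ isT).
have hx t : {subset t <= S} -> {subset x :: t <= S}.
  by move=> tS y; rewrite inE => /predU1P [->|/tS].
rewrite -!map_cons !heap_squeeze ?h ?h' /=; try exact: hx.
rewrite !push_squeeze //= => /andP [/eqP e2 e1].
have pS t : {subset t <= S} -> (push adj x t).2 \in S /\ {subset (push adj x t).1 <= S}.
  move=> tS; split=> [|y yt]; apply: (hx _ tS); rewrite (mem_push adj) ?eqxx // yt orbT //.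
have [p2 p1] := pS _ sS; have [p2' p1'] := pS _ sS'.
by split; [exact: squeeze_inj e2|rewrite sqE in e1].
Qed.

Lemma knuth3_push_closed : push_closed false knuth3.
Proof.
apply: (@push_closed_checkP _ _ 3); last by vm_compute.
- move=> S [|a [|b [|c [|]]]] // [|a' [|b' [|c' [|]]]] //= sS sS'.
  have [aS bS cS] : [/\ a \in S, b \in S & c \in S] by split; apply: sS; rewrite !inE eqxx ?orbT.
  have [aS' bS' cS'] : [/\ a' \in S, b' \in S & c' \in S]
    by split; apply: sS'; rewrite !inE eqxx ?orbT.
  by rewrite /strictly_between !squeeze_eqE // !squeeze_ltE.
- move=> [|a [|b [|c [|]]]] // [|a' [|b' [|c' [|]]]] //=.
  by case/orP=> /and4P [/eqP <- /eqP <- /eqP <- _]; split; rewrite // !inE !eqxx ?orbT.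
Qed.

Lemma knuth4_push_closed : push_closed true knuth4.
Proof.
apply: (@push_closed_checkP _ _ 4); last by vm_compute.
- move=> S [|a [|b [|c [|d [|]]]]] // [|a' [|b' [|c' [|d' [|]]]]] //= sS sS'.
  have [aS bS cS dS] : [/\ a \in S, b \in S, c \in S & d \in S]
    by split; apply: sS; rewrite !inE eqxx ?orbT.
  have [aS' bS' cS' dS'] : [/\ a' \in S, b' \in S, c' \in S & d' \in S]
    by split; apply: sS'; rewrite !inE eqxx ?orbT.
  have mS : maxn a d \in S by rewrite /maxn; case: ifP.
  by rewrite /strictly_between squeeze_max // !squeeze_eqE // !squeeze_ltE.
- move=> [|a [|b [|c [|d [|]]]]] // [|a' [|b' [|c' [|d' [|]]]]] //=.
  by case/or3P=> [/and5P [/eqP <- /eqP <- /eqP <- /eqP <- _]|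
    /and5P [/eqP <- /eqP <- /eqP <- /eqP <- _]|/and5P [/eqP <- /eqP <- /eqP <- /eqP <- _]];
    split; rewrite // !inE !eqxx ?orbT.
Qed.

Lemma strictly_betweenC a b c : strictly_between a b c = strictly_between c b a.
Proof. by rewrite /strictly_between orbC. Qed.

Lemma knuth3_rev s s' : knuth3 s s' -> knuth3 (rev s) (rev s').
Proof.
case: s => [|a [|b [|c [|]]]] //; case: s' => [|a' [|b' [|c' [|]]]] //=.
rewrite orbC => /orP [] /and4P [e1 e2 e3]; rewrite strictly_betweenC => bt; apply/orP;
  [left|right];
by rewrite e1 e2 e3 bt.
Qed.

Lemma knuth4_rev s s' : knuth4 s s' -> knuth4 (rev s) (rev s').
Proof.
case: s => [|a [|b [|c [|d [|]]]]] //; case: s' => [|a' [|b' [|c' [|d' [|]]]]] //=.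
rewrite /rev /=.
case/or3P => [/and5P [e1 e2 e3 e4 /andP [ab bt]]|/and5P [e1 e2 e3 e4 /andP [ab bt]]|/and5P [e1 e2 e3 e4 bt]].
- by apply/or3P; apply: Or32; rewrite e1 e2 e3 e4 ab strictly_betweenC bt.
- by apply/or3P; apply: Or31; rewrite e1 e2 e3 e4 ab strictly_betweenC bt.
- by apply/or3P; apply: Or33; rewrite e1 e2 e3 e4 maxnC strictly_betweenC bt.
Qed.

(** * Posets coloured by diagonals *)

(** The conditions are symmetric under reversal of the order, so that one closure
argument serves slides and reverse slides. *)
Record coloring (B : finType) (le : rel B) (wall : bool) (c : B -> nat) : Prop := Coloring {
  color_cov : forall x y, covered le x y -> adj (c x) (c y);
  color_comp : forall x y, adj (c x) (c y) || (c x == c y) -> le x y || le y x;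
  color_up : forall x y, x != y -> le x y -> c x = c y ->
    exists z, [/\ le x z, le z y & c z = (c x).+1];
  color_down : forall x y, x != y -> le x y -> c x = c y ->
    wall && (c x == 0) \/ exists z, [/\ le x z, le z y & (c z).+1 = c x] }.

Lemma adjC a b : adj a b = adj b a.
Proof. by rewrite /adj orbC. Qed.

Lemma coloring_flip (B : finType) (le : rel B) wall c : coloring le wall c ->
  coloring (flip le) wall c.
Proof.
case=> cc cm cu cd; split.
- by move=> x y; rewrite (covered_flip le x y) adjC; apply: cc.
- by move=> x y /cm; rewrite orbC.
- move=> x y xy yx e; rewrite eq_sym in xy; have [z [yz zx ez]] := cu y x xy yx (esym e).
  by exists z; rewrite e.
- move=> x y xy yx e; rewrite eq_sym in xy; have := cd y x xy yx (esym e).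
  rewrite e => -[->|[z [yz zx ez]]]; [by left|right; by exists z].
Qed.

Section Colors.
Variables (B : finType) (le : rel B) (wall : bool) (c : B -> nat).
Hypotheses (le_order : partial_order le) (cl : coloring le wall c).

Let le_refl : reflexive le. Proof. by case: le_order. Qed.
Let le_anti : antisymmetric le. Proof. by case: le_order. Qed.
Let le_trans : transitive le. Proof. by case: le_order. Qed.

Notation cov := (covered le).

(** Colours that differ by one belong to comparable boxes, and consecutive
comparable letters form a covering pair. *)
Lemma color_adj p a t s : valid le (p ++ a :: t :: s) -> cov a t = adj (c a) (c t).
Proof.
move=> v; apply/idP/idP => [|h]; first exact: color_cov cl _ _.
apply: (valid_adj le_order v).
have := color_comp cl (x := a) (y := t); rewrite h => /(_ isT) /orP [//|ta].
have : valid le [:: a; t] by apply: (valid_mid (s1 := p) (s3 := s)).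
by case; rewrite /lin_ext /= ta.
Qed.

Lemma push_color p a s : valid le (p ++ a :: s) ->
  push adj (c a) (map c s) = (map c (push cov a s).1, c (push cov a s).2).
Proof.
elim: s p a => //= t s IH p a v.
rewrite -(color_adj v); case: ifP => h /=; first by rewrite (IH (rcons p a)) ?cat_rcons.
rewrite (IH (rcons p t)) // cat_rcons; apply: (valid_swap le_order v); by rewrite h.
Qed.


(** The boxes that [color_up] and [color_down] provide between two letters of one
colour belong to the shape by convexity, hence stand between the two letters. *)
Lemma heap_from_color a seen s : valid le (a :: rev seen ++ s) ->
  heap_from wall (c a) (map c seen) (map c s).
Proof.
elim: s seen => //= b s IH seen v; rewrite -(map_cons c b) (IH (b :: seen)) ?andbT; last first.
  by rewrite rev_cons cat_rcons.
apply/implyP => /eqP ab.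
have v' : valid le (a :: rcons (rev seen) b).
  by apply: (valid_mid (s1 := [::]) (s3 := s)); rewrite /= cat_rcons.
have u := lin_ext_uniq le_order v'.1; move: u; rewrite /= rcons_uniq mem_rcons inE negb_or.
case/andP => /andP [nab _] _.
have bin : b \in a :: rcons (rev seen) b by rewrite inE mem_rcons mem_head orbT.
have lab : le a b.
  have := color_comp cl (x := a) (y := b); rewrite ab eqxx orbT => /(_ isT) /orP [//|ba].
  by move: v'.1; rewrite /lin_ext /= => /andP [/allP /(_ b)];
    rewrite mem_rcons mem_head ba => /(_ isT).
have mid z : c z != c a -> le a z -> le z b -> z \in seen.
  move=> cz az zb; have := v'.2 a z b (mem_head _ _) bin az zb.
  rewrite inE mem_rcons inE mem_rev => /or3P [/eqP zx|/eqP zx|//].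
    by rewrite zx eqxx in cz.
  by rewrite zx ab eqxx in cz.
rewrite /surrounded; apply/andP; split.
  have [z [az zb cz]] := color_up cl nab lab ab.
  by apply/mapP; exists z => //; apply: mid => //; rewrite cz neq_ltn ltnSn orbT.
case: (color_down cl nab lab ab) => [->//|[z [az zb cz]]]; apply/orP; right.
rewrite has_map; apply/hasP; exists z; last by rewrite /= cz.
by apply: mid => //; rewrite -cz neq_ltn ltnSn.
Qed.

Lemma heap_color s : valid le s -> heap wall (map c s).
Proof.
elim: s => //= a s IH v; rewrite IH; last exact: (valid_suffix (s1 := [:: a])).
by rewrite (heap_from_color (seen := [::])).
Qed.

(** Boxes of one colour form a chain, and the last letter of a word is maximal. *)
Lemma last_color_eq X Y x y : valid le (rcons X x) -> valid le (rcons Y y) ->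
  rcons X x =i rcons Y y -> c x = c y -> x = y.
Proof.
move=> vX vY e cxy.
have := color_comp cl (x := x) (y := y); rewrite cxy eqxx orbT => /(_ isT) /orP [xy|yx].
  by apply/esym/(last_max vX) => //; rewrite e mem_rcons mem_head.
by apply: (last_max vY) => //; rewrite -e mem_rcons mem_head.
Qed.

End Colors.

Definition colored (B : finType) (le : rel B) (c : B -> nat) (E : rel (seq nat)) X Y :=
  [/\ valid le X, valid le Y, X =i Y & E (map c X) (map c Y)].

Lemma colored_slide_closed (B : finType) (le : rel B) wall c E : partial_order le ->
  coloring le wall c ->
  push_closed wall E -> slide_closed le (colored le c E).
Proof.
move=> le_order cl Ecl X Y a [vX vY e EXY] i.
have i' : enters le Y a by rewrite -(enters_eq le a e).
have [aX _] := proj1 (entersP le_order a vX) i; have [aY _] := proj1 (entersP le_order a vY) i'.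
have := Ecl _ _ _ EXY (heap_color le_order cl aX) (heap_color le_order cl aY).
rewrite (push_color le_order cl (p := [::]) aX) (push_color le_order cl (p := [::]) aY) /=.
case=> c2 E1.
have pX := valid_push le_order aX; have pY := valid_push le_order aY.
have e2 : (push (covered le) a X).2 = (push (covered le) a Y).2.
  apply: (last_color_eq cl pX pY _ c2) => x.
  by rewrite !(perm_mem (push_perm _ _ _)) !inE e.
split=> //; split=> //; [exact: valid_pushed|exact: valid_pushed|exact: pushed_eq].
Qed.

Lemma colored_stable (B : finType) (le : rel B) wall c E : partial_order le ->
  coloring le wall c ->
  push_closed wall E -> (forall s s', E s s' -> E (rev s) (rev s')) ->
  stable le (colored le c E).
Proof.
move=> le_order cl Ecl Erev.
apply: (stableI (Q' := colored (flip le) c E)) => [X Y []//|X Y||].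
- have eE : E (map c (rev X)) (map c (rev Y)) = E (map c X) (map c Y).
    by apply/idP/idP => /Erev; rewrite !map_rev ?revK.
  rewrite /revrel /colored eE; split=> -[v1 v2 e h];
    [case: (proj1 (revrel_valid le X Y) (And3 v1 v2 e))
    |case: (proj2 (revrel_valid le X Y) (And3 v1 v2 e))] => *; by split.
- exact: colored_slide_closed Ecl.
- exact: colored_slide_closed (partial_order_flip le_order) (coloring_flip cl) Ecl.
Qed.

(** * Boxes in the plane *)

Definition grid_le (p q : nat * nat) := (p.1 <= q.1) && (p.2 <= q.2).

Lemma even_quadricE n p : 3 <= n -> boxes (EvenQuadric n) p =
  (p.2 == 1) && (1 <= p.1 <= n - 1) || (p.2 == 2) && (n - 2 <= p.1 <= 2 * n - 4).
Proof.
case: p => i [|[|[|j]]] n3; rewrite /= /in_rows /= ?andbF ?andbT ?orbF //.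
Qed.

Lemma odd_quadricE n p : boxes (OddQuadric n) p = (p.2 == 1) && (1 <= p.1 <= 2 * n - 1).
Proof. by case: p => i [|[|j]]; rewrite /= /in_rows /= ?andbF. Qed.

Definition rows_boxes (rows : seq (nat * nat)) : seq (nat * nat) :=
  flatten [seq [seq (i, j.+1) | i <- iota (nth (1, 0) rows j).1
     ((nth (1, 0) rows j).2.+1 - (nth (1, 0) rows j).1)] | j <- iota 0 (size rows)].

Lemma mem_rows_boxes rows p : in_rows rows p -> p \in rows_boxes rows.
Proof.
case: p => i [|j]; rewrite /in_rows //= => /andP [js].
case e: (nth _ _ _) => [u v] /andP [ui iv]; apply/flattenP.
exists [seq (i, j.+1) | i <- iota u (v.+1 - u)].
  by apply/mapP; exists j; rewrite ?mem_iota // e.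
by apply/mapP; exists i => //; rewrite mem_iota; lia.
Qed.

Definition region_step (bx : pred (nat * nat)) p q :=
  grid_le (p.1.+1, p.2) q && bx (p.1.+1, p.2) || grid_le (p.1, p.2.+1) q && bx (p.1, p.2.+1).

Lemma rows_step rows :
  all (fun p => all (fun q => grid_le p q ==> ((p == q) || region_step (in_rows rows) p q))
    (rows_boxes rows)) (rows_boxes rows) ->
  forall p q, in_rows rows p -> in_rows rows q -> grid_le p q -> p != q ->
  region_step (in_rows rows) p q.
Proof.
move=> chk p q /mem_rows_boxes pr /mem_rows_boxes qr pq /negbTE npq.
by move/allP: chk => /(_ p pr) /allP /(_ q qr); rewrite pq npq.
Qed.

(** The regions need not be convex in the plane; in a staircase some steps between
two comparable boxes are blocked, but never both of them. *)
Lemma boxes_step t p q : variety_ok t -> boxes t p -> boxes t q -> grid_le p q -> p != q ->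
  region_step (boxes t) p q.
Proof.
case: t => [k n|n|n|n|n||] ok.
- case: p => i j; case: q => i' j'; rewrite /region_step /grid_le /= xpair_eqE; lia.
- rewrite /region_step !odd_quadricE; case: p => i j; case: q => i' j';
  rewrite /grid_le /= xpair_eqE; lia.
- case: p => i j; case: q => i' j'; rewrite /region_step /grid_le /= xpair_eqE; lia.
- case: p => i j; case: q => i' j'; rewrite /region_step /grid_le /= xpair_eqE; lia.
- rewrite /region_step !even_quadricE //; case: p => i j; case: q => i' j'.
  rewrite /grid_le /= xpair_eqE; move: ok => /= ok; lia.
- by move: p q; apply: rows_step; vm_compute.
- by move: p q; apply: rows_step; vm_compute.
Qed.

Lemma grid_le_trans p q r : grid_le p q -> grid_le q r -> grid_le p r.
Proof. by rewrite /grid_le; lia. Qed.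

Record coords (B : finType) (le : rel B) (t : variety) (f : B -> nat * nat) : Prop := Coords {
  coords_order : partial_order le;
  coords_ok : variety_ok t;
  coords_inj : injective f;
  coords_im : forall p, boxes t p <-> exists x, f x = p;
  coords_cov : forall x y, covered le x y = right_or_up (f x) (f y) }.

Section Coordinates.
Variables (B : finType) (le : rel B) (t : variety) (f : B -> nat * nat).
Hypothesis cf : coords le t f.

Let le_order := coords_order cf.
Let le_refl : reflexive le. Proof. by case: le_order. Qed.
Let le_anti : antisymmetric le. Proof. by case: le_order. Qed.
Let le_trans : transitive le. Proof. by case: le_order. Qed.

Lemma coords_box x : boxes t (f x).
Proof. by apply/(coords_im cf); exists x. Qed.

Lemma coords_pre p : boxes t p -> exists x, f x = p.
Proof. by move/(coords_im cf). Qed.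

Lemma coords_eq x y : (x == y) = (f x == f y).
Proof. by rewrite (inj_eq (coords_inj cf)). Qed.

(** Only the covering relations are given by coordinates.  In one direction a
comparable pair is joined by a chain of covers, in the other the chain is built
from the steps of [boxes_step]. *)
Lemma coords_le x y : le x y = grid_le (f x) (f y).
Proof.
apply/idP/idP.
  have [n] := ubnP #|[set z | le x z && le z y]|; elim: n x => // n IH x sn xy.
  have [->|nxy] := eqVneq x y; first by rewrite /grid_le !leqnn.
  pose S := [set z | slt le x z && le z y].
  have yS : y \in S by rewrite inE /slt nxy xy le_refl.
  (* Among the boxes above [x] and weakly below [y], one with the fewest boxes
     weakly below it covers [x]. *)
  pose h z := #|[set u | le u z]|.
  have [z zS zmin] := @arg_minnP _ y (mem S) h yS.
  move: (zS); rewrite /= inE => /andP [xz zy].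
  have cxz : covered le x z.
    rewrite /covered xz; apply/forallP => u; apply/negP => /andP [xu /andP [uz luz]].
    have uS : u \in S by rewrite inE xu (le_trans luz zy).
    have := zmin u uS; rewrite leqNgt => /negP []; apply: proper_card; apply/properP; split.
      by apply/subsetP => v; rewrite !inE => vu; apply: le_trans vu luz.
    exists z; rewrite !inE ?le_refl //; apply: contra uz => zu.
    by apply/eqP/le_anti; rewrite luz.
  apply: (@grid_le_trans _ (f z)).
    by move: cxz; rewrite (coords_cov cf) /right_or_up /grid_le => /orP [] /eqP -> /=;
      rewrite ?leqnn ?leqnSn.
  case/andP: xz => nxz lxz; apply: IH => //; rewrite ltnS in sn; apply: leq_trans sn.
  apply: proper_card; apply/properP; split.
    by apply/subsetP => v; rewrite !inE => /andP [zv ->]; rewrite (le_trans lxz zv).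
  exists x; rewrite !inE ?le_refl ?xy //; apply: contra nxz => /andP [zx _].
  by apply/eqP/le_anti; rewrite lxz.
have [n] := ubnP ((f y).1 + (f y).2 - ((f x).1 + (f x).2)); elim: n x => // n IH x sn xy.
have [/(coords_inj cf) ->//|nxy] := eqVneq (f x) (f y).
have key p : right_or_up (f x) p -> boxes t p -> grid_le p (f y) -> le x y.
  move=> rp /coords_pre [z fz] py; apply: (@le_trans z).
    by apply: covered_le; rewrite (coords_cov cf) fz.
  apply: IH; rewrite fz //; move: rp py nxy xy sn; rewrite /right_or_up /grid_le.
  case: p fz => p1 p2 _; case: (f x) => x1 x2; case: (f y) => y1 y2 /=; rewrite !xpair_eqE; lia.
case/orP: (boxes_step (coords_ok cf) (coords_box x) (coords_box y) xy nxy) => /andP [h1 h2];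
  by apply: key h2 h1; rewrite /right_or_up eqxx ?orbT.
Qed.

End Coordinates.

Section Tops.
Variables (B : finType) (le : rel B).
Hypothesis le_order : partial_order le.

Let le_refl : reflexive le. Proof. by case: le_order. Qed.
Let le_anti : antisymmetric le. Proof. by case: le_order. Qed.
Let le_trans : transitive le. Proof. by case: le_order. Qed.

Lemma exists_max (D : {set B}) x : x \in D ->
  exists2 d, d \in D /\ le x d & forall y, y \in D -> le d y -> y = d.
Proof.
move=> xD; pose S := [set z in D | le x z].
have xS : x \in S by rewrite inE xD le_refl.
pose h z := #|[set u | le u z]|.
have [d dS dmax] := @arg_maxnP _ x (mem S) h xS.
move: (dS); rewrite /= inE => /andP [dD xd]; exists d => // y yD dy.
have yS : y \in S by rewrite inE yD (le_trans xd dy).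
have hyd : h y <= h d by apply: dmax.
move: hyd; rewrite leqNgt => /negP dm; apply/esym/eqP; apply: contraT => ndy.
case: dm; apply: proper_card; apply/properP; split.
  by apply/subsetP => v; rewrite !inE => vd; apply: le_trans vd dy.
exists y; rewrite !inE ?le_refl //; apply: contra ndy => yd.
by apply/eqP/le_anti; rewrite dy.
Qed.

Lemma lin_ext_exists (D : {set B}) : exists2 w, lin_ext le w & [set x in w] = D.
Proof.
have [n] := ubnP #|D|; elim: n D => // n IH D sn.
have [->|[x xD]] := set_0Vmem D; first by exists [::] => //; apply/setP => x; rewrite !inE.
have [d [dD _] dm] := exists_max xD.
have [|w lw ew] := IH (D :\ d).
  by move: sn; rewrite (cardsD1 d D) dD.
have we y : y \in w = (y != d) && (y \in D) by have := in_setD1 y D d; rewrite -ew inE.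
exists (rcons w d).
  rewrite /lin_ext pairwise_rcons -/(lin_ext le w) lw andbT; apply/allP => y.
  rewrite we => /andP [nyd yD]; apply: contra nyd => dy; apply/eqP; exact: dm.
by apply/setP => y; rewrite inE mem_rcons inE we; case: eqP => [->|].
Qed.

(** The letters of [s], from the last to the first, can be removed from [l] one
after another as maximal boxes. *)
Fixpoint peels (l : {set B}) (s : seq B) : Prop :=
  if s is a :: s' then (forall x, x \in l -> le a x -> x \in s) /\ peels l s' else True.

Lemma peels_up (l : {set B}) s x y : peels l s -> y \in s -> x \in l -> le y x -> x \in s.
Proof.
elim: s => //= a s IH [ta ts]; rewrite inE => /predU1P [->|ys] xl yx; first exact: ta.
by rewrite inE IH ?orbT.
Qed.

Lemma peels_lin (l : {set B}) (s : seq B) : {subset s <= l} -> uniq s -> peels l s ->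
  lin_ext le s.
Proof.
elim: s => //= a s IH sl /andP [as_ us] [_ ts].
rewrite /lin_ext /= -/(lin_ext le s) IH ?andbT // => [|x xs]; last by apply: sl;
  rewrite inE xs orbT.
apply/allP => y ys; apply: contra as_ => ya; apply: (peels_up ts ys _ ya).
by apply: sl; rewrite mem_head.
Qed.

Lemma straight_valid (l : {set B}) w : straight le l -> [set x in w] = l -> lin_ext le w ->
  valid le w.
Proof.
move=> sl ew lw; split=> // x y z _ zw _ yz.
have : y \in [set x in w] by rewrite ew; apply: sl yz _; rewrite -ew inE.
by rewrite inE.
Qed.

(** The prefix [P] does not depend on the order [s'] in which the top boxes are
removed. *)
Lemma straight_words_ending (l : {set B}) (s : seq B) : straight le l -> {subset s <= l} ->
  exists P, forall s', s' =i s -> uniq s' -> peels l s' ->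
    valid le (P ++ s') /\ [set x in P ++ s'] = l.
Proof.
move=> sl ss; have [P lP eP] := lin_ext_exists (l :\: [set x in s]).
have mP x : (x \in P) = (x \notin s) && (x \in l).
  have : (x \in [set x in P]) = (x \in l :\: [set x in s]) by rewrite eP.
  by rewrite !inE.
exists P => s' e us' ts'.
have ss' : {subset s' <= l} by move=> x; rewrite e; apply: ss.
have el : [set x in P ++ s'] = l.
  apply/setP => x; rewrite inE mem_cat mP e; have := ss x.
  by case: (x \in s) => //= [/(_ isT) -> //|_]; rewrite orbF.
split=> //; apply: (straight_valid sl el).
rewrite lin_ext_cat lP (peels_lin ss' us' ts') /=; apply/allP => x; rewrite mP => /andP [xs xl].
by apply/allP => y ys; apply: contra xs => yx; rewrite -e; exact: (peels_up ts' ys xl yx).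
Qed.

Lemma straight_earlier w s1 x s2 y : valid le w -> straight le [set z in w] ->
  w = s1 ++ x :: s2 -> slt le y x -> y \in s1.
Proof.
move=> vw sw ew /andP [nyx yx].
have : y \in [set z in w] by apply: (sw y x yx); rewrite inE ew mem_cat mem_head orbT.
rewrite inE ew mem_cat inE (negbTE nyx) /= => /orP [//|ys].
move: vw.1; rewrite ew lin_ext_cat {2}/lin_ext /= => /and3P [_ /andP [/allP /(_ y ys)]].
by rewrite yx.
Qed.

End Tops.

(** The box [p] can be appended to the word [s] of a straight shape.  The tests for
positivity keep the predecessor of 0 from being taken for a neighbour. *)
Definition addable (bx : pred (nat * nat)) (s : seq (nat * nat)) (p : nat * nat) :=
  [&& bx p, p \notin s, (0 < p.1) && bx (p.1.-1, p.2) ==> ((p.1.-1, p.2) \in s)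
    & (0 < p.2) && bx (p.1, p.2.-1) ==> ((p.1, p.2.-1) \in s)].

Section StraightWords.
Variables (B : finType) (le : rel B) (t : variety) (f : B -> nat * nat).
Hypothesis cf : coords le t f.

Lemma coords_straight (w : seq B) :
  (forall p q, p \in map f w -> boxes t q -> grid_le q p -> q \in map f w) ->
  straight le [set x in w].
Proof.
move=> cw x y; rewrite (coords_le cf) !inE => xy yw.
by rewrite -(mem_map (coords_inj cf)); apply: cw (coords_box cf x) xy; apply: map_f.
Qed.

Lemma coords_lin_ext (w : seq B) :
  lin_ext le w = pairwise (fun p q => ~~ grid_le q p) (map f w).
Proof.
by rewrite /lin_ext pairwise_map; apply: eq_pairwise => x y /=; rewrite (coords_le cf).
Qed.

Lemma coords_addable w s1 p s2 : valid le w -> straight le [set z in w] ->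
  map f w = s1 ++ p :: s2 -> addable (boxes t) s1 p.
Proof.
move=> vw sw e.
have uw : uniq (map f w) by rewrite map_inj_uniq; [apply:
  (lin_ext_uniq (coords_order cf) vw.1)|apply: (coords_inj cf)].
pose n := size s1.
have ew : w = take n w ++ drop n w by rewrite cat_take_drop.
have e1 : map f (take n w) = s1 by rewrite map_take e take_size_cat.
have e2 : map f (drop n w) = p :: s2 by rewrite map_drop e drop_size_cat.
case: (drop n w) ew e2 => // x w2 ew [fx _].
have early q : boxes t q -> right_or_up q p -> q \in s1.
  move=> /(coords_pre cf) [y fy] qp; rewrite -e1 -fy; apply: map_f.
  apply: (straight_earlier vw sw ew).
  by have : covered le y x; [rewrite (coords_cov cf) fy fx|case/andP].
apply/and4P; split; first by rewrite -fx; apply: (coords_box cf).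
- by move: uw; rewrite e cat_uniq /= => /and3P [_ ]; rewrite negb_or => /andP [].
- apply/implyP => /andP [p0 bp]; apply: early => //; rewrite /right_or_up /= prednK //.
  by case: (p) => /= *; rewrite eqxx.
- apply/implyP => /andP [p0 bp]; apply: early => //; rewrite /right_or_up /= prednK //.
  by case: (p) => /= *; rewrite eqxx orbT.
Qed.
End StraightWords.

(** A window can be tested without the rest of the filling: it suffices that its two
words can be removed from the top of the shape. *)
Lemma peels_window (B : finType) (le : rel B) om k w c c' X Y : partial_order le ->
  valid le w -> straight le [set x in w] -> om = Some k -> {subset rcons X c <= w} ->
  uniq (rcons X c) -> uniq (rcons Y c') -> rcons Y c' =i rcons X c ->
  peels le [set x in w] (rcons X c) -> peels le [set x in w] (rcons Y c') ->
    size X = k.-1 -> 0 < k ->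
  (valid le (rcons X c) -> valid le (rcons Y c') ->
   dual_equiv le (filling_of (rcons X c)) (filling_of (rcons Y c'))) ->
  exists k P X Y, [/\ om = Some k, valid le (P ++ rcons X c), P ++ rcons X c =i w
    & dual_words le k (rcons X c) (rcons Y c')].
Proof.
move=> le_order vw sw omk ss uX uY eYX tX tY sz k0 dual.
have [|P hP] := straight_words_ending le_order (s := rcons X c) sw; first by move=> x /ss;
  rewrite inE.
have [v1 e1] := hP _ (fun x => erefl _) uX tX; have [v2 e2] := hP _ eYX uY tY.
have v1' := valid_suffix v1; have v2' := valid_suffix v2.
exists k, P, X, Y; split=> //; first exact: set_mem_eq e1 erefl.
split=> //; last exact: dual.
  by rewrite size_rcons sz prednK.
Qed.

(** * Rectangles and staircases: moving a corner to the end *)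

(** Adding [k] keeps the diagonal a natural number. *)
Definition grassmann_color k (p : nat * nat) := p.1 + k - p.2.
Definition staircase_color (p : nat * nat) := p.1 - p.2.

Lemma grassmann_coloring (B : finType) (le : rel B) k n f : coords le (Gr k n) f ->
  coloring le false (fun x => grassmann_color k (f x)).
Proof.
move=> cf; split=> x y.
- rewrite (coords_cov cf); have := coords_box cf x; have := coords_box cf y.
  rewrite /right_or_up /grassmann_color /adj /=.
  by case: (f x) => i j; case: (f y) => i' j'; rewrite !xpair_eqE /=; lia.
- rewrite !(coords_le cf); have := coords_box cf x; have := coords_box cf y.
  rewrite /grid_le /grassmann_color /adj /=.
  by case: (f x) => i j; case: (f y) => i' j' /=; lia.
- rewrite (coords_eq cf) (coords_le cf) => nxy xy e.
  have bx := coords_box cf x; have b_y := coords_box cf y.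
  have [|z fz] := coords_pre cf (p := ((f x).1.+1, (f x).2)).
    move: nxy xy e bx b_y; rewrite /grid_le /grassmann_color /=.
    by case: (f x) => i j; case: (f y) => i' j'; rewrite !xpair_eqE /=; lia.
  exists z; rewrite !(coords_le cf) fz; move: nxy xy e bx b_y;
    rewrite /grid_le /grassmann_color /=.
  by case: (f x) => i j; case: (f y) => i' j'; rewrite !xpair_eqE /= => *; split; lia.
- rewrite (coords_eq cf) (coords_le cf) => nxy xy e; right.
  have bx := coords_box cf x; have b_y := coords_box cf y.
  have [|z fz] := coords_pre cf (p := ((f x).1, (f x).2.+1)).
    move: nxy xy e bx b_y; rewrite /grid_le /grassmann_color /=.
    by case: (f x) => i j; case: (f y) => i' j'; rewrite !xpair_eqE /=; lia.
  exists z; rewrite !(coords_le cf) fz; move: nxy xy e bx b_y;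
    rewrite /grid_le /grassmann_color /=.
  by case: (f x) => i j; case: (f y) => i' j'; rewrite !xpair_eqE /= => *; split; lia.
Qed.

Definition staircase (t : variety) n := t = LG n \/ t = OG n.

Lemma staircaseE t n p : staircase t n -> boxes t p = (1 <= p.2 <= p.1) && (p.1 <= n).
Proof. by case=> ->. Qed.

Lemma staircase_coloring (B : finType) (le : rel B) t n f : staircase t n -> coords le t f ->
  coloring le true (fun x => staircase_color (f x)).
Proof.
move=> st cf; have bE p := staircaseE p st; split=> x y.
- rewrite (coords_cov cf); have := coords_box cf x; have := coords_box cf y.
  rewrite !bE /right_or_up /staircase_color /adj /=.
  by case: (f x) => i j; case: (f y) => i' j'; rewrite !xpair_eqE /=; lia.
- rewrite !(coords_le cf); have := coords_box cf x; have := coords_box cf y.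
  rewrite !bE /grid_le /staircase_color /adj /=.
  by case: (f x) => i j; case: (f y) => i' j' /=; lia.
- rewrite (coords_eq cf) (coords_le cf) => nxy xy e.
  have bx := coords_box cf x; have b_y := coords_box cf y; rewrite !bE in bx b_y.
  have [|z fz] := coords_pre cf (p := ((f x).1.+1, (f x).2)).
    rewrite bE; move: nxy xy e bx b_y; rewrite /grid_le /staircase_color /=.
    by case: (f x) => i j; case: (f y) => i' j'; rewrite !xpair_eqE /=; lia.
  exists z; rewrite !(coords_le cf) fz; move: nxy xy e bx b_y;
    rewrite /grid_le /staircase_color /=.
  by case: (f x) => i j; case: (f y) => i' j'; rewrite !xpair_eqE /= => *; split; lia.
- rewrite (coords_eq cf) (coords_le cf) => nxy xy e.
  have bx := coords_box cf x; have b_y := coords_box cf y; rewrite !bE in bx b_y.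
  have [->|c0] := eqVneq (staircase_color (f x)) 0; [by left|right].
  have [|z fz] := coords_pre cf (p := ((f x).1, (f x).2.+1)).
    rewrite bE; move: c0 nxy xy e bx b_y; rewrite /grid_le /staircase_color /=.
    by case: (f x) => i j; case: (f y) => i' j'; rewrite !xpair_eqE /=; lia.
  exists z; rewrite !(coords_le cf) fz; move: c0 nxy xy e bx b_y;
    rewrite /grid_le /staircase_color /=.
  by case: (f x) => i j; case: (f y) => i' j'; rewrite !xpair_eqE /= => *; split; lia.
Qed.

Lemma grassmann_dual (B : finType) (le : rel B) k n f X Y : coords le (Gr k n) f ->
  valid le X -> valid le Y -> X =i Y ->
  knuth3 (map (fun x => grassmann_color k (f x)) X) (map (fun x => grassmann_color k (f x)) Y) ->
  dual_equiv le (filling_of X) (filling_of Y).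
Proof.
move=> cf vX vY e E; have le_order := coords_order cf.
apply: (stable_dual le_order (colored_stable le_order (grassmann_coloring cf) knuth3_push_closed knuth3_rev)).
by split.
Qed.

Lemma staircase_dual (B : finType) (le : rel B) t n f X Y : staircase t n -> coords le t f ->
  valid le X -> valid le Y -> X =i Y ->
  knuth4 (map (fun x => staircase_color (f x)) X) (map (fun x => staircase_color (f x)) Y) ->
  dual_equiv le (filling_of X) (filling_of Y).
Proof.
move=> st cf vX vY e E; have le_order := coords_order cf.
apply: (stable_dual le_order (colored_stable le_order (staircase_coloring st cf) knuth4_push_closed knuth4_rev)).
by split.
Qed.

Section Context.
Variables (B : finType) (le : rel B) (t : variety) (f : B -> nat * nat).
Hypothesis cf : coords le t f.

Lemma maximal_pair (w : seq B) c c' : c \in w -> c' \in w -> c != c' ->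
  (forall x, x \in w -> le c x -> x = c) -> (forall x, x \in w -> le c' x -> x = c') ->
  ((f c).1 < (f c').1 /\ (f c').2 < (f c).2) \/ ((f c').1 < (f c).1 /\ (f c).2 < (f c').2).
Proof.
move=> cw c'w ncc mc mc'.
have ncc1 : ~~ le c c' by apply: contra ncc => /(mc _ c'w) ->.
have ncc2 : ~~ le c' c by apply: contra ncc => /(mc' _ cw) ->.
by move: ncc1 ncc2; rewrite !(coords_le cf) /grid_le; lia.
Qed.

(** The box in the column of [c] and the row of [c'] lies below both.  A maximal
box above it, once [c] and [c'] are removed, is weakly to the right of [c] and
below it, and weakly above [c'] and to its left. *)
Lemma corner_between (w : seq B) c c' : straight le [set x in w] ->
  c \in w -> c' \in w ->
  (forall x, x \in w -> le c x -> x = c) -> (forall x, x \in w -> le c' x -> x = c') ->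
  (f c).1 < (f c').1 -> (f c').2 < (f c).2 -> boxes t ((f c).1, (f c').2) ->
  exists d, [/\ d \in w, uniq [:: d; c; c'],
    forall x, x \in w -> le d x -> x \in [:: d; c; c'],
    (f c).1 <= (f d).1 < (f c').1 & (f c').2 <= (f d).2 < (f c).2].
Proof.
move=> sw cw c'w mc mc' l1 l2 bx; have le_order := coords_order cf.
have [x fx] := coords_pre cf bx.
have ncc : c != c' by rewrite (coords_eq cf); apply: contraTneq l1 => ->; rewrite ltnn.
have xw : x \in [set x in w] :\ c :\ c'.
  rewrite !inE !(coords_eq cf) fx; apply/and3P; split.
  - by apply: contraTneq l1 => <- /=; rewrite ltnn.
  - by apply: contraTneq l2 => <- /=; rewrite ltnn.
  - have : x \in [set x in w]; last by rewrite inE.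
    apply: (sw x c); last by rewrite inE.
    by rewrite (coords_le cf) fx /grid_le /= leqnn ltnW.
have [d [dw xd] md] := exists_max le_order xw.
move: dw; rewrite !inE => /and3P [dc' dc dw].
have ncd : ~~ le c d by apply: contra dc => /(mc _ dw) ->.
have nc'd : ~~ le c' d by apply: contra dc' => /(mc' _ dw) ->.
rewrite !(coords_le cf) in ncd nc'd; rewrite (coords_le cf) fx in xd.
exists d; split=> //.
- by rewrite /= !inE negb_or dc' dc ncc.
- move=> y yw dy; rewrite !inE; case: (y =P c) => [|/eqP yc]; first by rewrite orbT.
  case: (y =P c') => [|/eqP yc']; first by rewrite !orbT.
  by rewrite (md y) ?eqxx // !inE yc yc'.
- by move: xd ncd nc'd; rewrite /grid_le /=; lia.
- by move: xd ncd nc'd; rewrite /grid_le /=; lia.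
Qed.

End Context.

Lemma peels_maximal (B : finType) (le : rel B) (l : {set B}) c c' :
  (forall x, x \in l -> le c x -> x = c) -> (forall x, x \in l -> le c' x -> x = c') ->
  peels le l [:: c; c'].
Proof.
move=> mc mc'; split=> [x xl /(mc x xl) ->|]; first by rewrite mem_head.
by split=> // x xl /(mc' x xl) ->; rewrite mem_head.
Qed.

Lemma swap_last (T : eqType) (s : seq T) c c' : s ++ [:: c; c'] =i s ++ [:: c'; c].
Proof. by move=> y; rewrite !mem_cat !inE [(y == c) || _]orbC. Qed.

Lemma uniq_swap_last (T : eqType) (s : seq T) c c' :
  uniq (s ++ [:: c; c']) = uniq (s ++ [:: c'; c]).
Proof. by apply/perm_uniq; rewrite perm_cat2l; apply/permP => p /=; rewrite addnCA. Qed.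

Lemma eq_mem_peels (B : finType) (le : rel B) (l : {set B}) a s s' : s =i s' ->
  (forall x, x \in l -> le a x -> x \in a :: s) -> forall x, x \in l -> le a x -> x \in a :: s'.
Proof. by move=> e h x xl ax; rewrite inE -e -in_cons; apply: h. Qed.

(** The box found by [corner_between] lies on a diagonal strictly between those of
the two corners, so the three boxes form a window. *)
Lemma grassmann_window (B : finType) (le : rel B) k n f : coords le (Gr k n) f ->
  window_prop le (Some 3).
Proof.
move=> cf; have le_order := coords_order cf.
have key (w : seq B) c c' : straight le [set x in w] -> c \in w -> c' \in w ->
    (forall x, x \in w -> le c x -> x = c) -> (forall x, x \in w -> le c' x -> x = c') ->
    (f c).1 < (f c').1 -> (f c').2 < (f c).2 ->
    exists d, [/\ d \in w, uniq [:: d; c; c'],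
      forall x, x \in [set x in w] -> le d x -> x \in [:: d; c; c']
    & strictly_between (grassmann_color k (f c)) (grassmann_color k (f d)) (grassmann_color k (f c'))].
  move=> sw cw c'w mc mc' l1 l2.
  have bc := coords_box cf c; have bc' := coords_box cf c'.
  have [|d [dw ud td p1 p2]] := corner_between cf sw cw c'w mc mc' l1 l2.
    by move: bc bc'; rewrite /=; lia.
  exists d; split=> // [x|]; first by rewrite inE; apply: td.
  rewrite /strictly_between /grassmann_color; apply/orP; left.
  by move: bc; rewrite /=; lia.
move=> w c c' vw sw cw c'w ncc mc mc'.
have mcs x : x \in [set x in w] -> le c x -> x = c by rewrite inE; apply: mc.
have mcs' x : x \in [set x in w] -> le c' x -> x = c' by rewrite inE; apply: mc'.
have [d [dw ud td btw]] : exists d, [/\ d \in w, uniq [:: d; c'; c],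
      forall x, x \in [set x in w] -> le d x -> x \in [:: d; c'; c]
    & strictly_between (grassmann_color k (f c')) (grassmann_color k (f d)) (grassmann_color k (f c))].
  case: (maximal_pair cf cw c'w ncc mc mc') => -[l1 l2]; last exact: key.
  have [d [dw ud td btw]] := key w c c' sw cw c'w mc mc' l1 l2; exists d; split=> //.
  - by move: ud; rewrite /= !inE !negb_or eq_sym (eq_sym c') => /andP [/andP [-> ->]].
  - by apply: eq_mem_peels td; apply: (swap_last [::]).
  - by rewrite strictly_betweenC.
have ud' : uniq [:: d; c; c'].
  by move: ud; rewrite /= !inE !negb_or (eq_sym c) => /andP [/andP [-> ->]].
apply: (@peels_window _ le _ 3 w c c' [:: d; c'] [:: d; c]) => //.
- by move=> y; rewrite !inE => /or3P [] /eqP ->.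
- exact: (swap_last [:: d]).
- by split=> //; apply: peels_maximal.
- split; last exact: peels_maximal.
  by apply: eq_mem_peels td; apply: (swap_last [::]).
move=> v1 v2; apply: (grassmann_dual cf) => //; first exact: (swap_last [:: d]).
by rewrite /= !eqxx btw.
Qed.

Lemma staircase_lt c1 c2 c1' c2' d1 d2 e1 e2 :
  c1 <= d1 < c1' -> c2' <= d2 < c2 -> c2 <= c1 -> e2 <= e1 -> c2.-1 <= e2 ->
  ~~ ((d1 <= e1) && (d2 <= e2)) ->
  e1 - e2 < d1 - d2 /\ c1 - c2 < d1 - d2 < c1' - c2'.
Proof. lia. Qed.

(** A fourth box [e] on a lower diagonal than [d] is needed.  The box diagonally
below the upper corner [c] shows that boxes remain in the row under [c] or
higher; a maximal box in the highest remaining row is not to the right of [d],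
nor in a lower row, and differs from it. *)
Lemma staircase_window (B : finType) (le : rel B) t n f : staircase t n -> coords le t f ->
  window_prop le (Some 4).
Proof.
move=> st cf; have le_order := coords_order cf; have bE p := staircaseE p st.
have key (w : seq B) c c' : straight le [set x in w] -> c \in w -> c' \in w ->
    (forall x, x \in w -> le c x -> x = c) -> (forall x, x \in w -> le c' x -> x = c') ->
    (f c).1 < (f c').1 -> (f c').2 < (f c).2 ->
    exists e d, [/\ e \in w, d \in w, uniq [:: e; d; c; c'],
      (forall x, x \in [set x in w] -> le d x -> x \in [:: d; c; c']) /\
      (forall x, x \in [set x in w] -> le e x -> x \in [:: e; d; c; c'])
    & staircase_color (f e) < staircase_color (f d) /\
      strictly_between (staircase_color (f c)) (staircase_color (f d)) (staircase_color (f c'))].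
  move=> sw cw c'w mc mc' l1 l2.
  have bc := coords_box cf c; have bc' := coords_box cf c'; rewrite !bE in bc bc'.
  have [|d [dw ud td p1 p2]] := corner_between cf sw cw c'w mc mc' l1 l2.
    by rewrite bE /=; lia.
  have bd := coords_box cf d; rewrite bE in bd.
  have [|u fu] := coords_pre cf (p := ((f c).1.-1, (f c).2.-1)); first by rewrite bE /=; lia.
  have uD : u \in [set x in w] :\ c :\ c' :\ d.
    rewrite !inE !(coords_eq cf) fu.
    have -> : u \in w.
      have : u \in [set x in w]; last by rewrite inE.
      by apply: (sw u c); rewrite ?inE // (coords_le cf) fu /grid_le /=; lia.
    case: (f c) bc l1 l2 p1 p2 => i j; case: (f c') => i' j'; case: (f d) bd => p q /=.
    by rewrite !xpair_eqE; lia.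
  (* [r] only serves to find the highest remaining row; a maximal box above it
     cannot leave that row. *)
  have [r rD rmax] := @arg_maxnP _ u (mem ([set x in w] :\ c :\ c' :\ d)) (fun z => (f z).2) uD.
  have [e [eD re] me] := exists_max le_order rD.
  have rowe : (f c).2.-1 <= (f e).2.
    have : (f u).2 <= (f r).2 by apply: rmax.
    by move: re; rewrite fu (coords_le cf) /grid_le /=; lia.
  move: eD; rewrite !inE => /and4P [ed ec' ec ew].
  have nde : ~~ le d e.
    by apply/negP => /(td _ ew); rewrite !inE (negbTE ed) (negbTE ec) (negbTE ec').
  have be := coords_box cf e; rewrite bE in be; rewrite (coords_le cf) /grid_le in nde.
  exists e, d; split=> //.
  - by rewrite cons_uniq ud andbT !inE !negb_or ed ec ec'.
  - split=> y; rewrite inE => yw; first exact: td.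
    move=> ey; rewrite inE; case: (y =P e) => //= /eqP ye; rewrite !inE.
    case: (y =P d) => //= /eqP yd; case: (y =P c) => //= /eqP yc; apply: contraNT ye => yc'.
    by apply/eqP/me => //; rewrite !inE yd yc' yc.
  - have [||h1 h2] := staircase_lt p1 p2 _ _ rowe nde;
      [by case/andP: bc; case/andP|by case/andP: be; case/andP|].
    by rewrite /strictly_between /staircase_color h1 h2.
move=> w c c' vw sw cw c'w ncc mc mc'.
have mcs x : x \in [set x in w] -> le c x -> x = c by rewrite inE; apply: mc.
have mcs' x : x \in [set x in w] -> le c' x -> x = c' by rewrite inE; apply: mc'.
have [e [d [ew dw ud [td te] [lt_ed btw]]]] :
    exists e d, [/\ e \in w, d \in w, uniq [:: e; d; c'; c],
      (forall x, x \in [set x in w] -> le d x -> x \in [:: d; c'; c]) /\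
      (forall x, x \in [set x in w] -> le e x -> x \in [:: e; d; c'; c])
    & staircase_color (f e) < staircase_color (f d) /\
      strictly_between (staircase_color (f c')) (staircase_color (f d)) (staircase_color (f c))].
  case: (maximal_pair cf cw c'w ncc mc mc') => -[l1 l2]; last exact: key.
  have [e [d [ew dw ud [td te] [lt_ed btw]]]] := key w c c' sw cw c'w mc mc' l1 l2.
  exists e, d; split=> //.
  - by rewrite (uniq_swap_last [:: e; d]).
  - by split; [apply: eq_mem_peels td; apply: (swap_last [::])
              |apply: eq_mem_peels te; apply: (swap_last [:: d])].
  - by rewrite strictly_betweenC.
have ud' : uniq [:: e; d; c; c'].
  by rewrite (uniq_swap_last [:: e; d]).
apply: (@peels_window _ le _ 4 w c c' [:: e; d; c'] [:: e; d; c]) => //.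
- by move=> y; rewrite !inE => /or4P [] /eqP ->.
- exact: (swap_last [:: e; d]).
- by split=> //; split=> //; apply: peels_maximal.
- split; first by apply: eq_mem_peels te; apply: (swap_last [:: d]).
  split; last exact: peels_maximal.
  by apply: eq_mem_peels td; apply: (swap_last [::]).
move=> v1 v2; apply: (staircase_dual st cf) => //; first exact: (swap_last [:: e; d]).
by rewrite /= !eqxx lt_ed btw.
Qed.

(** * Rectangles and staircases: the smallest pairs *)

Lemma incomparable_coords (B : finType) (le : rel B) t f : coords le t f ->
  (exists x y, ~~ le x y && ~~ le y x) ->
  exists p q, [/\ boxes t p, boxes t q, p.1 < q.1 & q.2 < p.2].
Proof.
move=> cf [x [y]]; rewrite !(coords_le cf) => /andP [h1 h2].
have bx := coords_box cf x; have b_y := coords_box cf y.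
have [lt|ge] := ltnP (f x).1 (f y).1.
  by exists (f x), (f y); split=> //; move: h1 h2; rewrite /grid_le; lia.
by exists (f y), (f x); split=> //; move: h1 h2; rewrite /grid_le; lia.
Qed.

(** The distinguished pair and its uniqueness can be stated in coordinates, where
straightness of a word means that every letter is addable to those before it. *)
Lemma coords_seed (B : finType) (le : rel B) t f m s1 s2 : coords le t f ->
  all (boxes t) s1 -> s2 =i s1 -> s1 <> s2 ->
  size s1 = m -> uniq s1 -> uniq s2 ->
  pairwise (fun p q => ~~ grid_le q p) s1 -> pairwise (fun p q => ~~ grid_le q p) s2 ->
  (forall p q, p \in s1 -> boxes t q -> grid_le q p -> q \in s1) ->
  (forall w1 w2, map f w1 = s1 -> map f w2 = s2 -> valid le w1 -> valid le w2 -> w1 =i w2 ->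
     dual_equiv le (filling_of w1) (filling_of w2)) ->
  (forall r r', (forall u p v, r = u ++ p :: v -> addable (boxes t) u p) ->
     (forall u p v, r' = u ++ p :: v -> addable (boxes t) u p) ->
     r =i r' -> size r = m -> size r' = m -> r <> r' ->
     (r = s1 /\ r' = s2) \/ (r = s2 /\ r' = s1)) ->
  exists w1 w2, [/\ dual_words le m w1 w2, straight le [set x in w1], w1 <> w2 &
    forall w w', valid le w -> valid le w' -> straight le [set x in w] -> w =i w' ->
      size w = m -> w <> w' -> (w = w1 /\ w' = w2) \/ (w = w2 /\ w' = w1)].
Proof.
move=> cf b1 e21 n12 sz u1 u2 l1 l2 str dual uniq12; have le_order := coords_order cf.
have lift s : all (boxes t) s -> exists w, map f w = s.
  elim: s => [|p s IH] /=; first by exists [::].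
  by case/andP=> /(coords_pre cf) [x <-] /IH [w <-]; exists (x :: w).
have [w1 f1] := lift s1 b1.
have b2 : all (boxes t) s2 by apply/allP => p; rewrite e21; apply: (allP b1).
have [w2 f2] := lift s2 b2.
have finj := inj_map (coords_inj cf).
have ew : w1 =i w2 by move=> x; rewrite -!(mem_map (coords_inj cf)) f1 f2 e21.
have sw1 : straight le [set x in w1] by apply: (coords_straight cf); rewrite f1.
have v1 : valid le w1 by apply: (straight_valid sw1 erefl); rewrite (coords_lin_ext cf) f1.
have v2 : valid le w2.
  apply: (straight_valid sw1); last by rewrite (coords_lin_ext cf) f2.
  by apply/setP => x; rewrite !inE ew.
exists w1, w2; split=> //.
- by split=> //; [rewrite -sz -f1 size_map | apply: dual].
- by move=> e; apply: n12; rewrite -f1 -f2 e.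
move=> w w' vw vw' sw eww szw nww.
have sw' : straight le [set x in w'].
  by move=> x y xy; rewrite !inE -!eww => yw; have := sw x y xy; rewrite !inE; apply.
have szw' : size w' = m.
  by rewrite -szw; apply/esym/perm_size/uniq_perm; [exact:
    (lin_ext_uniq le_order vw.1)|exact: (lin_ext_uniq le_order vw'.1)|].
have := uniq12 (map f w) (map f w') (fun u p v e => coords_addable cf vw sw e)
  (fun u p v e => coords_addable cf vw' sw' e).
rewrite !size_map -f1 -f2 => /(_ _ szw szw') [||[/finj -> /finj ->]|[/finj -> /finj ->]];
  [|by move/finj|by left|by right].
move=> p; apply/mapP/mapP => -[x xw ->]; exists x; rewrite // ?eww // -?eww //.
Qed.

(** Two words without repetitions that agree up to the last two letters and have the
same letters differ by the exchange of these two. *)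
Lemma last_two (T : eqType) (s : seq T) x y b c b' c' :
  b = x \/ b = y -> b' = x \/ b' = y -> uniq (s ++ [:: b; c]) -> uniq (s ++ [:: b'; c']) ->
  s ++ [:: b; c] =i s ++ [:: b'; c'] -> s ++ [:: b; c] <> s ++ [:: b'; c'] ->
  (s ++ [:: b; c] = s ++ [:: x; y] /\ s ++ [:: b'; c'] = s ++ [:: y; x]) \/
  (s ++ [:: b; c] = s ++ [:: y; x] /\ s ++ [:: b'; c'] = s ++ [:: x; y]).
Proof.
move=> eb eb'; rewrite !cat_uniq /= !inE !andbT !orbF !negb_or.
case/and3P => _ /andP [bs cs] bc /and3P [_ /andP [bs' cs'] bc'] e ne.
have ec : (c == b') || (c == c').
  by have := e c; rewrite !mem_cat !inE (negbTE cs) eqxx orbT /= => /esym.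
have ecb : (b' == b) || (b' == c).
  by have := e b'; rewrite !mem_cat !inE (negbTE bs') eqxx /=.
have ebb : (b == b') || (b == c').
  by have := e b; rewrite !mem_cat !inE (negbTE bs) eqxx /= => /esym.
have [cb|cb] := eqVneq c b'.
  subst c; have eb'' : b = c'.
    by move: ebb; rewrite (negbTE bc) /= => /eqP.
  by subst c'; case: eb bc => ->; case: eb' => ->; rewrite ?eqxx //; [left|right].
move: ec; rewrite (negbTE cb) /= => /eqP cc; subst c'.
move: ecb; rewrite [b' == c]eq_sym (negbTE cb) orbF => /eqP bb.
by rewrite bb in ne.
Qed.

Lemma grassmann_seed (B : finType) (le : rel B) k n f : coords le (Gr k n) f ->
  seed_prop le (Some 3).
Proof.
move=> cf m [<-] /(incomparable_coords cf) [p [q []]] /= bp bq l1 l2.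
have [k2 n2] : 1 < k /\ 1 < n - k by lia.
move=> {p q bp bq l1 l2}.
apply: (@coords_seed _ _ _ _ _ [:: (1, 1); (2, 1); (1, 2)] [:: (1, 1); (1, 2); (2, 1)] cf) => //.
- by rewrite /= k2 n2 !andbT; lia.
- exact: (swap_last [:: (1, 1)]).
- move=> p q; rewrite /grid_le !inE /=; case: q => q1 q2; rewrite !xpair_eqE /=.
  by case/or3P => /eqP -> /=; lia.
- move=> w1 w2 f1 f2 v1 v2 e; apply: (grassmann_dual cf) => //.
  rewrite !(map_comp (grassmann_color k) f) f1 f2 /= /grassmann_color !eqxx /=.
  by rewrite /strictly_between; apply/orP; left; apply/orP; right; lia.
have first a : addable (boxes (Gr k n)) [::] a -> a = (1, 1).
  case: a => i j; rewrite /addable !in_nil /= => h; apply/eqP; rewrite xpair_eqE; move: h; lia.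
have second a : addable (boxes (Gr k n)) [:: (1, 1)] a -> a = (2, 1) \/ a = (1, 2).
  case: a => i j; rewrite /addable /= !inE !xpair_eqE => h.
  have : ((i, j) == (2, 1)) || ((i, j) == (1, 2)) by rewrite !xpair_eqE; move: h; lia.
  by case/orP => /eqP ->; [left|right].
move=> [|a [|b [|c [|]]]] // [|a' [|b' [|c' [|]]]] // h h' e _ _ ne.
have ea := first _ (h [::] a [:: b; c] erefl); have ea' := first _ (h' [::] a' [:: b'; c'] erefl).
subst a a'.
have eb := second _ (h [:: (1, 1)] b [:: c] erefl).
have eb' := second _ (h' [:: (1, 1)] b' [:: c'] erefl).
have [_ nc _ _] := and4P (h [:: (1, 1); b] c [::] erefl).
have [_ nc' _ _] := and4P (h' [:: (1, 1); b'] c' [::] erefl).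
apply: (last_two (s := [:: (1, 1)])) => //.
- by move: nc; rewrite /= !inE !negb_or !(eq_sym c) andbT; case: eb => -> /andP [-> ->].
- by move: nc'; rewrite /= !inE !negb_or !(eq_sym c') andbT; case: eb' => -> /andP [-> ->].
Qed.

Lemma staircase_seed (B : finType) (le : rel B) t n f : staircase t n -> coords le t f ->
  seed_prop le (Some 4).
Proof.
move=> st cf m [<-] /(incomparable_coords cf) [p [q []]]; have bE p' := staircaseE p' st.
rewrite !bE => bp bq l1 l2.
have n3 : 2 < n by lia.
move=> {p q bp bq l1 l2}.
apply: (@coords_seed _ _ _ _ _ [:: (1, 1); (2, 1); (3, 1); (2, 2)]
  [:: (1, 1); (2, 1); (2, 2); (3, 1)] cf) => //.
- by rewrite /= !bE /= n3 !andbT; lia.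
- exact: (swap_last [:: (1, 1); (2, 1)]).
- move=> p q; rewrite bE /grid_le !inE /=; case: q => q1 q2; rewrite !xpair_eqE /=.
  by case/or4P => /eqP -> /=; lia.
- move=> w1 w2 f1 f2 v1 v2 e; apply: (staircase_dual st cf) => //.
  by rewrite !(map_comp staircase_color f) f1 f2.
have first a : addable (boxes t) [::] a -> a = (1, 1).
  case: a => i j; rewrite /addable !bE !in_nil /= => h; apply/eqP; rewrite xpair_eqE; move:
    h; lia.
have second a : addable (boxes t) [:: (1, 1)] a -> a = (2, 1).
  case: a => i j; rewrite /addable !bE /= !inE !xpair_eqE => h.
  by apply/eqP; rewrite !xpair_eqE; move: h; lia.
have third a : addable (boxes t) [:: (1, 1); (2, 1)] a -> a = (3, 1) \/ a = (2, 2).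
  case: a => i j; rewrite /addable !bE /= !inE !xpair_eqE => h.
  have : ((i, j) == (3, 1)) || ((i, j) == (2, 2)) by rewrite !xpair_eqE; move: h; lia.
  by case/orP => /eqP ->; [left|right].
move=> [|a [|b [|c [|d [|]]]]] // [|a' [|b' [|c' [|d' [|]]]]] // h h' e _ _ ne.
have ea := first _ (h [::] a [:: b; c; d] erefl).
have ea' := first _ (h' [::] a' [:: b'; c'; d'] erefl); subst a a'.
have eb := second _ (h [:: (1, 1)] b [:: c; d] erefl).
have eb' := second _ (h' [:: (1, 1)] b' [:: c'; d'] erefl); subst b b'.
have ec := third _ (h [:: (1, 1); (2, 1)] c [:: d] erefl).
have ec' := third _ (h' [:: (1, 1); (2, 1)] c' [:: d'] erefl).
have [_ nc _ _] := and4P (h [:: (1, 1); (2, 1); c] d [::] erefl).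
have [_ nc' _ _] := and4P (h' [:: (1, 1); (2, 1); c'] d' [::] erefl).
apply: (last_two (s := [:: (1, 1); (2, 1)])) => //.
- by move: nc; rewrite /= !inE !negb_or !(eq_sym d) andbT; case: ec => -> /and3P [-> -> ->].
- by move: nc'; rewrite /= !inE !negb_or !(eq_sym d') andbT; case: ec' => -> /and3P [-> -> ->].
Qed.

(** * Quadrics *)

Lemma odd_quadric_window (B : finType) (le : rel B) n f om : coords le (OddQuadric n) f ->
  window_prop le om.
Proof.
move=> cf w c c' _ _ cw c'w ncc mc mc'.
have := coords_box cf c; have := coords_box cf c'; rewrite !odd_quadricE.
by case: (maximal_pair cf cw c'w ncc mc mc'); lia.
Qed.

Definition equipotent (B : finType) (le : rel B) (m : nat) (X Y : seq B) :=
  [/\ valid le X, valid le Y, X =i Y & size X = m].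

Lemma card_absurd m k : 1 < m -> k < m.-2 -> m <= k.+2 -> False.
Proof. lia. Qed.

Section Diamond.
Variables (B : finType) (a b : B) (m : nat).

(** The only incomparable boxes are [a] and [b], and both have too few boxes below
them for a shape of size [m] that has [a] and [b] on top and misses one of those
boxes. *)
Definition diamond (le : rel B) := [/\ ~~ le a b, ~~ le b a,
  forall x y, ~~ le x y -> ~~ le y x -> (x = a /\ y = b) \/ (x = b /\ y = a)
  & #|[set x | slt le x a]| <= m.-2 /\ #|[set x | slt le x b]| <= m.-2].

(** The two vacated boxes are maximal in the enlarged shape.  If they differ, they are
[a] and [b], and the shape consists of these and of boxes below them other than
the one entered; these are fewer than [m]. *)
Lemma diamond_slide_closed le : partial_order le -> 1 < m -> diamond le ->
  slide_closed le (equipotent le m).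
Proof.
move=> le_order m2 [nab nba inc [ca cb]] X Y x [vX vY e sX] i.
have i' : enters le Y x by rewrite -(enters_eq le x e).
have [xX hX] := proj1 (entersP le_order x vX) i; have [xY _] := proj1 (entersP le_order x vY) i'.
have pX := valid_push le_order xX; have pY := valid_push le_order xY.
have eX := push_perm (covered le) x X; have eY := push_perm (covered le) x Y.
have lX := push_le le_order x X; have lY := push_le le_order x Y.
set rX := push _ x X in pX eX lX *; set rY := push _ x Y in pY eY lY *.
have exy : rcons rX.1 rX.2 =i rcons rY.1 rY.2.
  by move=> z; rewrite (perm_mem eX) (perm_mem eY) !inE e.
have inX : rX.2 \in rcons rX.1 rX.2 by rewrite mem_rcons mem_head.
have inY : rY.2 \in rcons rX.1 rX.2 by rewrite exy mem_rcons mem_head.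
have e2 : rX.2 = rY.2.
  apply/eqP; apply: contraT => nxy.
  have n1 : ~~ le rX.2 rY.2.
    by apply: contra nxy => /(last_max pX inY) ->.
  have n2 : ~~ le rY.2 rX.2.
    apply: contra nxy => h; apply/eqP; apply: (last_max pY _ h).
    by rewrite -exy.
  have uX := lin_ext_uniq le_order xX.1.
  (* [u] and [v] are the vacated boxes; all other letters are below [u], and [x] is
     below [u] without being a letter. *)
  have bound u v : rX.2 = u -> rY.2 = v -> #|[set z | slt le z u]| <= m.-2 ->
      (forall z, ~~ le z u -> ~~ le u z -> z = v) -> False.
    move=> eu ev cu incu.
    have sub : {subset X <= v :: u :: enum ([set z | slt le z u] :\ x)}.
      move=> z zX; rewrite !inE mem_enum !inE.
      have nzx : z != x by apply: contraTneq uX => <-; rewrite /= zX.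
      have zin : z \in rcons rX.1 rX.2 by rewrite (perm_mem eX) inE zX orbT.
      have [->|nzu] := eqVneq z u; first by rewrite orbT.
      have [zu|zu] := boolP (le z u); first by rewrite /slt nzu zu nzx !orbT.
      rewrite (incu z zu) ?eqxx //; apply: contra nzu => uz.
      by apply/eqP; rewrite -eu; apply: (last_max pX zin); rewrite eu.
    have xu : x \in [set z | slt le z u].
      rewrite inE /slt -eu lX andbT; apply: contraNneq n1 => <-; exact: lY.
    have := uniq_leq_size (lin_ext_uniq le_order vX.1) sub.
    rewrite sX /= -cardE; move: cu; rewrite (cardsD1 x) xu add1n; exact: card_absurd.
  case: (inc _ _ n1 n2) => -[eu ev]; apply/negP => _.
    apply: (bound a b eu ev ca) => z z1 z2.
    by case: (inc z a z1 z2) => -[// za _]; move: z1; rewrite za; case: le_order => -> .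
  apply: (bound b a eu ev cb) => z z1 z2.
  by case: (inc z b z1 z2) => -[// zb _]; move: z1; rewrite zb; case: le_order => ->.
split=> //; split; [exact: valid_pushed|exact: valid_pushed|exact: pushed_eq|].
by rewrite size_push.
Qed.

Lemma diamond_stable le : partial_order le -> 1 < m -> diamond le -> diamond (flip le) ->
  stable le (equipotent le m).
Proof.
move=> le_order m2 d d'.
apply: (stableI (Q' := equipotent (flip le) m)) => [X Y []//|X Y||].
- rewrite /revrel /equipotent size_rev; split=> -[v1 v2 e h];
    [case: (proj1 (revrel_valid le X Y) (And3 v1 v2 e))
    |case: (proj2 (revrel_valid le X Y) (And3 v1 v2 e))] => *; by split.
- exact: diamond_slide_closed.
- exact: diamond_slide_closed (partial_order_flip le_order) m2 d'.
Qed.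

End Diamond.

Section EvenQuadric.
Variables (B : finType) (le : rel B) (n : nat) (f : B -> nat * nat).
Hypothesis cf : coords le (EvenQuadric n) f.

Let n3 : 3 <= n. Proof. exact: (coords_ok cf). Qed.
Let bE p := even_quadricE p n3.
Let le_order := coords_order cf.

Lemma card_coords (D : {set B}) s : {subset [seq f x | x in D] <= s} -> #|D| <= size s.
Proof.
move=> sub; rewrite cardE -(size_map f); apply: uniq_leq_size => //.
by rewrite map_inj_uniq ?enum_uniq //; apply: coords_inj cf.
Qed.

Lemma even_quadric_diamond a b : f a = (n - 1, 1) -> f b = (n - 2, 2) ->
  diamond a b n le /\ diamond a b n (flip le).
Proof.
move=> fa fb.
have inc x y : ~~ le x y -> ~~ le y x -> (x = a /\ y = b) \/ (x = b /\ y = a).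
  rewrite !(coords_le cf) => h1 h2.
  have := coords_box cf x; have := coords_box cf y; rewrite !bE => hy hx.
  have [[e1 e2]|[e1 e2]] : (f x = f a /\ f y = f b) \/ (f x = f b /\ f y = f a);
    last 2 first.
  - by left; split; apply: (coords_inj cf).
  - by right; split; apply: (coords_inj cf).
  rewrite fa fb; case: (f x) h1 h2 hx => i j; case: (f y) hy => i' j'; rewrite /grid_le /=.
  move=> hy h1 h2 hx.
  have [h|h] : (i = n - 1 /\ j = 1) /\ (i' = n - 2 /\ j' = 2) \/
      (i = n - 2 /\ j = 2) /\ (i' = n - 1 /\ j' = 1) by lia.
  - by left; case: h => -[-> ->] [-> ->].
  - by right; case: h => -[-> ->] [-> ->].
have nab : ~~ le a b by rewrite (coords_le cf) fa fb /grid_le /=; lia.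
have nba : ~~ le b a by rewrite (coords_le cf) fa fb /grid_le /=; lia.
have lower c : (f c = (n - 1, 1) \/ f c = (n - 2, 2)) -> #|[set x | slt le x c]| <= n.-2.
  move=> fc; rewrite -subn2 -[n - 2](size_iota 1) -(size_map (fun i => (i, 1))).
  apply: card_coords => p /imageP [x]; rewrite inE /slt (coords_eq cf) (coords_le cf) => h ->.
  have := coords_box cf x; rewrite bE.
  case: (f x) h => i j; rewrite /grid_le => h hb; apply/mapP.
  have [hi ->] : 1 <= i <= n - 2 /\ j = 1.
    by case: fc h => ->; rewrite xpair_eqE /=; move: hb; rewrite /=; lia.
  by exists i => //; rewrite mem_iota; lia.
have upper c : (f c = (n - 1, 1) \/ f c = (n - 2, 2)) -> #|[set x | slt (flip le) x c]| <= n.-2.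
  move=> fc; rewrite -subn2 -[n - 2](size_iota (n - 1)) -(size_map (fun i => (i, 2))).
  apply: card_coords => p /imageP [x];
    rewrite inE /slt /flip (coords_eq cf) (coords_le cf) => h ->.
  have := coords_box cf x; rewrite bE.
  case: (f x) h => i j; rewrite /grid_le => h hb; apply/mapP.
  have [hi ->] : n - 1 <= i <= 2 * n - 4 /\ j = 2.
    by case: fc h => ->; rewrite xpair_eqE /=; move: hb; rewrite /=; lia.
  by exists i => //; rewrite mem_iota; lia.
split; split=> //.
- by split; apply: lower; [left|right].
- by move=> x y h1 h2; have := inc x y h2 h1.
- by split; apply: upper; [left|right].
Qed.

Lemma even_quadric_corners : exists a b, f a = (n - 1, 1) /\ f b = (n - 2, 2).
Proof.
have [|a fa] := coords_pre cf (p := (n - 1, 1)); first by rewrite bE /=; lia.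
have [|b fb] := coords_pre cf (p := (n - 2, 2)); first by rewrite bE /=; lia.
by exists a, b.
Qed.

Lemma even_quadric_card a b : f a = (n - 1, 1) -> f b = (n - 2, 2) ->
  #|[set x | le x a || le x b]| = n.
Proof.
move=> fa fb.
pose s := (n - 2, 2) :: [seq (i, 1) | i <- iota 1 (n - 1)].
have us : uniq s.
  rewrite /= map_inj_uniq ?iota_uniq ?andbT; last by move=> i j [].
  by apply/mapP => -[i _ []].
have sz : size s = n by rewrite /= size_map size_iota; lia.
rewrite -sz cardE -(size_map f); apply: perm_size; apply: uniq_perm => //.
  by rewrite map_inj_uniq ?enum_uniq //; apply: coords_inj cf.
move=> p; rewrite [p \in s]inE; apply/mapP/idP => [[x]|].
  rewrite mem_enum inE !(coords_le cf) fa fb => h ->.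
  have := coords_box cf x; rewrite bE; case: (f x) h => i j; rewrite /grid_le /= => h hb.
  have [/= hj|hj] : j = 2 /\ i = n - 2 \/ j = 1 /\ 1 <= i <= n - 1 by lia.
    by case: hj => -> ->; rewrite eqxx.
  by case: hj => -> hi; apply/orP; right; apply: map_f; rewrite mem_iota; lia.
have pre q : boxes (EvenQuadric n) q -> grid_le q (n - 1, 1) || grid_le q (n - 2, 2) ->
    exists2 x, x \in enum [set x | le x a || le x b] & q = f x.
  move=> /(coords_pre cf) [x <-]; exists x => //.
  by rewrite mem_enum inE !(coords_le cf) fa fb.
case/orP => [/eqP ->|/mapP [i]].
  by apply: pre; rewrite ?bE /grid_le /=; lia.
by rewrite mem_iota => hi ->; apply: pre; rewrite ?bE /grid_le /=; lia.
Qed.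

Lemma even_quadric_dual X Y : equipotent le n X Y -> dual_equiv le (filling_of X) (filling_of Y).
Proof.
move=> eXY; have [a [b [fa fb]]] := even_quadric_corners.
have [d d'] := even_quadric_diamond fa fb.
by apply: (stable_dual le_order (diamond_stable le_order _ d d') eXY); apply: leq_trans n3.
Qed.

(** Every box other than [a] and [b] is comparable to both of them. *)
Lemma even_quadric_ideal (l : {set B}) a b : f a = (n - 1, 1) -> f b = (n - 2, 2) ->
  straight le l -> a \in l -> b \in l ->
  (#|l| <= n \/ forall x, x \in l -> (le a x -> x = a) /\ (le b x -> x = b)) ->
  l = [set x | le x a || le x b].
Proof.
move=> fa fb sl al bl h.
have [[nab nba inc _] _] := even_quadric_diamond fa fb.
have sub : [set x | le x a || le x b] \subset l.
  by apply/subsetP => x; rewrite inE => /orP [] /sl; apply.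
case: h => [cl|mx].
  by apply/esym/eqP; rewrite eqEcard sub (even_quadric_card fa fb).
apply/eqP; rewrite eqEsubset sub andbT; apply/subsetP => x xl; rewrite inE.
have le_refl : reflexive le by case: le_order.
have [//|xa] /= := boolP (le x a).
have [ax|ax] := boolP (le a x).
  by have [/(_ ax) e _] := mx x xl; rewrite e le_refl in xa.
by case: (inc x a xa ax) => -[e _]; rewrite e le_refl // in xa *.
Qed.

Lemma even_quadric_window : window_prop le (Some n).
Proof.
move=> w c c' vw sw cw c'w ncc mc mc'.
have mcs x : x \in [set x in w] -> le c x -> x = c by rewrite inE; apply: mc.
have mcs' x : x \in [set x in w] -> le c' x -> x = c' by rewrite inE; apply: mc'.
have [a [b [fa fb]]] := even_quadric_corners.
have [[nab nba inc _] _] := even_quadric_diamond fa fb.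
have ncc1 : ~~ le c c' by apply: contra ncc => /(mc _ c'w) ->.
have ncc2 : ~~ le c' c by apply: contra ncc => /(mc' _ cw) ->.
have szw : size w = n.
  rewrite -(card_uniqP (lin_ext_uniq le_order vw.1)) -(even_quadric_card fa fb) -(even_quadric_ideal fa fb sw).
  - by rewrite cardsE.
  - by rewrite inE; case: (inc _ _ ncc1 ncc2) => -[e1 e2]; rewrite -?e1 -?e2.
  - by rewrite inE; case: (inc _ _ ncc1 ncc2) => -[e1 e2]; rewrite -?e1 -?e2.
  - right=> x; rewrite inE => xw; case: (inc _ _ ncc1 ncc2) => -[<- <-].
    + by split=> [/(mc x xw)|/(mc' x xw)].
    + by split=> [/(mc' x xw)|/(mc x xw)].
have [|P hP] := straight_words_ending le_order (s := [:: c'; c]) sw.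
  by move=> x; rewrite !inE => /orP [] /eqP ->.
have u2 : uniq [:: c'; c] by rewrite /= inE eq_sym ncc.
have u2' : uniq [:: c; c'] by rewrite /= inE ncc.
have [v1 e1] := hP [:: c'; c] (fun x => erefl _) u2 (peels_maximal mcs' mcs).
have [v2 e2] := hP [:: c; c'] (swap_last [::] c c') u2' (peels_maximal mcs mcs').
exists n, [::], (rcons P c'), (rcons P c); rewrite /= -!cats1 -!catA /=.
have eX : P ++ [:: c'; c] =i w by apply: set_mem_eq e1 erefl.
have eXY : P ++ [:: c'; c] =i P ++ [:: c; c'] by apply: set_mem_eq e1 e2.
have szX : size (P ++ [:: c'; c]) = n.
  rewrite -szw; apply: perm_size; apply: uniq_perm => //.
    exact: (lin_ext_uniq le_order v1.1).
  exact: (lin_ext_uniq le_order vw.1).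
by split=> //; split=> //; apply: even_quadric_dual.
Qed.

(** With a single incomparable pair, the word is sorted for one of the two total
orders that refine the given one. *)
Lemma lin_ext_two a b w : (forall x y, ~~ le x y -> ~~ le y x ->
  (x = a /\ y = b) \/ (x = b /\ y = a)) ->
  lin_ext le w ->
  pairwise (fun x y => le x y || (x == a) && (y == b)) w \/
  pairwise (fun x y => le x y || (x == b) && (y == a)) w.
Proof.
move=> inc lw.
have [ba|ab] := leqP (index b w) (index a w); [right|left]; apply/(pairwiseP a) => i j;
  rewrite !inE => iw jw ij; have nle := pairwiseP a lw i j iw jw ij;
  have [//|nle2] /= := boolP (le _ _); case: (inc _ _ nle2 nle) => -[ei ej];
  rewrite ?ei ?ej ?eqxx //.
- by move: ba; rewrite -ei -ej !index_uniq ?(lin_ext_uniq le_order lw) // leqNgt ij.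
- by move: ab; rewrite -ei -ej !index_uniq ?(lin_ext_uniq le_order lw) // ltnNge (ltnW ij).
Qed.

(** The boxes below [a] and [b] form a chain, so that a filling of the ideal which
they generate is determined by the order of [a] and [b]; a straight shape that
lacks one of them is a chain. *)
Lemma even_quadric_seed : seed_prop le (Some n).
Proof.
move=> _ [<-] _; have [a [b [fa fb]]] := even_quadric_corners.
have [[nab nba inc _] _] := even_quadric_diamond fa fb.
have le_refl : reflexive le by case: le_order.
have le_anti : antisymmetric le by case: le_order.
have le_trans : transitive le by case: le_order.
have nab' : a != b by apply: contraNneq nab => ->.
pose l := [set x | le x a || le x b].
have sl : straight le l.
  by move=> x y xy; rewrite !inE => /orP [] h; rewrite (le_trans _ _ _ xy h) ?orbT.
have [|P hP] := straight_words_ending le_order (s := [:: a; b]) sl.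
  by move=> x; rewrite !inE => /orP [] /eqP ->; rewrite le_refl ?orbT.
have ma x : x \in l -> le a x -> x = a.
  rewrite inE => /orP [xa ax|xb ax]; first by apply: le_anti; rewrite xa ax.
  by rewrite (le_trans _ _ _ ax xb) in nab.
have mb x : x \in l -> le b x -> x = b.
  rewrite inE => /orP [xa bx|xb bx]; last by apply: le_anti; rewrite xb bx.
  by rewrite (le_trans _ _ _ bx xa) in nba.
have u1 : uniq [:: a; b] by rewrite /= inE nab'.
have u2 : uniq [:: b; a] by rewrite /= inE eq_sym nab'.
have [v1 e1] := hP [:: a; b] (fun x => erefl _) u1 (peels_maximal ma mb).
have [v2 e2] := hP [:: b; a] (swap_last [::] b a) u2 (peels_maximal mb ma).
have e12 := set_mem_eq e1 e2.
have size_l w : valid le w -> [set x in w] = l -> size w = n.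
  move=> vw ew; rewrite -(card_uniqP (lin_ext_uniq le_order vw.1)) -(even_quadric_card fa fb) -/l -ew.
  by rewrite cardsE.
have d1 : equipotent le n (P ++ [:: a; b]) (P ++ [:: b; a]) by split=> //; apply: size_l.
exists (P ++ [:: a; b]), (P ++ [:: b; a]); split.
- by case: d1 => *; split=> //; apply: even_quadric_dual.
- by rewrite e1.
- by move=> /eqP; rewrite eqseq_cat // eqxx /= eqseq_cons (negbTE nab').
pose r u v := fun x y => le x y || (x == u) && (y == v).
have r_anti u v : ~~ le v u -> antisymmetric (r u v).
  move=> nvu x y /andP []; rewrite /r => /orP [xy|/andP [/eqP -> /eqP ->]].
    case/orP => [yx|/andP [/eqP ey /eqP ex]]; first by apply: le_anti; rewrite xy yx.
    by rewrite ex ey (negbTE nvu) in xy.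
  by rewrite (negbTE nvu) /= => /andP [_ /eqP].
have inc' x y : ~~ le x y -> ~~ le y x -> (x = b /\ y = a) \/ (x = a /\ y = b).
  by move=> h1 h2; case: (inc x y h1 h2); [right|left].
have same u v w w' : ~~ le v u -> valid le w -> valid le w' -> w =i w' ->
    pairwise (r u v) w -> pairwise (r u v) w' -> w = w'.
  move=> nvu vw vw' e h h'; apply: (pairwise_eq (r_anti u v nvu)) => //.
  apply: uniq_perm => //; [exact: (lin_ext_uniq le_order vw.1)|exact:
    (lin_ext_uniq le_order vw'.1)].
have r1 : pairwise (r a b) (P ++ [:: a; b]).
  have [//|] := lin_ext_two inc v1.1.
  by rewrite pairwise_cat /= (negbTE nab) (negbTE nab') !andbF.
have r2 : pairwise (r b a) (P ++ [:: b; a]).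
  have [|//] := lin_ext_two inc v2.1.
  by rewrite pairwise_cat /= (negbTE nba) [b == a]eq_sym (negbTE nab') !andbF.
move=> w w' vw vw' sw eww szw nww.
have inab : exists x y, [/\ x \in w, y \in w, ~~ le x y & ~~ le y x].
  have [h|] := boolP [exists x in w, exists y in w, ~~ le x y && ~~ le y x].
    case/exists_inP: h => x xw /exists_inP [y yw /andP [h1 h2]]; by exists x, y.
  move/exists_inPn => h; case: nww.
  have chain v : v =i w -> valid le v -> pairwise le v.
    move=> ev [lv _]; apply: (@sub_in_pairwise _ (mem w) _ _ _ v _ lv).
      move=> x y /= xw yw nyx; apply: contraT => nxy.
      by have /exists_inPn /(_ y yw) := h x xw; rewrite nxy nyx.
    by apply/allP => x; rewrite /= ev.
  apply: (pairwise_eq le_anti); [exact: chain|by apply: chain => // x; rewrite eww|].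
  by apply: uniq_perm => //; [exact: (lin_ext_uniq le_order vw.1)|exact:
    (lin_ext_uniq le_order vw'.1)].
have [aw bw] : a \in w /\ b \in w.
  by case: inab => x [y [xw yw h1 h2]]; case: (inc x y h1 h2) => -[<- <-].
have ew : [set x in w] = l.
  apply: (even_quadric_ideal fa fb sw); rewrite ?inE //; left.
  by rewrite cardsE (card_uniqP (lin_ext_uniq le_order vw.1)) szw.
have ew1 := set_mem_eq ew e1; have ew2 := set_mem_eq ew e2.
have ew1' x : (x \in w') = (x \in P ++ [:: a; b]) by rewrite -eww ew1.
have ew2' x : (x \in w') = (x \in P ++ [:: b; a]) by rewrite -eww ew2.
have [h|h] := lin_ext_two inc vw.1; have [h'|h'] := lin_ext_two inc vw'.1.
- by case: nww; apply: (same a b).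
- by left; split; [apply: (same a b)|apply: (same b a)].
- by right; split; [apply: (same b a)|apply: (same a b)].
- by case: nww; apply: (same b a).
Qed.

End EvenQuadric.

(** * The Cayley plane and the Freudenthal variety *)

Local Notation point := (nat * nat)%type.
Local Notation table := (seq (seq point * seq point)).

Section Table.
Variables (c o : rel point) (bx : seq point).

(** A necessary condition for [p] to be a corner: some letter covers [p], and the
boxes above [p] that have letters above them are letters themselves.  Testing
more boxes than the corners does no harm.  Conditionals take the place of
conjunctions in the costly tests, because evaluation by value would compute both
arguments of a conjunction. *)
Definition can_enter (X : seq point) (p : point) : bool :=
  if has (c p) X then
    if p \in X then false
    else all (fun z => if c p z then (if has (o z) X then z \in X else true) else true) bx
  else false.

Definition entries (X : seq point) := [seq p <- bx | can_enter X p].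

Definition table_closed (L : table) : bool :=
  all (fun XY => all (fun p =>
    let r := push c p XY.1 in let r' := push c p XY.2 in
    if r.2 == r'.2 then (r.1, r'.1) \in L else false) (entries XY.1)) L.

Definition table_images (L : table) : table :=
  flatten [seq [seq ((push c p XY.1).1, (push c p XY.2).1) | p <- entries XY.1] | XY <- L].
End Table.

Definition table_rev (L : table) : table := [seq (rev XY.1, rev XY.2) | XY <- L].

(** Breadth-first search for the pairs obtained by slides and reverse slides. *)
Fixpoint slide_orbit bx (fuel : nat) (seen front : table) : table :=
  if fuel is fuel'.+1 then
    let new := table_images right_or_up grid_le bx front ++
      table_rev (table_images (flip right_or_up) (flip grid_le) bx (table_rev front)) in
    let new' := undup [seq z <- new | z \notin seen] in
    slide_orbit bx fuel' (new' ++ seen) new'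
  else seen.

Definition cayley_rows := [:: (1, 5); (3, 5); (4, 6); (4, 8)].
Definition freudenthal_rows := [:: (1, 6); (4, 6); (5, 7); (5, 9); (5, 9); (8, 9);
                               (9, 9); (9, 9); (9, 9)].

Definition cayley_seed : seq point * seq point :=
  ([:: (1, 1); (2, 1); (3, 1); (4, 1); (3, 2)], [:: (1, 1); (2, 1); (3, 1); (3, 2); (4, 1)]).
Definition freudenthal_seed : seq point * seq point :=
  ([:: (1, 1); (2, 1); (3, 1); (4, 1); (5, 1); (4, 2)],
   [:: (1, 1); (2, 1); (3, 1); (4, 1); (4, 2); (5, 1)]).

Definition cayley_table := Eval vm_compute in slide_orbit (rows_boxes cayley_rows) 30 [::
  cayley_seed] [:: cayley_seed].
Definition freudenthal_table := Eval vm_compute in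
  slide_orbit (rows_boxes freudenthal_rows) 50 [:: freudenthal_seed] [:: freudenthal_seed].


Definition table_swap (L : table) : table := [seq (XY.2, XY.1) | XY <- L].

(** A normal form for straight shapes: the boxes listed in the order of [bx]. *)
Definition ideal_of bx (s : seq point) := [seq p <- bx | p \in s].

Definition ideal_images bx (Js : seq (seq point)) : seq (seq point) :=
  flatten [seq [seq ideal_of bx (p :: J) | p <- bx & addable (mem bx) J p] | J <- Js].

Fixpoint ideals bx (fuel : nat) (front : seq (seq point)) : seq (seq point) :=
  if fuel is fuel'.+1 then front ++ ideals bx fuel' (undup (ideal_images bx front)) else front.

Definition ideals_closed bx (Js : seq (seq point)) :=
  all (fun J => all (fun p =>
    if addable (mem bx) J p then ideal_of bx (p :: J) \in Js else true) bx) Js.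

Definition grid_lin_ext (s : seq point) := pairwise (fun p q => ~~ grid_le q p) s.

Definition table_wf m (L : table) :=
  all (fun XY => [&& size XY.1 == m, perm_eq XY.1 XY.2, grid_lin_ext XY.1 & grid_lin_ext XY.2]) L.

Definition window_found (J : seq point) (c c' : point) (XY : seq point * seq point) :=
  if last c' XY.1 == c then
    if last c XY.2 == c' then
      if all (fun p => p \in J) XY.1 then
        all (fun p => all (fun q => if grid_le p q then q \in XY.1 else true) J) XY.1
      else false
    else false
  else false.

Definition corner_of (J : seq point) (c : point) := all (fun p =>
  if grid_le c p then p == c else true) J.

Definition windows_found (Js : seq (seq point)) (L : table) :=
  all (fun J => all (fun c => if corner_of J c then
    all (fun c' => if corner_of J c' then if c == c' then true else has (window_found J c c') L
      else true) J else true) J) Js.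

Fixpoint straight_words bx (m : nat) : seq (seq point) :=
  if m is m'.+1 then
    flatten [seq [seq rcons s p | p <- bx & addable (mem bx) s p] | s <- straight_words bx m']
  else [:: [::]].

Definition seed_found bx m (s1 s2 : seq point) :=
  all (fun r => all (fun r' => if r == r' then true else if perm_eq r r' then
     (r == s1) && (r' == s2) || (r == s2) && (r' == s1) else true) (straight_words bx m))
    (straight_words bx m).

Definition is_ideal bx (s : seq point) := all (fun p => all (fun q =>
  if grid_le q p then q \in s else true) bx) s.

(** All that has to be computed for an exceptional variety: [L] is the table of
pairs, [Js] lists the straight shapes, [s1] and [s2] are the smallest pair. *)
Record certificate bx m (L : table) (Js : seq (seq point)) (s1 s2 : seq point) : Prop :=
  Certificate {
  cert_closed : table_closed right_or_up grid_le bx L;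
  cert_closed_rev : table_closed (flip right_or_up) (flip grid_le) bx (table_rev L);
  cert_wf : table_wf m L;
  cert_root : [::] \in Js;
  cert_ideals : ideals_closed bx Js;
  cert_windows : windows_found Js (L ++ table_swap L);
  cert_seed : seed_found bx m s1 s2;
  cert_s1 : (s1, s2) \in L;
  cert_ideal : is_ideal bx s1;
  cert_in : all (mem bx) s1;
  cert_neq : s1 != s2 }.

Definition cayley_ideals := Eval vm_compute in ideals (rows_boxes cayley_rows) 16 [:: [::]].
Definition freudenthal_ideals :=
  Eval vm_compute in ideals (rows_boxes freudenthal_rows) 27 [:: [::]].

Lemma cayley_certificate : certificate (rows_boxes cayley_rows) 5 cayley_table cayley_ideals
  cayley_seed.1 cayley_seed.2.
Proof. by split; vm_compute. Qed.

Lemma freudenthal_certificate : certificate (rows_boxes freudenthal_rows) 6 freudenthal_table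
  freudenthal_ideals freudenthal_seed.1 freudenthal_seed.2.
Proof. by split; vm_compute. Qed.

Section Exceptional.
Variables (B : finType) (f : B -> point) (bx : seq point).
Hypotheses (f_inj : injective f) (f_im : forall p, p \in bx <-> exists x, f x = p).

Let f_bx x : f x \in bx. Proof. by apply/f_im; exists x. Qed.

Definition tabled (le : rel B) (L : table) X Y :=
  [/\ valid le X, valid le Y, X =i Y & (map f X, map f Y) \in L].

Lemma can_enter_corner (le : rel B) c o a X : partial_order le ->
  (forall x y, covered le x y = c (f x) (f y)) -> (forall x y, le x y = o (f x) (f y)) ->
  valid le X -> enters le X a -> can_enter c o bx (map f X) (f a).
Proof.
move=> le_order hc ho vX /(entersP le_order a vX) [v h].
have ax : a \notin X by case/andP: (lin_ext_uniq le_order v.1).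
rewrite /can_enter has_map.
have -> : has (preim f (c (f a))) X.
  have pne : (push (covered le) a X).2 != a.
    have vp := valid_push le_order v; apply/eqP => e.
    case/hasP: h => x xX ax'; have := mem_push (covered le) a X x; rewrite inE xX orbT e.
    rewrite (_ : x == a = false) /=; last by apply: contraNF ax => /eqP <-.
    move=> /esym xp; move: vp.1; rewrite /lin_ext pairwise_rcons e => /andP [/allP /(_ x xp)].
    by rewrite ax'.
  have : has (covered le a) X.
    by apply: contraNT pne => h'; rewrite push_id.
  by apply: sub_has => x /=; rewrite hc.
rewrite mem_map // (negbTE ax); apply/allP => _ /f_im [z <-]; case: ifP => // az.
case: ifP => // /hasP [_ /mapP [y yX ->] zy]; rewrite mem_map //.
have laz : le a z by apply: covered_le; rewrite hc.
have := v.2 a z y (mem_head _ _); rewrite inE yX orbT laz ho zy => /(_ isT isT isT).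
rewrite inE => /orP [/eqP za|//]; move: az; rewrite -hc za.
by rewrite /covered /slt eqxx.
Qed.

Lemma tabled_slide_closed (le : rel B) c o L : partial_order le ->
  (forall x y, covered le x y = c (f x) (f y)) -> (forall x y, le x y = o (f x) (f y)) ->
  table_closed c o bx L -> slide_closed le (tabled le L).
Proof.
move=> le_order hc ho /allP chk X Y a [vX vY e XYL] i.
have i' : enters le Y a by rewrite -(enters_eq le a e).
have [aX _] := proj1 (entersP le_order a vX) i; have [aY _] := proj1 (entersP le_order a vY) i'.
have en : f a \in entries c o bx (map f X).
  by rewrite mem_filter (can_enter_corner le_order hc ho vX i) f_bx.
move/allP: (chk _ XYL) => /(_ _ en) /=.
rewrite !(map_push _ _ hc) /=; case: eqP => // /f_inj e2 L1.
by split=> //; split=> //; [exact: valid_pushed|exact: valid_pushed|exact: pushed_eq].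
Qed.

Lemma tabled_stable (le : rel B) L : partial_order le ->
  (forall x y, covered le x y = right_or_up (f x) (f y)) -> (forall x y,
    le x y = grid_le (f x) (f y)) ->
  table_closed right_or_up grid_le bx L ->
  table_closed (flip right_or_up) (flip grid_le) bx (table_rev L) -> stable le (tabled le L).
Proof.
move=> le_order hc ho c1 c2.
apply: (stableI (Q' := tabled (flip le) (table_rev L))) => [X Y []//|X Y||].
- have eL : ((map f (rev X), map f (rev Y)) \in L) = ((map f X, map f Y) \in table_rev L).
    rewrite !map_rev; apply/idP/mapP => [XYL|[[U V] UV [-> ->]]]; last by rewrite !revK.
    by exists (rev (map f X), rev (map f Y)); rewrite ?revK.
  rewrite /revrel /tabled eL; split=> -[v1 v2 e h];
    [case: (proj1 (revrel_valid le X Y) (And3 v1 v2 e))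
    |case: (proj2 (revrel_valid le X Y) (And3 v1 v2 e))] => *; by split.
- exact: tabled_slide_closed c1.
apply: tabled_slide_closed c2; first exact: partial_order_flip.
  by move=> x y; rewrite (covered_flip le x y) hc.
by move=> x y; rewrite /flip ho.
Qed.

Lemma dual_equiv_sym (le : rel B) T U : dual_equiv le T U -> dual_equiv le U T.
Proof. by move=> d s U' T' sU sT; apply/esym/(d s). Qed.

End Exceptional.

Lemma rows_boxesE rows p : (p \in rows_boxes rows) = in_rows rows p.
Proof.
apply/idP/idP => [|/mem_rows_boxes //].
case/flattenP => _ /mapP [j + ->]; rewrite mem_iota => /andP [_ jr] /mapP [i + ->].
rewrite /in_rows /= mem_iota; case: (nth _ _ _) => u v /=; lia.
Qed.

Lemma peels_of_lin (B : finType) (le : rel B) (l : {set B}) (s : seq B) : lin_ext le s ->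
  (forall a x, a \in s -> x \in l -> le a x -> x \in s) -> peels le l s.
Proof.
move=> ls up; suff gen s1 s2 : s1 ++ s2 = s -> peels le l s2 by apply: (gen [::]).
elim: s2 s1 => //= a s2 IH s1 es; split; last by apply: (IH (rcons s1 a)); rewrite cat_rcons.
move=> x xl ax; have := up a x _ xl ax; rewrite -es !mem_cat mem_head orbT => /(_ isT).
case/orP=> // xs1; move: ls; rewrite -es lin_ext_cat => /and3P [_ _ /allP /(_ x xs1) /=].
by rewrite ax.
Qed.

Section Certified.
Variables (B : finType) (le : rel B) (t : variety) (f : B -> point).
Variables (rows : seq (nat * nat)) (m : nat) (L : table) (Js : seq (seq point)) (s1 s2 :
  seq point).
Hypothesis cf : coords le t f.
Hypothesis tE : boxes t =1 in_rows rows.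
Let bx := rows_boxes rows.
Hypothesis cert : certificate bx m L Js s1 s2.

Let le_order := coords_order cf.
Let f_inj := coords_inj cf.

Let bxE p : (p \in bx) = boxes t p. Proof. by rewrite rows_boxesE tE. Qed.

Let f_im p : p \in bx <-> exists x, f x = p.
Proof. by rewrite bxE; apply: (coords_im cf). Qed.

Let f_bx x : f x \in bx. Proof. by apply/f_im; exists x. Qed.

Let L_stable : stable le (tabled f le L).
Proof.
apply: (tabled_stable f_inj f_im le_order (coords_cov cf) (coords_le cf)).
- exact: cert_closed cert.
- exact: cert_closed_rev cert.
Qed.

Lemma exceptional_dual X Y : valid le X -> valid le Y -> X =i Y ->
  (map f X, map f Y) \in L ++ table_swap L -> dual_equiv le (filling_of X) (filling_of Y).
Proof.
move=> vX vY e; rewrite mem_cat => /orP [h|/mapP [[U V] UV [eX eY]]].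
  by apply: (stable_dual le_order L_stable).
apply: dual_equiv_sym; apply: (stable_dual le_order L_stable); split=> //.
by rewrite eX eY.
Qed.

Lemma eq_addable b1 b2 s s' p : b1 =1 b2 -> {in b1, s =i s'} -> addable b1 s p = addable b2 s' p.
Proof.
move=> b12 ss'; rewrite /addable -!b12.
case bp: (b1 p) => //=; rewrite ss' //; congr (_ && _).
have h q : (0 < p.1) && b1 q ==> (q \in s) = ((0 < p.1) && b1 q ==> (q \in s')).
  by case bq: (b1 q); rewrite ?andbF // ss'.
have h' q : (0 < p.2) && b1 q ==> (q \in s) = ((0 < p.2) && b1 q ==> (q \in s')).
  by case bq: (b1 q); rewrite ?andbF // ss'.
by rewrite h h'.
Qed.

Lemma mem_ideal_of s p : p \in bx -> (p \in ideal_of bx s) = (p \in s).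
Proof. by move=> pb; rewrite mem_filter pb andbT. Qed.

(** A straight shape is reached from the empty one by adding the letters of any of
its words. *)
Lemma ideal_in w : valid le w -> straight le [set z in w] -> ideal_of bx (map f w) \in Js.
Proof.
move=> vw sw; suff gen s s' : s ++ s' = w -> ideal_of bx (map f s) \in Js.
  by apply: (gen w [::]); rewrite cats0.
elim/last_ind: s s' => [|s x IH] s' es.
  by rewrite /= /ideal_of (eq_filter (a2 := pred0)) // filter_pred0; apply: cert_root cert.
rewrite cat_rcons in es; have Js_s := IH _ es.
have ad : addable (boxes t) (map f s) (f x).
  by apply: (coords_addable cf vw sw (s2 := map f s')); rewrite -es map_cat.
have := allP (cert_ideals cert) _ Js_s => /allP /(_ _ (f_bx x)).
rewrite (_ : addable _ _ _ = true); last first.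
  rewrite -ad; apply: eq_addable => [p|p pb]; first by rewrite /= bxE.
  exact: mem_ideal_of.
rewrite /ideal_of (@eq_in_filter _ _ [pred p | p \in map f (rcons s x)]) // => p pb.
by rewrite /= inE (mem_ideal_of _ pb) map_rcons mem_rcons inE.
Qed.

Lemma lift_word (w : seq B) r : all (fun p => p \in map f w) r -> exists2 s,
  map f s = r & {subset s <= w}.
Proof.
elim: r => [|p r IH] /=; first by exists [::].
case/andP => /mapP [x xw ->] /IH [s <- sw]; exists (x :: s) => // y.
by rewrite inE => /predU1P [->|/sw].
Qed.

(** The table of pairs is searched for a window once for every straight shape and
every pair of its maximal boxes; the search is part of the certificate. *)
Lemma exceptional_window : window_prop le (Some m).
Proof.
move=> w c c' vw sw cw c'w ncc mc mc'.
pose J := ideal_of bx (map f w).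
have JE x : (f x \in J) = (x \in w) by rewrite mem_ideal_of // mem_map.
have Jw p : p \in J -> p \in map f w by rewrite mem_filter => /andP [].
have corner d : d \in w -> (forall x, x \in w -> le d x -> x = d) -> corner_of J (f d).
  move=> dw md; apply/allP => p /Jw /mapP [x xw ->]; rewrite -(coords_le cf).
  by case: ifP => // /(md x xw) ->; rewrite eqxx.
have := allP (cert_windows cert) _ (ideal_in vw sw) => /allP /(_ (f c)).
rewrite JE corner // => /(_ cw) /allP /(_ (f c')); rewrite JE corner // => /(_ c'w).
rewrite (inj_eq f_inj) (negbTE ncc) => /hasP [[X Y] XYL].
rewrite /window_found /=; case: eqP => // eX; case: eqP => // eY; case: ifP => // XJ upX.
have wf : [&& size X == m, perm_eq X Y, grid_lin_ext X & grid_lin_ext Y].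
  move: XYL; rewrite mem_cat =>
    /orP [/(allP (cert_wf cert)) //|/mapP [[U V] /(allP (cert_wf cert))]].
  by case/and4P => /= /eqP sU pUV lU lV [-> ->];
    rewrite -(perm_size pUV) sU eqxx perm_sym pUV lU lV.
case/and4P: wf => /eqP sX pXY lX lY.
have [|X0 fX0 X0w] := @lift_word w X; first by apply: sub_all XJ => p; apply: Jw.
have [|Y0 fY0 Y0w] := @lift_word w Y.
  by rewrite -(perm_all _ pXY); apply: sub_all XJ => p; apply: Jw.
have eXY : Y0 =i X0.
  by move=> x; rewrite -(mem_map f_inj) -(mem_map f_inj X0) fX0 fY0 (perm_mem pXY).
have lX0 : lin_ext le X0 by rewrite (coords_lin_ext cf) fX0.
have lY0 : lin_ext le Y0 by rewrite (coords_lin_ext cf) fY0.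
have tX0 : peels le [set x in w] X0.
  apply: peels_of_lin => // a x aX; rewrite inE => xw ax.
  have faX : f a \in X by rewrite -fX0 map_f.
  have := allP upX _ faX => /allP /(_ (f x)); rewrite JE => /(_ xw).
  by rewrite -(coords_le cf) ax -fX0 mem_map.
have tY0 : peels le [set x in w] Y0.
  apply: peels_of_lin => // a x; rewrite eXY => aX xw ax.
  by rewrite eXY; apply: (peels_up tX0 aX).
have m0 : 0 < size X.
  case: X eX {XYL XJ upX sX pXY lX fX0} => //= e; move/f_inj: e => e.
  by rewrite e eqxx in ncc.
have szX0 : size X0 = m by rewrite -sX -fX0 size_map.
case/lastP: X0 => [|X1 x] in fX0 X0w eXY lX0 tX0 szX0 *; first by rewrite -fX0 in m0.
case/lastP: Y0 => [|Y1 y] in fY0 Y0w eXY lY0 tY0 *.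
  by have := eXY x; rewrite mem_rcons mem_head.
have xc : x = c by apply: f_inj; rewrite -eX -fX0 map_rcons last_rcons.
have yc : y = c' by apply: f_inj; rewrite -eY -fY0 map_rcons last_rcons.
subst x y.
apply: (@peels_window _ le _ m w c c' X1 Y1) => //.
- exact: (lin_ext_uniq le_order lX0).
- exact: (lin_ext_uniq le_order lY0).
- by rewrite -szX0 size_rcons.
- by rewrite -sX.
by move=> v1 v2; apply: exceptional_dual => //; rewrite ?fX0 ?fY0.
Qed.

Lemma straight_words_gen r : (forall u p v, r = u ++ p :: v -> addable (boxes t) u p) ->
  r \in straight_words bx (size r).
Proof.
elim/last_ind: r => //= r p IH h; rewrite size_rcons /=.
apply/flattenP; exists [seq rcons r q | q <- bx & addable (mem bx) r q].
  by apply: map_f; apply: IH => u q v e; apply: (h u q (rcons v p)); rewrite e rcons_cat.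
apply: map_f; have ad : addable (boxes t) r p by apply: (h r p [::]); rewrite cats1.
rewrite mem_filter bxE (_ : addable _ _ _ = true); first by case/and4P: ad.
by rewrite -ad; apply: eq_addable => // q; rewrite /= bxE.
Qed.

Lemma exceptional_seed : seed_prop le (Some m).
Proof.
move=> _ [<-] _.
have /and4P [/eqP sz p12 l1 l2] := allP (cert_wf cert) _ (cert_s1 cert);
  rewrite /= in sz p12 l1 l2.
have al r : grid_lin_ext r -> uniq r.
  apply: pairwise_uniq => p; rewrite /grid_le !leqnn //.
have ss1 := cert_in cert.
apply: (@coords_seed _ _ _ _ _ s1 s2 cf) => //.
- by apply: sub_all ss1 => p; rewrite /= bxE.
- by move=> p; rewrite (perm_mem p12).
- exact/eqP/(cert_neq cert).
- exact: al.
- exact: al.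
- move=> p q ps; rewrite -bxE => qb qp.
  by have := allP (cert_ideal cert) p ps => /allP /(_ q qb); rewrite qp.
- move=> w1 w2 f1 f2 v1 v2 e; apply: exceptional_dual => //.
  by rewrite f1 f2 mem_cat (cert_s1 cert).
move=> r r' hr hr' e szr szr' nrr.
have rW := straight_words_gen hr; have rW' := straight_words_gen hr'; rewrite szr in rW;
  rewrite szr' in rW'.
have ur q : (forall u p v, q = u ++ p :: v -> addable (boxes t) u p) -> uniq q.
  elim/last_ind: q => //= q p IH h; rewrite rcons_uniq IH ?andbT; last first.
    by move=> u p' v eq; apply: (h u p' (rcons v p)); rewrite eq rcons_cat.
  by case/and4P: (h q p [::] (esym (cats1 q p))).
have pr : perm_eq r r' by apply: uniq_perm => //; apply: ur.
have := allP (cert_seed cert) _ rW => /allP /(_ _ rW'); rewrite pr; case: eqP => // _.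
by case/orP => /andP [/eqP -> /eqP ->]; [left|right].
Qed.

End Certified.

(** * Root posets and the theorem *)

Section RootPoset.
Import GRing.Theory Num.Theory.
Local Open Scope ring_scope.
Variables (R : realFieldType) (n r : nat) (Phi : {fset 'rV[R]_n}) (Delta : r.-tuple 'rV[R]_n).
Hypothesis freeD : free Delta.

Definition height (g : 'rV[R]_n) : R := \sum_(i < r) coord Delta i g.

Lemma height_simple a g : g - a \in Delta -> height g = height a + 1.
Proof.
case/tnthP => j e; have -> : g = tnth Delta j + a by rewrite -e subrK.
rewrite /height; under eq_bigr do rewrite linearD.
rewrite big_split /= addrC; congr (_ + _).
under eq_bigr => i _ do rewrite (tnth_nth 0) coord_free //.
rewrite (bigD1 j) //= eqxx big1 ?addr0 // => i /negbTE ij.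
by rewrite -[(_ == _)%N]/(j == i) eq_sym ij.
Qed.

Lemma height_path (a : posroots Phi Delta) p :
  path (fun a g : posroots Phi Delta => val g - val a \in Delta) a p ->
  height (val (last a p)) = height (val a) + (size p)%:R.
Proof.
elim: p a => [|b p IH] a /=; first by rewrite addr0.
by case/andP => /height_simple ab /IH ->; rewrite ab -addrA -natr1 [1 + _]addrC.
Qed.

(** Only antisymmetry needs an argument: the height increases along every cover. *)
Lemma root_le_order : partial_order (@root_le R n r Phi Delta).
Proof.
split.
- by move=> x; apply: connect0.
- move=> x y /andP [/connectP [p pp ey] /connectP [q qp ex]].
  have h1 := height_path pp; have h2 := height_path qp; rewrite -ey in h1; rewrite -ex in h2.
  move: h2; rewrite h1 -addrA -natrD => /eqP.
  rewrite -subr_eq0 opprD addrA subrr sub0r oppr_eq0 pnatr_eq0 addn_eq0.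
  by case: (p) ey => [->|].
- by move=> y x z; apply: connect_trans.
Qed.

Lemma box_le_order b : partial_order (@box_le R n r Phi Delta b).
Proof.
case: root_le_order => rr ra rt; split.
- by move=> x; apply: rr.
- by move=> x y h; apply/val_inj/ra.
- by move=> y x z; apply: rt.
Qed.

End RootPoset.

Lemma coords_main (B : finType) (le : rel B) t f : coords le t f ->
  window_prop le (mnum t) /\ seed_prop le (mnum t).
Proof.
case: t => [k n|n|n|n|n||] cf /=.
- split; [exact: grassmann_window cf|exact: grassmann_seed cf].
- split; [exact: odd_quadric_window cf|by []].
- have st : staircase (LG n) n by left.
  by split; [exact: staircase_window st cf|exact: staircase_seed st cf].
- have st : staircase (OG n) n by right.
  by split; [exact: staircase_window st cf|exact: staircase_seed st cf].
- split; [exact: even_quadric_window cf|exact: even_quadric_seed cf].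
- split; [exact: (exceptional_window cf (fun=> erefl) cayley_certificate)
          |exact: (exceptional_seed cf (fun=> erefl) cayley_certificate)].
- split; [exact: (exceptional_window cf (fun=> erefl) freudenthal_certificate)
          |exact: (exceptional_seed cf (fun=> erefl) freudenthal_certificate)].
Qed.

Theorem theorem1p1 (R : realFieldType) (n r : nat)
  (Phi : {fset 'rV[R]_n}) (Delta : r.-tuple 'rV[R]_n) (b : 'I_r) (t : variety)
  (hPhi : root_system Phi) (hDelta : simple_system Phi Delta)
  (hb : cominuscule Phi Delta b)
  (ht : has_type (@box_le R n r Phi Delta b) t) :
  let le := @box_le R n r Phi Delta b in
  (* (I) *)
  (forall (l : {set box Phi Delta b}) (T U : filling (box Phi Delta b)),
     straight le l -> SYT le l T -> SYT le l U -> dual_equiv le T U)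
  /\
  (* (II) *)
  (forall (l v : {set box Phi Delta b}) (X Y : filling (box Phi Delta b)),
     straight le l -> straight le v -> l \subset v ->
     SYT le (v :\: l) X -> SYT le (v :\: l) Y ->
     (dual_equiv le X Y <-> elementary_chain le (mnum t) X Y))
  /\
  (* (III); when Lambda is a chain, every shape has a single filling, and no
     claim is made *)
  (forall m : nat, mnum t = Some m ->
     (exists x y : box Phi Delta b, ~~ le x y && ~~ le y x) ->
     exists (s : {set box Phi Delta b}) (T U : filling (box Phi Delta b)),
       [/\ [/\ straight le s, #|s| = m, SYT le s T, SYT le s U & T <> U],
           dual_equiv le T U,
           forall V, SYT le s V -> V = T \/ V = U,
           forall (s' : {set box Phi Delta b}) (T' U' : filling (box Phi Delta b)),
             straight le s' -> #|s'| = m ->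
             SYT le s' T' -> SYT le s' U' -> T' <> U' -> s' = s
         & forall (l v : {set box Phi Delta b}) (X Y : filling (box Phi Delta b)),
             straight le l -> straight le v -> l \subset v -> #|v :\: l| = m ->
             SYT le (v :\: l) X -> SYT le (v :\: l) Y -> X <> Y ->
             dual_equiv le X Y ->
             exists q : seq (box Phi Delta b),
               (slides le q T = Some X /\ slides le q U = Some Y) \/
               (slides le q T = Some Y /\ slides le q U = Some X)]).
Proof.
have [freeD _ _] := hDelta; have [ok [f [f_inj f_im f_cov]]] := ht.
have le_order := box_le_order Phi freeD b.
have [win seed] := coords_main (Coords le_order ok f_inj f_im f_cov).
exact: dual_equivalence_of_windows le_order win seed.
Qed.
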